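(* Let $N$ be a real hypersurface of $\mathbf C^3$ with unit normal vector field $\xi$. Then $$Ric(J\xi,J\xi)\leq \frac{25}{2}H^2.$$ If the equality case holds identically, then $N$ is a totally real $3$-ruled minimal submanifold of $\mathbf C^3$.
   Context: $\mathbf C^3$ is the complex Euclidean $3$-space with its standard flat Kähler structure (complex structure $J$, metric $\langle\,,\rangle$). For a real hypersurface $N$ (real dimension $n=5$), $Ric$ is the Ricci tensor of $N$, $\overrightarrow H=\frac1n\,\mathrm{trace}\,\sigma$ is the mean curvature vector ($\sigma$ the second fundamental form), $H^2=\langle\overrightarrow H,\overrightarrow H\rangle$, and $N$ is minimal if $\overrightarrow H=0$ identically. A submanifold $V$ of a Kähler manifold is totally real if $J(T_xV)\subset T_x^\perp V$ for each $x\in V$. A real hypersurface $N$ of a Kähler manifold $\tilde M$ with $\dim_{\mathbf C}\tilde M=m$ is called totally real $m$-ruled if for each point $x\in N$ there exists an $m$-dimensional totally real totally geodesic submanifold $V^m_x$ of $N$ through $x$. *)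

(* Defs.v *)
From mathcomp Require Import all_boot all_order all_algebra.
From mathcomp Require Import all_classical all_reals all_analysis.

Set Implicit Arguments.
Unset Strict Implicit.
Unset Printing Implicit Defensive.

Import Order.TTheory GRing.Theory Num.Theory.
Import numFieldNormedType.Exports.

Local Open Scope classical_set_scope.
Local Open Scope ring_scope.

(* The norm of ['rV[R]_p] is the sup norm; it only provides the topology and
   the derivatives. The Euclidean metric is [dot]. *)
Definition dot (R : realType) (p : nat) (v w : 'rV[R]_p) : R :=
  (v *m w^T) 0 0.

(* C^m is R^(m + m), with x + i y represented by [row_mx x y]. *)
Definition cplxJ (R : realType) (m : nat) (v : 'rV[R]_(m + m)) :
    'rV[R]_(m + m) :=
  row_mx (- rsubmx v) (lsubmx v).

(* C^oo on an open set: every iterated directional derivative is (Frechet)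
   differentiable at every point of [U]. *)
Definition smooth_on (R : realType) (n p : nat) (U : set 'rV[R]_n)
    (F : 'rV[R]_n -> 'rV[R]_p) : Prop :=
  forall (vs : seq 'rV[R]_n) (u : 'rV[R]_n), U u ->
    differentiable (foldr (fun v G => 'D_v G) F vs) u.

(* The values of [cmap] outside [cdom] and of [cinv] outside [ccod] are
   irrelevant. *)
Record chart (R : realType) (n : nat) (M : topologicalType) := Chart {
  cdom : set M;
  ccod : set 'rV[R]_n;
  cmap : M -> 'rV[R]_n;
  cinv : 'rV[R]_n -> M;
  cdom_open : open cdom;
  ccod_open : open ccod;
  cmap_cod : forall x, cdom x -> ccod (cmap x);
  cinv_dom : forall u, ccod u -> cdom (cinv u);
  cmapK : forall x, cdom x -> cinv (cmap x) = x;
  cinvK : forall u, ccod u -> cmap (cinv u) = u;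
  cmap_continuous : {within cdom, continuous cmap};
  cinv_continuous : {within ccod, continuous cinv}
}.

(* [chart_at x] is a preferred chart around [x]; tensors at [x] are computed in
   it, and do not depend on this choice. *)
Record smoothManifold (R : realType) (n : nat) := SmoothManifold {
  carrier :> topologicalType;
  carrier_hausdorff : hausdorff_space carrier;
  carrier_second_countable : @second_countable carrier;
  atlas : set (chart R n carrier);
  chart_at : carrier -> chart R n carrier;
  chart_at_atlas : forall x, atlas (chart_at x);
  chart_at_dom : forall x, cdom (chart_at x) x;
  atlas_smooth : forall c d, atlas c -> atlas d ->
    smooth_on (ccod c `&` cinv c @^-1` cdom d) (cmap d \o cinv c)
}.

Section LocalGeometry.
Context {R : realType}.

(* Levi-Civita connection of the metric [g] : Gamma^k_ij. *)
Definition christoffel n (g : 'rV[R]_n -> 'M[R]_n) (k i j : 'I_n)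
    (u : 'rV[R]_n) : R :=
  2^-1 * \sum_l invmx (g u) k l *
    ('D_('e_i) (fun v => g v j l : R^o) u
     + 'D_('e_j) (fun v => g v i l : R^o) u
     - 'D_('e_l) (fun v => g v i j : R^o) u).

(* The component along d_l of R(d_i, d_j) d_k, with the convention
   R(X, Y) Z = nabla_X nabla_Y Z - nabla_Y nabla_X Z - nabla_[X, Y] Z. *)
Definition curvature n (g : 'rV[R]_n -> 'M[R]_n) (l k i j : 'I_n)
    (u : 'rV[R]_n) : R :=
  'D_('e_i) (christoffel g l j k : _ -> R^o) u
  - 'D_('e_j) (christoffel g l i k : _ -> R^o) u
  + \sum_m (christoffel g l i m u * christoffel g m j k u
            - christoffel g l j m u * christoffel g m i k u).

(* Ric(Y, Z) = trace (X |-> R(X, Y) Z). *)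
Definition ricci n (g : 'rV[R]_n -> 'M[R]_n) (u : 'rV[R]_n) : 'M[R]_n :=
  \matrix_(j, k) \sum_i curvature g i k i j u.

(* Gauss formula sigma(X, Y) = nabla~_X Y - nabla_X Y for X = d_i, Y = d_j,
   in coordinates: [g] is the metric of the submanifold, [h] the metric of the
   ambient space and [F] the inclusion. *)
Definition local_sff n p (g : 'rV[R]_n -> 'M[R]_n) (h : 'rV[R]_p -> 'M[R]_p)
    (F : 'rV[R]_n -> 'rV[R]_p) (u : 'rV[R]_n) (i j : 'I_n) : 'rV[R]_p :=
  'D_('e_i) ('D_('e_j) F) u
  + \row_a \sum_b \sum_c
      christoffel h a b c (F u) * ('J F u) i b * ('J F u) j c
  - \sum_k christoffel g k i j u *: row k ('J F u).

End LocalGeometry.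

Section Immersed.
Context {R : realType} {n p : nat} {M : smoothManifold R n}.
Variable f : M -> 'rV[R]_p.

Definition smooth_vec : Prop :=
  forall c, atlas c -> smooth_on (ccod c) (f \o cinv c).

(* The image of the differential of [f] at [x], as a row space. *)
Definition tangent (x : M) : 'M[R]_(n, p) :=
  'J (f \o cinv (chart_at x)) (cmap (chart_at x) x).

Definition immersion : Prop := smooth_vec /\ forall x, row_free (tangent x).

(* The metric induced by [f], in the chart [c]. *)
Definition induced_metric (c : chart R n M) (u : 'rV[R]_n) : 'M[R]_n :=
  'J (f \o cinv c) u *m ('J (f \o cinv c) u)^T.

(* [v *m pinvmx (tangent x)] is the row of coordinates, in the chart at [x],
   of a vector [v] tangent to [M] at [x]. *)
Definition Ric (x : M) (v w : 'rV[R]_p) : R :=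
  let c := chart_at x in
  dot (v *m pinvmx (tangent x) *m ricci (induced_metric c) (cmap c x))
      (w *m pinvmx (tangent x)).

Definition sff (x : M) (i j : 'I_n) : 'rV[R]_p :=
  let c := chart_at x in
  local_sff (induced_metric c) (fun=> 1%:M) (f \o cinv c) (cmap c x) i j.

Definition mean_curvature (x : M) : 'rV[R]_p :=
  let c := chart_at x in
  n%:R^-1 *:
    \sum_i \sum_j invmx (induced_metric c (cmap c x)) i j *: sff x i j.

Definition minimal : Prop := forall x, mean_curvature x = 0.

Definition unit_normal_field (xi : M -> 'rV[R]_p) : Prop :=
  forall x, dot (xi x) (xi x) = 1 /\
    forall v, (v <= tangent x)%MS -> dot (xi x) v = 0.

End Immersed.

Definition totally_real (R : realType) (n m : nat) (V : smoothManifold R n)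
    (f : V -> 'rV[R]_(m + m)) : Prop :=
  forall x v w, (v <= tangent f x)%MS -> (w <= tangent f x)%MS ->
    dot (cplxJ v) w = 0.

Section Submanifold.
Context {R : realType} {k n : nat}.
Context {V : smoothManifold R k} {M : smoothManifold R n}.
Variable phi : V -> M.

Definition smooth_map : Prop :=
  continuous phi /\
  forall c d, atlas c -> atlas d ->
    smooth_on (ccod c `&` (phi \o cinv c) @^-1` cdom d)
              (cmap d \o phi \o cinv c).

(* [phi] read in the charts at [y] and [phi y]. *)
Definition local_map (y : V) : 'rV[R]_k -> 'rV[R]_n :=
  cmap (chart_at (phi y)) \o phi \o cinv (chart_at y).

(* An immersion that is a homeomorphism onto its image. *)
Definition smooth_embedding : Prop :=
  [/\ smooth_map,
      forall y, row_free ('J (local_map y) (cmap (chart_at y) y)),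
      injective phi &
      forall A : set V, open A ->
        exists2 B : set M, open B & phi @` A = B `&` range phi].

(* The second fundamental form of [V] in [M] vanishes, [M] having the metric
   induced by [f] and [V] the one induced by [f \o phi]. *)
Definition totally_geodesic (p : nat) (f : M -> 'rV[R]_p) : Prop :=
  forall (y : V) (i j : 'I_k),
    local_sff (induced_metric (f \o phi) (chart_at y))
              (induced_metric f (chart_at (phi y)))
              (local_map y) (cmap (chart_at y) y) i j = 0.

End Submanifold.

Definition totally_real_ruled (R : realType) (n m : nat)
    (N : smoothManifold R n) (f : N -> 'rV[R]_(m + m)) : Prop :=
  forall x : N, exists (V : smoothManifold R m) (phi : V -> N),
    [/\ smooth_embedding phi, range phi x,
        totally_real (f \o phi) & totally_geodesic phi f].

(* Main.v *)
(* Let [A] be the shape operator, [tau] its trace and [u = J xi]. By the Gauss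
   equation [Ric(u, u) = tau <A u, u> - |A u|^2 <= tau^2 / 2], and equality forces
   [tau = 0] and [A u = 0]. If [A u = 0] everywhere, then [xi] and the image of
   [d xi] span a space on which the Kaehler form vanishes, so [A] has rank at
   most 2; being symmetric and traceless it has rank 0 or 2, and in the second
   case its kernel is totally real of dimension 3.

   Near a point the hypersurface is the graph of a height function [h] over its
   tangent space. Let [H] be the Hessian of [h] and [g] the metric. The rank and
   trace conditions give [H g^-1 H g^-1 H = kappa H], where [kappa] vanishes
   exactly where [H] does. Differentiating this identity shows that a kernel
   direction of [H] at a point with [kappa <> 0] stays in the kernel along the
   straight line it spans (by Gronwall), and that [kappa] does not vanish on that
   line; hence [grad h] is constant along it. When points with [kappa <> 0] tend to
   the base point, the projections onto the kernels of [H] are bounded, and a limit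
   of them projects onto a 3-dimensional totally real space on which [grad h = 0].
   If there are no such points, [h] is affine near the base point and any
   Lagrangian subspace of the tangent space will do. Either way the hypersurface
   contains an open piece of a totally real affine 3-space, which is totally
   geodesic because it is so even in the ambient space. *)

(* The constant is [5 ^ 2 / 2]: the mean curvature vector is [tau / 5] times the normal, so the
   bound reads [tau ^+ 2 / 2]. The Kaehler form vanishes on the image of d xi because
   differentiating <J xi, d xi> = 0 gives a skew term plus a symmetric one with sum zero, so each is
   zero. The obstacle is that a leaf is wanted through every point, also where [kappa] vanishes and
   the kernel of the Hessian jumps. There the 3-plane is only reachable as a limit of kernels at
   nearby points, and the limit is useful only if the flat segments at these points do not shrink.
   Hence [kappa] has to be nonzero on all of a kernel segment inside a fixed ball: along it the
   Hessian applied to an affine Jacobi field is constant, so it cannot drop to 0 at a first zero of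
   [kappa]. The kernel projectors stay bounded because they involve [kappa] only through the square
   of a symmetric matrix divided by [kappa]; the trace of that square is [2 * kappa], so its entries
   are at most that. Limits are taken along an ultrafilter, and the dimension 3 survives as the
   trace of an idempotent. *)
Require Import Defs.
From HB Require Import structures.
From mathcomp Require Import all_boot all_order all_algebra.
From mathcomp Require Import all_classical all_reals all_analysis.
From mathcomp Require Import ring lra.

Set Implicit Arguments.
Unset Strict Implicit.
Unset Printing Implicit Defensive.

Import Order.TTheory GRing.Theory Num.Theory.
Import numFieldNormedType.Exports.

Local Open Scope classical_set_scope.
Local Open Scope ring_scope.

#[local] Opaque derive jacobian.

(** * Smooth functions *)

Section Smooth.
Context {R : realType}.

(** Replaces little-o by an explicit epsilon, so that a candidate differential can be checked by
    estimates. The derivative of the local inverse in [inverse_function] is found this way. *)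
Lemma is_diff_unique (V W : normedModType R) (f : V -> W) (df : {linear V -> W}) u :
  continuous df ->
  (forall e, 0 < e -> \forall h \near (0 : V), `|f (h + u) - f u - df h| <= e * `|h|) ->
  differentiable f u /\ 'd f u = df :> (V -> W).
Proof.
move=> cdf H.
have E : f \o shift u = cst (f u) + df +o_ (0 : V) id.
  apply/eqaddoP => e e0; have := H e e0; apply: filterS => h.
  by rewrite /= !fctE opprD addrA.
have D := diff_unique cdf E.
by split=> //; apply/diff_locallyP; rewrite D.
Qed.

Lemma diff_eps (V W : normedModType R) (f : V -> W) u : differentiable f u ->
  forall e, 0 < e ->
  \forall h \near (0 : V), `|f (h + u) - f u - 'd f u h| <= e * `|h|.
Proof.
move=> /diff_locallyP [_ /eqaddoP H] e e0; have := H e e0; apply: filterS => h.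
by rewrite /= !fctE opprD addrA.
Qed.

Lemma near_shift0 (V : normedModType R) (P : V -> Prop) (u : V) :
  (\forall x \near u, P x) -> \forall h \near (0 : V), P (h + u).
Proof.
move=> nP.
have : (h + u @[h --> (0:V)]) --> 0 + u by apply: cvgD; [exact: cvg_id|exact: cvg_cst].
by rewrite add0r => /(_ _ nP).
Qed.

Lemma near_differentiable (V W : normedModType R) (f g : V -> W) u :
  (\near u, f u = g u) -> differentiable f u -> differentiable g u.
Proof.
move=> fg df.
suff [] : differentiable g u /\ 'd g u = 'd f u :> (V -> W) by [].
apply: is_diff_unique; first exact: diff_continuous.
move=> e e0; have := diff_eps df e0.
have fgu : f u = g u by exact: nbhs_singleton fg.
have fg0 : \forall h \near (0 : V), f (h + u) = g (h + u).
  exact: near_shift0 fg.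
by apply: filterS2 fg0 => h <-; rewrite fgu.
Qed.

(** Recursion on the order, unlike the lists of directions in [smooth_on], allows induction through
    products, inverses and composites, whose derivatives involve only data of one order less. Order
    0 already means differentiable. *)
Fixpoint Ck n (k : nat) (U : set 'rV[R]_n) (f : 'rV[R]_n -> R) : Prop :=
  (forall u, U u -> differentiable f u) /\
  (if k is k'.+1 then forall v, Ck k' U ('D_v f) else True).

Definition smooth n (U : set 'rV[R]_n) (f : 'rV[R]_n -> R) : Prop :=
  forall k, Ck k U f.

Lemma Ck_diff n k (U : set 'rV[R]_n) f : Ck k U f ->
  forall u, U u -> differentiable f u.
Proof. by case: k => [|k] []. Qed.

Lemma CkW n k (U : set 'rV[R]_n) f : Ck k.+1 U f -> Ck k U f.
Proof.
elim: k f => [|k IH] f /=; first by case.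
by move=> [df d2]; split=> // v; apply: IH; apply: d2.
Qed.

Lemma Ck_sub n k (U V : set 'rV[R]_n) f : V `<=` U -> Ck k U f -> Ck k V f.
Proof.
move=> VU; elim: k f => [|k IH] f /= [df d2]; split=> //.
- by move=> u /VU; exact: df.
- by move=> u /VU; exact: df.
- by move=> v; apply: IH.
Qed.

Lemma near_open n (U : set 'rV[R]_n) (P : 'rV[R]_n -> Prop) u : open U -> U u ->
  (forall u, U u -> P u) -> \near u, P u.
Proof.
move=> oU Uu HP; suff: nbhs u U by apply: filterS.
exact: open_nbhs_nbhs.
Qed.

Lemma eq_on_derive n (W : normedModType R) (U : set 'rV[R]_n) (f g : 'rV[R]_n -> W) v u :
  open U -> (forall u, U u -> f u = g u) -> U u -> 'D_v f u = 'D_v g u.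
Proof. by move=> oU fg Uu; apply: near_eq_derive; exact: near_open fg. Qed.

Lemma Ck_eq n k (U : set 'rV[R]_n) f g : open U ->
  (forall u, U u -> f u = g u) -> Ck k U f -> Ck k U g.
Proof.
move=> oU; elim: k f g => [|k IH] f g fg /= [df d2]; split=> //.
- by move=> u Uu; apply: near_differentiable (df u Uu); exact: near_open fg.
- by move=> u Uu; apply: near_differentiable (df u Uu); exact: near_open fg.
- by move=> v; apply: IH (d2 v) => u Uu; exact: (eq_on_derive _ oU).
Qed.

Section Ops.
Variables (n : nat) (U : set 'rV[R]_n) (oU : open U).
Implicit Types f g : 'rV[R]_n -> R.

Lemma Ck_cst k (a : R) : Ck k U (fun=> a).
Proof.
elim: k a => [|k IH] a /=; split=> //; try by move=> u _; exact: differentiable_cst.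
move=> v; have := IH 0; apply: Ck_eq => // u _; rewrite derive_cst //.
Qed.

Lemma CkD k f g : Ck k U f -> Ck k U g -> Ck k U (fun u => f u + g u).
Proof.
elim: k f g => [|k IH] f g /= [df d2] [dg e2]; split=> //.
- by move=> u Uu; apply: differentiableD; [exact: df|exact: dg].
- by move=> u Uu; apply: differentiableD; [exact: df|exact: dg].
- move=> v; have := IH _ _ (d2 v) (e2 v); apply: Ck_eq => // u Uu.
  by rewrite -deriveD //; apply: diff_derivable; [exact: df|exact: dg].
Qed.

Lemma CkM k f g : Ck k U f -> Ck k U g -> Ck k U (fun u => f u * g u).
Proof.
elim: k f g => [|k IH] f g.
  move=> [df d2] [dg e2]; split=> // u Uu.
  by apply: differentiableM; [exact: df|exact: dg].
move=> Cf Cg; have Cf' := CkW Cf; have Cg' := CkW Cg.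
case: Cf Cg => [df d2] [dg e2]; split=> //.
- by move=> u Uu; apply: differentiableM; [exact: df|exact: dg].
- move=> v; have := CkD (IH _ _ Cf' (e2 v)) (IH _ _ Cg' (d2 v)).
  apply: Ck_eq => // u Uu.
  by rewrite deriveM //; apply: diff_derivable; [exact: df|exact: dg].
Qed.

Lemma CkN k f : Ck k U f -> Ck k U (fun u => - f u).
Proof.
move=> /(CkM (Ck_cst k (-1))); apply: Ck_eq => // u _; by rewrite mulN1r.
Qed.

Lemma CkB k f g : Ck k U f -> Ck k U g -> Ck k U (fun u => f u - g u).
Proof. by move=> Cf Cg; apply: CkD => //; apply: CkN. Qed.

Lemma Ck_sum k (I : Type) (r : seq I) (P : pred I) (F : I -> 'rV[R]_n -> R) :
  (forall i, P i -> Ck k U (F i)) -> Ck k U (fun u => \sum_(i <- r | P i) F i u).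
Proof.
move=> CF; elim: r => [|i r IH].
  by apply: Ck_eq (Ck_cst k 0) => // u _; rewrite big_nil.
case Pi: (P i); last by apply: Ck_eq IH => // u _; rewrite big_cons Pi.
by apply: Ck_eq (CkD (CF i Pi) IH) => // u _; rewrite big_cons Pi.
Qed.

Lemma Ck_prod k (I : Type) (r : seq I) (P : pred I) (F : I -> 'rV[R]_n -> R) :
  (forall i, P i -> Ck k U (F i)) -> Ck k U (fun u => \prod_(i <- r | P i) F i u).
Proof.
move=> CF; elim: r => [|i r IH].
  by apply: Ck_eq (Ck_cst k 1) => // u _; rewrite big_nil.
case Pi: (P i); last by apply: Ck_eq IH => // u _; rewrite big_cons Pi.
by apply: Ck_eq (CkM (CF i Pi) IH) => // u _; rewrite big_cons Pi.
Qed.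

Lemma CkV k f : (forall u, U u -> f u != 0) -> Ck k U f -> Ck k U (fun u => (f u)^-1).
Proof.
move=> f0; elim: k => [|k IH].
  by move=> [df d2]; split=> // u Uu; apply: differentiableV; [exact: df|exact: f0].
move=> Cf; have Cf' := CkW Cf; case: Cf => [df d2]; split=> //.
- by move=> u Uu; apply: differentiableV; [exact: df|exact: f0].
- move=> v; have := CkM (CkN (CkM (IH Cf') (IH Cf'))) (d2 v).
  apply: Ck_eq => // u Uu.
  rewrite deriveV //; [| exact: f0 | by apply: diff_derivable; exact: df].
  by rewrite -exprVn expr2.
Qed.

End Ops.
End Smooth.

Section SmoothVec.
Context {R : realType}.

Lemma is_derive_line (V W : normedModType R) (f : V -> W) (x v : V) (s : R) :
  differentiable f (s *: v + x) ->
  is_derive s (1 : R) (fun s : R => f (s *: v + x)) ('D_v f (s *: v + x)).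
Proof.
move=> df.
pose l := fun s : R => s *: v + x.
have dl : is_diff s l (fun h => h *: v).
  have -> : (fun h : R => h *: v) = ( *:%R ^~ v) + (0 : R -> V).
    by apply/funext => h; rewrite /= addrfctE addr0.
  exact: is_diffD.
have dfl : differentiable (f \o l) s.
  by apply: differentiable_comp => //.
apply: DeriveDef; first exact: diff_derivable.
rewrite (deriveE _ dfl) diff_comp //= diff_val.
by rewrite scale1r deriveE.
Qed.

Lemma MVT_line (V : normedModType R) (f : V -> R) (x v : V) :
  (forall s : R, 0 <= s <= 1 -> differentiable f (s *: v + x)) ->
  exists2 c : R, 0 < c < 1 & f (v + x) - f x = 'D_v f (c *: v + x).
Proof.
move=> df.
have H (s : R) : s \in `]0, 1[%R ->
    is_derive s (1:R) (fun s : R => f (s *: v + x)) ('D_v f (s *: v + x)).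
  move=> s01; apply: is_derive_line; apply: df; move: s01.
  by rewrite in_itv /= => /andP[? ?]; rewrite !ltW.
have C : {within `[0, 1], continuous (fun s : R => f (s *: v + x))}.
  apply: derivable_within_continuous => s; rewrite in_itv /= => s01.
  by have [] := is_derive_line (df s s01).
have [c c01] := MVT ltr01 H C.
rewrite scale1r scale0r add0r subr0 mulr1 => E.
by exists c => //; move: c01; rewrite in_itv.
Qed.

Lemma differentiable_rV (V : normedModType R) n (F : V -> 'rV[R]_n) u :
  differentiable F u <-> forall j, differentiable (fun t => F t 0 j) u.
Proof.
split=> [dF j|dF].
  exact: (differentiable_comp dF (differentiable_coord (F u) 0 j)).
have -> : F = \sum_(j < n) (fun t => F t 0 j *: ('e_j : 'rV[R]_n)).
  apply/funext => t; rewrite fct_sumE; exact: row_sum_delta.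
by apply: differentiable_sum => j; apply: differentiableZl.
Qed.

Lemma diff_coord (V : normedModType R) n (F : V -> 'rV[R]_n) u j :
  differentiable F u -> differentiable (fun t => F t 0 j) u.
Proof. by move=> /differentiable_rV. Qed.

Lemma derive_rV (V : normedModType R) n (F : V -> 'rV[R]_n) u v j :
  differentiable F u -> ('D_v F u) 0 j = 'D_v (fun t => F t 0 j) u.
Proof. by move=> dF; rewrite derive_mx ?mxE //; exact: diff_derivable. Qed.

Lemma jacobianE m n (F : 'rV[R]_m -> 'rV[R]_n) u i j :
  differentiable F u -> ('J F u) i j = 'D_('e_i) (fun t => F t 0 j) u.
Proof.
move=> dF; rewrite -derive_rV // deriveEjacobian //.
by rewrite -rowE [RHS]mxE.
Qed.

Lemma row_jacobian m n (F : 'rV[R]_m -> 'rV[R]_n) u i :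
  differentiable F u -> row i ('J F u) = 'D_('e_i) F u.
Proof. by move=> dF; rewrite deriveEjacobian // rowE. Qed.

Lemma derive_comp (V W : normedModType R) n (f : V -> 'rV[R]_n)
    (g : 'rV[R]_n -> W) u v :
  differentiable f u -> differentiable g (f u) ->
  'D_v (g \o f) u = \sum_i 'D_v (fun t => f t 0 i) u *: 'D_('e_i) g (f u).
Proof.
move=> df dg; rewrite deriveE; last exact: differentiable_comp.
rewrite diff_comp //= -(deriveE _ df) (row_sum_delta ('D_v f u)) linear_sum.
by apply: eq_bigr => i _; rewrite linearZ /= derive_rV // -deriveE.
Qed.

Lemma jacobian_comp m n p (f : 'rV[R]_m -> 'rV[R]_n) (g : 'rV[R]_n -> 'rV[R]_p) u :
  differentiable f u -> differentiable g (f u) ->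
  'J (g \o f) u = 'J f u *m 'J g (f u).
Proof.
move=> df dg; apply/row_matrixP => i.
rewrite row_mul !row_jacobian //; last exact: differentiable_comp.
rewrite -(deriveEjacobian _ dg) deriveE; last exact: differentiable_comp.
by rewrite diff_comp //= -(deriveE _ df) -(deriveE _ dg).
Qed.

Lemma derive_sumE (V W : normedModType R) (f : V -> W) n (a : 'I_n -> R) (e : 'I_n -> V) u :
  differentiable f u -> 'D_(\sum_i a i *: e i) f u = \sum_i a i *: 'D_(e i) f u.
Proof.
move=> df; rewrite deriveE // linear_sum; apply: eq_bigr => i _.
by rewrite linearZ /= -deriveE.
Qed.

Lemma derive_coords n (W : normedModType R) (f : 'rV[R]_n -> W) u v :
  differentiable f u -> 'D_v f u = \sum_i v 0 i *: 'D_('e_i) f u.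
Proof. by move=> df; rewrite -derive_sumE // -row_sum_delta. Qed.

Section Comp.
Variables (m n : nat) (U : set 'rV[R]_m) (U' : set 'rV[R]_n).
Hypothesis (oU : open U).

(** By the chain rule the derivative is a sum of derivatives of [f] times partial derivatives of [g]
    composed with [f]. The outer function changes at each order, hence the induction over all
    [g]. *)
Lemma Ck_comp k (f : 'rV[R]_m -> 'rV[R]_n) (g : 'rV[R]_n -> R) :
  (forall u, U u -> U' (f u)) ->
  (forall j, Ck k U (fun u => f u 0 j)) -> Ck k U' g -> Ck k U (g \o f).
Proof.
move=> fU; elim: k g => [|k IH] g Cf Cg.
  split=> // u Uu; apply: differentiable_comp.
    by apply/differentiable_rV => j; exact: Ck_diff (Cf j) _ Uu.
  by apply: (Ck_diff Cg); exact: fU.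
have df u : U u -> differentiable f u.
  by move=> Uu; apply/differentiable_rV => j; exact: Ck_diff (Cf j) _ Uu.
have dg u : U u -> differentiable g (f u).
  by move=> Uu; apply: (Ck_diff Cg); exact: fU.
split.
  by move=> u Uu; apply: differentiable_comp; [exact: df|exact: dg].
move=> v.
have H : Ck k U (fun u => \sum_i 'D_v (fun t => f t 0 i) u * ('D_('e_i) g \o f) u).
  apply: Ck_sum => // i _; apply: CkM => //.
    by case: (Cf i) => _; apply.
  apply: IH => [j|]; first exact: CkW.
  by case: Cg => _; apply.
by apply: Ck_eq H => // u Uu; rewrite derive_comp //; [exact: df|exact: dg].
Qed.

Lemma smooth_comp (f : 'rV[R]_m -> 'rV[R]_n) (g : 'rV[R]_n -> R) :
  (forall u, U u -> U' (f u)) ->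
  (forall j, smooth U (fun u => f u 0 j)) -> smooth U' g -> smooth U (g \o f).
Proof. by move=> fU Cf Cg k; exact: (Ck_comp fU (fun j => Cf j k) (Cg k)). Qed.

End Comp.

Lemma smooth_D n (U : set 'rV[R]_n) f v : smooth U f -> smooth U ('D_v f).
Proof. by move=> Sf k; case: (Sf k.+1) => _; apply. Qed.

Lemma smooth_diff n (U : set 'rV[R]_n) f u : smooth U f -> U u -> differentiable f u.
Proof. by move=> /(_ 0%N) Sf; exact: Ck_diff Sf _. Qed.

Lemma smooth_onP n p (U : set 'rV[R]_n) (F : 'rV[R]_n -> 'rV[R]_p) : open U ->
  smooth_on U F <-> forall j, smooth U (fun u => F u 0 j).
Proof.
move=> oU; split=> [SF j k|SF vs].
  elim: k F SF => [|k IH] F SF.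
    by split=> // u Uu; apply: diff_coord; exact: (SF [::]).
  split=> [u Uu|v]; first by apply: diff_coord; exact: (SF [::]).
  apply: (@Ck_eq _ _ _ _ (fun u => ('D_v F u) 0 j)) => //.
    by move=> u Uu; rewrite derive_rV //; exact: (SF [::]).
  (* [rcons] makes the new direction the innermost derivative, matching [Ck], which differentiates
     the function itself first. *)
  apply: IH => vs u Uu; have := SF (rcons vs v) u Uu.
  by rewrite foldr_rcons.
suff S : forall j, smooth U (fun u => foldr (fun v G => 'D_v G) F vs u 0 j).
  by move=> u Uu; apply/differentiable_rV => j; exact: smooth_diff (S j) Uu.
elim: vs => [|v vs IH] //= j k.
have H := smooth_D v (IH j) k.
apply: Ck_eq H => // u Uu; rewrite derive_rV //.
by apply/differentiable_rV => i; exact: smooth_diff (IH i) Uu.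
Qed.

Section SmoothMx.
Variables (n : nat) (U : set 'rV[R]_n) (oU : open U).

Lemma Ck_mulmx k a b c (A : 'rV[R]_n -> 'M[R]_(a, b)) (B : 'rV[R]_n -> 'M[R]_(b, c)) :
  (forall i j, Ck k U (fun u => A u i j)) -> (forall i j, Ck k U (fun u => B u i j)) ->
  forall i j, Ck k U (fun u => (A u *m B u) i j).
Proof.
move=> CA CB i j.
have H : Ck k U (fun u => \sum_l A u i l * B u l j).
  by apply: Ck_sum => // l _; apply: CkM.
by apply: Ck_eq H => // u _; rewrite mxE.
Qed.

Lemma Ck_det k a (A : 'rV[R]_n -> 'M[R]_a) :
  (forall i j, Ck k U (fun u => A u i j)) -> Ck k U (fun u => \det (A u)).
Proof.
move=> CA; rewrite /determinant; apply: Ck_sum => // s _; apply: CkM => //.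
  exact: Ck_cst.
by apply: Ck_prod.
Qed.

Lemma Ck_invmx k a (A : 'rV[R]_n -> 'M[R]_a) :
  (forall u, U u -> A u \in unitmx) ->
  (forall i j, Ck k U (fun u => A u i j)) ->
  forall i j, Ck k U (fun u => invmx (A u) i j).
Proof.
move=> uA CA i j.
have H : Ck k U (fun u => (\det (A u))^-1 * cofactor (A u) j i).
  apply: CkM => //.
    apply: CkV => //; last exact: Ck_det.
    by move=> u Uu; have := uA u Uu; rewrite unitmxE unitfE.
  rewrite /cofactor; apply: CkM => //; first exact: Ck_cst.
  apply: Ck_det => i' j'.
  apply: (@Ck_eq _ _ _ _ (fun u => A u (lift j i') (lift i j'))) => //.
  by move=> u _; rewrite !mxE.
by apply: Ck_eq H => // u Uu; rewrite /invmx uA // !mxE.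
Qed.

End SmoothMx.

(** For [schwarz]: [s] is a second difference, [q] the square of the step, and [a], [b] the two
    mixed derivatives that both approximate [s / q]. *)
Lemma dist_le_scaled (s a b e q : R) : 0 < q ->
  `|s - q * a| <= e / 2 * q -> `|s - q * b| <= e / 2 * q -> `|a - b| <= e.
Proof.
move=> q0 H1 H2; rewrite -(ler_pM2l q0) -{1}(ger0_norm (ltW q0)) -normrM.
move: H1 H2; rewrite !ler_norml.
by move=> /andP[? ?] /andP[? ?]; apply/andP; split; lra.
Qed.

(** The mean value theorem in the direction [v] turns the second difference into [t] times a
    difference of ['D_v f] at two points near [u]. Differentiability of ['D_v f] at the single point
    [u] then gives the expansion. *)
Lemma second_difference (n : nat) (f : 'rV[R]_n -> R) u v w :
  (\near u, differentiable f u) -> differentiable ('D_v f) u ->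
  forall e, 0 < e -> \forall t \near (0:R)^'+,
   `|f (t *: v + (t *: w + u)) - f (t *: w + u) - (f (t *: v + u) - f u)
      - t ^+ 2 * 'D_w ('D_v f) u| <= e * t ^+ 2.
Proof.
move=> df dG e e0; set G := 'D_v f.
(* The two error terms are taken at [c *: v + t *: w] and [c *: v] with [0 < c < t], whose norms add
   up to at most [t * C]; the summand 1 keeps [C] positive. *)
pose C := 2 * `|v| + `|w| + 1.
have C0 : 0 < C by rewrite /C; have := normr_ge0 v; have := normr_ge0 w; lra.
have C0' := ltW C0.
have [r r0 Hr] : exists2 r : R, 0 < r & forall h : 'rV[R]_n, `|h| < r ->
    differentiable f (h + u) /\ `|G (h + u) - G u - 'd G u h| <= e / C * `|h|.
  have ec : 0 < e / C by rewrite divr_gt0.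
  have H1 := diff_eps dG ec.
  have H2 : \forall h \near (0 : 'rV[R]_n), differentiable f (h + u).
    exact: near_shift0 df.
  have /nbhs_normP [r r0 Hr] : \forall h \near (0 : 'rV[R]_n),
      differentiable f (h + u) /\ `|G (h + u) - G u - 'd G u h| <= e / C * `|h|.
    exact: filterI H2 H1.
  by exists r => // h hr; apply: Hr; rewrite /= sub0r normrN.
near=> t.
have t0 : 0 < t by near: t; exact: nbhs_right_gt.
have t0' := ltW t0.
have tr : t * C < r.
  rewrite -ltr_pdivlMr //; near: t; apply: nbhs_right_lt; exact: divr_gt0.
have nb (s : R) : 0 <= s <= t -> `|s *: v + t *: w| <= t * C /\ `|s *: v| <= t * C.
  move=> /andP[s0 st].
  have sv : `|s *: v| <= t * `|v| by rewrite normrZ ger0_norm // ler_wpM2r.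
  have tw : `|t *: w| = t * `|w| by rewrite normrZ ger0_norm.
  have tv0 : 0 <= t * `|v| by rewrite mulr_ge0.
  have tw0 : 0 <= t * `|w| by rewrite mulr_ge0.
  split; last by rewrite (le_trans sv) // /C; nra.
  by rewrite (le_trans (ler_normD _ _)) // tw /C; nra.
pose phi := fun s : R => f (s *: v + (t *: w + u)) - f (s *: v + u).
have dphi (s : R) : 0 <= s <= t -> is_derive s (1:R) phi
    (G (s *: v + (t *: w + u)) - G (s *: v + u)).
  move=> st; have [n1 n2] := nb s st.
  apply: is_deriveB; apply: is_derive_line.
    by rewrite addrA; apply: (Hr _ _).1; apply: le_lt_trans tr.
  by apply: (Hr _ _).1; apply: le_lt_trans tr.
have dphi' (s : R) : s \in `]0, t[%R -> is_derive s (1:R) phi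
    (G (s *: v + (t *: w + u)) - G (s *: v + u)).
  by rewrite in_itv /= => /andP[? ?]; apply: dphi; rewrite !ltW.
have cphi : {within `[0, t], continuous phi}.
  by apply: derivable_within_continuous => s; rewrite in_itv /= => /dphi [].
have [c] := MVT t0 dphi' cphi.
rewrite in_itv /= => /andP[c0 ct].
rewrite subr0 {1 2}/phi scale0r !add0r => E.
have c01 : 0 <= c <= t by rewrite !ltW.
have [n1 n2] := nb c c01.
have r1 := (Hr _ (le_lt_trans n1 tr)).2.
have r2 := (Hr _ (le_lt_trans n2 tr)).2.
have -> : f (t *: v + (t *: w + u)) - f (t *: w + u) - (f (t *: v + u) - f u) =
  (G (c *: v + (t *: w + u)) - G (c *: v + u)) * t.
  rewrite -E; ring.
have EE : G (c *: v + (t *: w + u)) - G (c *: v + u) - t * 'D_w G u =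
   (G (c *: v + t *: w + u) - G u - 'd G u (c *: v + t *: w)) -
   (G (c *: v + u) - G u - 'd G u (c *: v)).
  rewrite !deriveE // addrA linearD /= [in X in _ = _ - (_ + X) - _]linearZ /=.
  rewrite [X in _ = _ - (_ + X) - _](_ : _ = t * 'd G u w) //; ring.
have -> : (G (c *: v + (t *: w + u)) - G (c *: v + u)) * t - t ^+ 2 * 'D_w G u =
   t * (G (c *: v + (t *: w + u)) - G (c *: v + u) - t * 'D_w G u) by ring.
rewrite EE normrM ger0_norm // expr2 mulrCA ler_wpM2l //.
apply: le_trans (ler_normB _ _) _.
apply: le_trans (lerD r1 r2) _.
rewrite -mulrDr.
have sv : `|c *: v| <= t * `|v| by rewrite normrZ (ger0_norm (ltW c0)) ler_wpM2r // ltW.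
have tw : `|t *: w| = t * `|w| by rewrite normrZ ger0_norm.
have vw : `|c *: v + t *: w| + `|c *: v| <= t * C.
  have := ler_normD (c *: v) (t *: w).
  have -> : t * C = 2 * (t * `|v|) + t * `|w| + t by rewrite /C; ring.
  rewrite tw; move: sv t0; clear; lra.
have -> : e * t = e / C * (t * C).
  by field; rewrite gt_eqF.
by rewrite ler_wpM2l // ltW // divr_gt0.
Unshelve. all: by end_near. Qed.

(** The second difference is symmetric in [v] and [w], so both mixed derivatives approximate the
    same number up to any [e]. No continuity of second derivatives enters. *)
Lemma schwarz (n : nat) (f : 'rV[R]_n -> R) u v w :
  (\near u, differentiable f u) -> differentiable ('D_v f) u ->
  differentiable ('D_w f) u -> 'D_w ('D_v f) u = 'D_v ('D_w f) u.
Proof.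
move=> df dv dw; apply/eqP; rewrite -subr_eq0 -normr_le0; apply/ler_addgt0Pl => e e0.
rewrite addr0.
have e2 : 0 < e / 2 by rewrite divr_gt0.
have H1 := second_difference w df dv e2.
have H2 := second_difference v df dw e2.
have H3 : \forall t \near (0:R)^'+, 0 < t by exact: nbhs_right_gt.
have [t [[{}H1 {}H2] t0]] := filter_ex (filterI (filterI H1 H2) H3).
have t2 : 0 < t ^+ 2 by rewrite exprn_gt0.
rewrite (addrCA (t *: w)) in H2.
have E (a b c d : R) : a - b - (c - d) = a - c - (b - d) by ring.
rewrite E in H2; apply: dist_le_scaled t2 H1 H2.
Qed.

Lemma smooth_schwarz (n : nat) (U : set 'rV[R]_n) (f : 'rV[R]_n -> R) u v w :
  open U -> smooth U f -> U u -> 'D_w ('D_v f) u = 'D_v ('D_w f) u.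
Proof.
move=> oU Sf Uu; apply: schwarz.
- by apply: (near_open oU) => // x Ux; exact: smooth_diff Sf Ux.
- exact: smooth_diff (smooth_D _ Sf) Uu.
- exact: smooth_diff (smooth_D _ Sf) Uu.
Qed.

End SmoothVec.

(** * Hypersurfaces in coordinates *)

Section DotAlgebra.
Context {R : realType}.

Lemma dotE p (v w : 'rV[R]_p) : dot v w = \sum_a v 0 a * w 0 a.
Proof. by rewrite /dot mxE; apply: eq_bigr => a _; rewrite mxE. Qed.

Lemma dotC p (v w : 'rV[R]_p) : dot v w = dot w v.
Proof. by rewrite !dotE; apply: eq_bigr => a _; rewrite mulrC. Qed.

Lemma dotDl p (u v w : 'rV[R]_p) : dot (u + v) w = dot u w + dot v w.
Proof. by rewrite /dot mulmxDl mxE. Qed.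

Lemma dotZl p a (v w : 'rV[R]_p) : dot (a *: v) w = a * dot v w.
Proof. by rewrite /dot -scalemxAl mxE. Qed.

Lemma dotNl p (v w : 'rV[R]_p) : dot (- v) w = - dot v w.
Proof. by rewrite -scaleN1r dotZl mulN1r. Qed.

Lemma dotBl p (u v w : 'rV[R]_p) : dot (u - v) w = dot u w - dot v w.
Proof. by rewrite dotDl dotNl. Qed.

Lemma dotDr p (u v w : 'rV[R]_p) : dot w (u + v) = dot w u + dot w v.
Proof. by rewrite !(dotC w) dotDl. Qed.

Lemma dotZr p a (v w : 'rV[R]_p) : dot v (a *: w) = a * dot v w.
Proof. by rewrite !(dotC v) dotZl. Qed.

Lemma dotNr p (v w : 'rV[R]_p) : dot v (- w) = - dot v w.
Proof. by rewrite !(dotC v) dotNl. Qed.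

Lemma dotBr p (u v w : 'rV[R]_p) : dot w (u - v) = dot w u - dot w v.
Proof. by rewrite dotDr dotNr. Qed.

Lemma dot0l p (w : 'rV[R]_p) : dot 0 w = 0.
Proof. by rewrite /dot mul0mx mxE. Qed.

Lemma dot0r p (w : 'rV[R]_p) : dot w 0 = 0.
Proof. by rewrite dotC dot0l. Qed.

Lemma dot_suml p (I : Type) (r : seq I) (P : pred I) (F : I -> 'rV[R]_p) w :
  dot (\sum_(i <- r | P i) F i) w = \sum_(i <- r | P i) dot (F i) w.
Proof.
by apply: (big_morph (fun v => dot v w)) => [u v|]; [exact: dotDl|exact: dot0l].
Qed.

Lemma dot_ge0 p (v : 'rV[R]_p) : 0 <= dot v v.
Proof. by rewrite dotE sumr_ge0 // => i _; rewrite -expr2 sqr_ge0. Qed.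

Lemma dot_eq0 p (v : 'rV[R]_p) : dot v v = 0 -> v = 0.
Proof.
rewrite dotE => /eqP; rewrite psumr_eq0; last by move=> i _; rewrite -expr2 sqr_ge0.
move=> /allP v0; apply/rowP => j; rewrite mxE.
by have /eqP := v0 j (mem_index_enum j); move/eqP; rewrite mulf_eq0 orbb => /eqP.
Qed.

Lemma dot_mulmx p q (v : 'rV[R]_p) (A : 'M[R]_(q, p)) (w : 'rV[R]_q) :
  dot v (w *m A) = dot (v *m A^T) w.
Proof. by rewrite /dot trmx_mul mulmxA. Qed.

Lemma mulmx_tr_dot n m p (A : 'M[R]_(n, p)) (B : 'M[R]_(m, p)) i j :
  (A *m B^T) i j = dot (row i A) (row j B).
Proof. by rewrite dotE mxE; apply: eq_bigr => a _; rewrite !mxE. Qed.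

Lemma mulmx_tr_row n p (v : 'rV[R]_p) (A : 'M[R]_(n, p)) j :
  (v *m A^T) 0 j = dot v (row j A).
Proof. by rewrite mulmx_tr_dot row_id. Qed.

Lemma gram_unit n p (A : 'M[R]_(n, p)) : row_free A -> A *m A^T \in unitmx.
Proof.
move=> fA; rewrite -row_free_unit -kermx_eq0; apply/eqP/row_matrixP => i.
rewrite row0; set w := row i _.
have : w *m (A *m A^T) = 0 by apply: sub_kermxP; exact: row_sub.
rewrite mulmxA => wA.
have wA0 : w *m A = 0.
  apply: dot_eq0; rewrite /dot trmx_mul mulmxA wA mul0mx mxE //.
by apply: (row_free_inj fA); rewrite wA0 mul0mx.
Qed.

(** In codimension one, [A] stacked on [nu] is an invertible square matrix, and [z - dot z nu *: nu]
    is orthogonal to all its rows. *)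
Lemma normal_decomp n p (A : 'M[R]_(n, p)) (nu z : 'rV[R]_p) :
  p = n.+1 -> row_free A -> nu *m A^T = 0 -> dot nu nu = 1 ->
  z *m A^T = 0 -> z = dot z nu *: nu.
Proof.
move=> pn fA nuA nu1 zA.
have nuA' : A *m nu^T = 0 by apply: trmx_inj; rewrite trmx_mul trmxK nuA trmx0.
have fC : row_free (col_mx A nu).
  rewrite -kermx_eq0; apply/eqP/row_matrixP => i; rewrite row0; set w := row i _.
  have : w *m col_mx A nu = 0 by apply: sub_kermxP; exact: row_sub.
  rewrite -[w]hsubmxK mul_row_col => E.
  have w2 : rsubmx w = 0.
    have := congr1 (fun M => M *m nu^T) E.
    rewrite mulmxDl -!mulmxA nuA' mulmx0 add0r mul0mx.
    have -> : nu *m nu^T = 1%:M by rewrite [LHS]mx11_scalar -/(dot nu nu) nu1.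
    by rewrite mulmx1.
  have w1 : lsubmx w = 0.
    by apply: (row_free_inj fA); rewrite mul0mx -E w2 mul0mx addr0.
  by rewrite w1 w2 row_mx0.
have fT : row_free (col_mx A nu)^T.
  by rewrite -row_leq_rank mxrank_tr (eqP fC) pn addn1.
apply/eqP; rewrite -subr_eq0; apply/eqP; apply: (row_free_inj fT).
rewrite mul0mx tr_col_mx mul_mx_row mulmxBl zA -scalemxAl nuA scaler0 subrr.
rewrite mulmxBl -scalemxAl.
have -> : nu *m nu^T = 1%:M by rewrite [LHS]mx11_scalar -/(dot nu nu) nu1.
have -> : z *m nu^T = (dot z nu)%:M by exact: mx11_scalar.
by rewrite scalemx1 subrr row_mx0.
Qed.

(** [A^T *m invmx (A *m A^T) *m A] is the orthogonal projection onto the row space of [A]; the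
    remainder is normal. *)
Lemma tangent_decomp n p (A : 'M[R]_(n, p)) (nu v : 'rV[R]_p) :
  p = n.+1 -> row_free A -> nu *m A^T = 0 -> dot nu nu = 1 ->
  v = v *m A^T *m invmx (A *m A^T) *m A + dot v nu *: nu.
Proof.
move=> pn fA nuA nu1; have uG := gram_unit fA.
set t := _ *m A.
have H : (v - t) *m A^T = 0 by rewrite mulmxBl -!mulmxA mulVmx // mulmx1 subrr.
have := normal_decomp pn fA nuA nu1 H.
have -> : dot (v - t) nu = dot v nu.
  by rewrite dotBl (dotC t) /t dot_mulmx nuA dot0l subr0.
by move=> /eqP; rewrite subr_eq addrC => /eqP.
Qed.

Lemma normal_submx n p (A : 'M[R]_(n, p)) (nu v : 'rV[R]_p) :
  p = n.+1 -> row_free A -> nu *m A^T = 0 -> dot nu nu = 1 ->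
  dot v nu = 0 -> (v <= A)%MS.
Proof.
move=> pn fA nuA nu1 v0; rewrite (tangent_decomp v pn fA nuA nu1) v0 scale0r addr0.
exact: submxMl.
Qed.

End DotAlgebra.

Section DotCalculus.
Context {R : realType}.

Lemma smooth_on_diff n p (U : set 'rV[R]_n) (X : 'rV[R]_n -> 'rV[R]_p) u :
  smooth_on U X -> U u -> differentiable X u.
Proof. by move=> SX; exact: (SX [::]). Qed.

Lemma smooth_on_D n p (U : set 'rV[R]_n) (X : 'rV[R]_n -> 'rV[R]_p) v :
  smooth_on U X -> smooth_on U ('D_v X).
Proof. by move=> SX vs u Uu; have := SX (rcons vs v) u Uu; rewrite foldr_rcons. Qed.

Lemma smooth_on_schwarz n p (U : set 'rV[R]_n) (X : 'rV[R]_n -> 'rV[R]_p) v w u :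
  open U -> smooth_on U X -> U u -> 'D_v ('D_w X) u = 'D_w ('D_v X) u.
Proof.
move=> oU SX Uu; apply/rowP => a.
have SXa := (smooth_onP X oU).1 SX a.
have E (v' w' : 'rV[R]_n) : ('D_v' ('D_w' X) u) 0 a = 'D_v' ('D_w' (fun t => X t 0 a)) u.
  rewrite derive_rV; last exact: smooth_on_diff (smooth_on_D _ SX) Uu.
  apply: (eq_on_derive _ oU) => // t Ut.
  by rewrite derive_rV //; exact: smooth_on_diff SX Ut.
apply: (etrans (E v w)); apply: (etrans _ (esym (E w v))).
exact: (smooth_schwarz w v oU SXa Uu).
Qed.

Lemma derive_dot (V : normedModType R) p (X Y : V -> 'rV[R]_p) u v :
  differentiable X u -> differentiable Y u ->
  'D_v (fun t => dot (X t) (Y t)) u = dot ('D_v X u) (Y u) + dot (X u) ('D_v Y u).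
Proof.
move=> dX dY.
have dX' a : derivable (fun t => X t 0 a) u v.
  by apply: diff_derivable; exact: diff_coord.
have dY' a : derivable (fun t => Y t 0 a) u v.
  by apply: diff_derivable; exact: diff_coord.
have -> : (fun t => dot (X t) (Y t)) =
    \sum_(a < p) ((fun t => X t 0 a) * (fun t => Y t 0 a)).
  by apply/funext => t; rewrite fct_sumE dotE.
rewrite derive_sum; last by move=> a; apply: derivableM.
rewrite !dotE -big_split /=; apply: eq_bigr => a _.
rewrite (derive_rV _ _ dX) (derive_rV _ _ dY) (deriveM (dX' a) (dY' a)) [RHS]addrC.
by congr (_ + _); exact: mulrC.
Qed.

Lemma smooth_dot n p (U : set 'rV[R]_n) (X Y : 'rV[R]_n -> 'rV[R]_p) :
  open U -> smooth_on U X -> smooth_on U Y -> smooth U (fun u => dot (X u) (Y u)).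
Proof.
move=> oU SX SY k.
have H : Ck k U (fun u => \sum_a X u 0 a * Y u 0 a).
  apply: Ck_sum => // a _; apply: CkM => //.
    exact: ((smooth_onP X oU).1 SX a k).
  exact: ((smooth_onP Y oU).1 SY a k).
by apply: Ck_eq H => // u _; rewrite dotE.
Qed.

End DotCalculus.

(** * The Gauss formula and the Gauss equation in coordinates *)

Section Gauss.
Context {R : realType} {n p : nat}.
Variables (U : set 'rV[R]_n) (F nu : 'rV[R]_n -> 'rV[R]_p).
Hypotheses (pn : p = n.+1) (oU : open U) (SF : smooth_on U F) (Snu : smooth_on U nu).
Hypothesis fF : forall u, U u -> row_free ('J F u).
Hypothesis nuF : forall u, U u -> nu u *m ('J F u)^T = 0.
Hypothesis nu1 : forall u, U u -> dot (nu u) (nu u) = 1.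

Let F1 i := 'D_('e_i) F.
Let F2 i j := 'D_('e_i) (F1 j).
Variable g : 'rV[R]_n -> 'M[R]_n.
Hypothesis gE0 : forall u, g u = 'J F u *m ('J F u)^T.

Let SF1 i : smooth_on U (F1 i). Proof. exact: smooth_on_D. Qed.
Let SF2 i j : smooth_on U (F2 i j). Proof. exact: smooth_on_D. Qed.
Let dF u : U u -> differentiable F u. Proof. exact: smooth_on_diff. Qed.
Let dF1 u i : U u -> differentiable (F1 i) u. Proof. exact: smooth_on_diff. Qed.
Let dF2 u i j : U u -> differentiable (F2 i j) u. Proof. exact: smooth_on_diff. Qed.
Let dnu u : U u -> differentiable nu u. Proof. exact: smooth_on_diff. Qed.

Let rowJ u i : U u -> row i ('J F u) = F1 i u.
Proof. by move=> Uu; rewrite row_jacobian //; exact: dF. Qed.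

Let gE u i j : U u -> g u i j = dot (F1 i u) (F1 j u).
Proof. by move=> Uu; rewrite gE0 mulmx_tr_dot !rowJ. Qed.

Let gU u : U u -> g u \in unitmx.
Proof. by move=> Uu; rewrite gE0; apply: gram_unit; exact: fF. Qed.

Let Dg u i j l : U u -> 'D_('e_i) (fun v => g v j l : R^o) u =
  dot (F2 i j u) (F1 l u) + dot (F1 j u) (F2 i l u).
Proof.
move=> Uu; apply: (etrans _ (derive_dot _ (dF1 j Uu) (dF1 l Uu))).
by apply: (eq_on_derive _ oU) => // v Uv; exact: gE.
Qed.

Definition second_form (u : 'rV[R]_n) : 'M[R]_n :=
  \matrix_(i, j) dot ('D_('e_i) ('D_('e_j) F) u) (nu u).

(** The product rule expands the three derivatives of the metric into six inner products; symmetry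
    of second derivatives cancels four of them and makes the other two equal. *)
Lemma christoffelE u k i j : U u ->
  christoffel g k i j u = \sum_l invmx (g u) k l * dot (F2 i j u) (F1 l u).
Proof.
move=> Uu; rewrite /christoffel mulr_sumr; apply: eq_bigr => l _.
have key (A B C A' B' C' X Y Z : 'rV[R]_p) : A' = A -> B' = B -> C' = C ->
    (dot A Z + dot Y B) + (dot A' Z + dot X C) - (dot B' Y + dot X C') = 2 * dot A Z.
  by move=> -> -> ->; rewrite (dotC B); ring.
rewrite [X in _ * (_ * X)](_ : _ = 2 * dot (F2 i j u) (F1 l u)); last first.
  apply: (etrans (congr2 (fun a b => a - b)
    (congr2 +%R (Dg i j l Uu) (Dg j i l Uu)) (Dg l i j Uu))).
  apply: (key (F2 i j u) (F2 i l u) (F2 j l u)).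
  - exact: smooth_on_schwarz oU SF Uu.
  - exact: smooth_on_schwarz oU SF Uu.
  - exact: smooth_on_schwarz oU SF Uu.
by rewrite mulrCA (mulrA 2^-1) mulVf ?mul1r // pnatr_eq0.
Qed.

Let chrg u i j l : U u ->
  \sum_k christoffel g k i j u * g u k l = dot (F2 i j u) (F1 l u).
Proof.
move=> Uu.
have -> : \sum_k christoffel g k i j u * g u k l =
   ((\row_q dot (F2 i j u) (F1 q u)) *m (invmx (g u))^T *m g u) 0 l.
  rewrite mxE; apply: eq_bigr => k _; congr (_ * _).
  rewrite christoffelE // mxE; apply: eq_bigr => q _.
  by rewrite !mxE mulrC.
have -> : (invmx (g u))^T = invmx (g u).
  by rewrite trmx_inv gE0 trmx_mul trmxK.
by rewrite -mulmxA mulVmx ?gU // mulmx1 mxE.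
Qed.

Let giC u k l : invmx (g u) k l = invmx (g u) l k.
Proof.
have <- : (invmx (g u))^T = invmx (g u) by rewrite trmx_inv gE0 trmx_mul trmxK.
by rewrite [LHS]mxE trmx_inv gE0 trmx_mul trmxK.
Qed.

(** By [christoffelE], the coefficients of the orthogonal projection of a second derivative of [F]
    onto the tangent space are the Christoffel symbols. *)
Lemma gauss_formula u i j : U u ->
  F2 i j u = \sum_k christoffel g k i j u *: F1 k u + second_form u i j *: nu u.
Proof.
move=> Uu; rewrite {1}(tangent_decomp (F2 i j u) pn (fF Uu) (nuF Uu) (nu1 Uu)).
rewrite -gE0 [second_form u i j]mxE; congr (_ + _).
rewrite mulmx_sum_row; apply: eq_bigr => k _; rewrite rowJ //; congr (_ *: _).
rewrite christoffelE // [LHS]mxE; apply: eq_bigr => l _.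
rewrite mulmx_tr_dot row_id rowJ // mulrC; congr (_ * _).
exact: giC.
Qed.

Lemma smooth_induced i j : smooth U (fun v => g v i j).
Proof.
move=> k; have := smooth_dot oU (SF1 i) (SF1 j) k.
by apply: Ck_eq => // v Uv; rewrite gE.
Qed.

Lemma smooth_christoffel k i j : smooth U (christoffel g k i j).
Proof.
move=> q.
have H : Ck q U (fun u => \sum_l invmx (g u) k l * dot (F2 i j u) (F1 l u)).
  apply: Ck_sum => // l _; apply: CkM => //.
    by apply: Ck_invmx => // i' j'; exact: smooth_induced.
  exact: smooth_dot.
by apply: Ck_eq H => // u Uu; rewrite christoffelE.
Qed.

Lemma second_formC u i j : U u -> second_form u i j = second_form u j i.
Proof.
move=> Uu; rewrite [LHS]mxE [RHS]mxE.
apply: (congr1 (fun z => dot z (nu u))).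
exact: smooth_on_schwarz oU SF Uu.
Qed.

(** One of the two halves that are skew-symmetrized in the curvature, with its upper index lowered.
    It results from differentiating [chrg]: the derivative of the metric produces the quadratic term
    in the symbols and a product of second derivatives, whose normal part is the product of second
    forms. *)
Let halfcurv u i j k q : U u ->
  \sum_l 'D_('e_i) (christoffel g l j k : _ -> R^o) u * g u l q +
  \sum_l (\sum_m christoffel g l i m u * christoffel g m j k u) * g u l q =
  dot ('D_('e_i) (F2 j k) u) (F1 q u) + second_form u j k * second_form u i q.
Proof.
move=> Uu.
have E : 'D_('e_i) (fun v => \sum_l christoffel g l j k v * g v l q) u =
         'D_('e_i) (fun v => dot (F2 j k v) (F1 q v)) u.
  by apply: (eq_on_derive _ oU) => // v Uv; exact: chrg.
have {}E := etrans E (derive_dot _ (dF2 j k Uu) (dF1 q Uu)).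
have dG l : derivable (christoffel g l j k) u 'e_i.
  by apply: diff_derivable; exact: (smooth_diff (smooth_christoffel _ _ _)).
have dg l : derivable (fun v => g v l q) u 'e_i.
  by apply: diff_derivable; exact: (smooth_diff (smooth_induced _ _)).
rewrite (_ : (fun v => _) = \sum_(l < n) (christoffel g l j k * (fun v => g v l q))) in E;
  last by apply/funext => v; rewrite fct_sumE.
rewrite derive_sum in E; last by move=> l; apply: derivableM.
have E2 : \sum_(l < n) 'D_('e_i) (christoffel g l j k * (fun v => g v l q)) u =
  \sum_l 'D_('e_i) (christoffel g l j k : _ -> R^o) u * g u l q +
  (\sum_l christoffel g l j k u * dot (F2 i l u) (F1 q u) +
   \sum_l christoffel g l j k u * dot (F1 l u) (F2 i q u)).
  rewrite -!big_split /=; apply: eq_bigr => l _.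
  rewrite (deriveM (dG l) (dg l)) [RHS]addrC; congr (_ + _); last exact: mulrC.
  by apply: (etrans (congr1 (fun z => christoffel g l j k u * z) (Dg i l q Uu))); exact: mulrDr.
have E3 : dot (F2 j k u) (F2 i q u) =
  \sum_l christoffel g l j k u * dot (F1 l u) (F2 i q u) +
  second_form u j k * second_form u i q.
  rewrite {1}(gauss_formula j k Uu) dotDl dotZl dot_suml; congr (_ + _ * _).
    by apply: eq_bigr => l _; rewrite dotZl.
  by rewrite dotC mxE.
have E4 : \sum_l (\sum_m christoffel g l i m u * christoffel g m j k u) * g u l q =
  \sum_l christoffel g l j k u * dot (F2 i l u) (F1 q u).
  under eq_bigr do rewrite mulr_suml.
  rewrite exchange_big /=; apply: eq_bigr => m _.
  rewrite -chrg // mulr_sumr; apply: eq_bigr => l _; ring.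
have fin (a b x d e s : R) : a + (b + x) = d + e -> e = x + s -> a + b = d + s.
  by move=> H1 H2; apply: (addIr x); rewrite -addrA H1 H2; ring.
rewrite E4; exact: fin (etrans (esym E2) E) E3.
Qed.

(** In the difference of two copies of [halfcurv] the third derivatives of [F] cancel, since they do
    not depend on the order of differentiation. *)
Lemma gauss_equation u i j k q : U u ->
  \sum_l curvature g l k i j u * g u l q =
  second_form u j k * second_form u i q - second_form u i k * second_form u j q.
Proof.
move=> Uu; have H1 := halfcurv i j k q Uu; have H2 := halfcurv j i k q Uu.
have H3 : 'D_('e_i) (F2 j k) u = 'D_('e_j) (F2 i k) u.
  exact: smooth_on_schwarz oU (SF1 k) Uu.
rewrite H3 in H1.
have E : \sum_l curvature g l k i j u * g u l q =
  (\sum_l 'D_('e_i) (christoffel g l j k : _ -> R^o) u * g u l q +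
  \sum_l (\sum_m christoffel g l i m u * christoffel g m j k u) * g u l q) -
  (\sum_l 'D_('e_j) (christoffel g l i k : _ -> R^o) u * g u l q +
  \sum_l (\sum_m christoffel g l j m u * christoffel g m i k u) * g u l q).
  have L (d1 d2 s1 s2 c : R) :
    (d1 - d2 + (s1 - s2)) * c = d1 * c + s1 * c - (d2 * c + s2 * c) by ring.
  apply: etrans (eq_bigr _ (fun l _ => etrans (congr1 (fun z => z * g u l q)
    (congr1 (fun z => _ + z) (sumrB _ _ _ _))) (L _ _ _ _ _))) _.
  apply: etrans (sumrB _ _ _ _) _.
  by apply: (congr2 (fun a b => a - b)); exact: big_split.
apply: (etrans E).
have L (a b c x y : R) : x = a + b -> y = a + c -> x - y = b - c.
  by move=> -> ->; ring.
apply: L.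
  exact: H1.
exact: H2.
Qed.

Lemma ricciE u : U u ->
  ricci g u = \tr (second_form u *m invmx (g u)) *: second_form u
    - second_form u *m invmx (g u) *m second_form u.
Proof.
move=> Uu; set B := second_form u.
have E i j k l : curvature g l k i j u =
   \sum_q (B j k * B i q - B i k * B j q) * invmx (g u) q l.
  have H : (\row_l curvature g l k i j u) *m g u =
           \row_q (B j k * B i q - B i k * B j q).
    apply/rowP => q; rewrite mxE [RHS]mxE -gauss_equation //.
    by apply: eq_bigr => l' _; rewrite mxE.
  have := congr1 (fun M => (M *m invmx (g u)) 0 l) H.
  rewrite -mulmxA mulmxV ?gU // mulmx1 mxE => ->.
  by rewrite mxE; apply: eq_bigr => q _; rewrite mxE.
clearbody B.
apply/matrixP => j k; rewrite [LHS]mxE [RHS]mxE [X in _ = X + _]mxE [X in _ = _ + X]mxE.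
under eq_bigr do rewrite E.
have -> : \tr (B *m invmx (g u)) * B j k =
    \sum_i \sum_q B j k * B i q * invmx (g u) q i.
  rewrite /mxtrace mulr_suml; apply: eq_bigr => i _.
  by rewrite mxE mulr_suml; apply: eq_bigr => q _; ring.
rewrite [X in _ - X]mxE -sumrB; apply: eq_bigr => i _.
rewrite mxE mulr_suml -sumrB; apply: eq_bigr => q _; ring.
Qed.

(** The Weingarten equation, by differentiating the orthogonality of [nu] to the tangent vectors. It
    has only first derivatives, so a change of chart acts on it by matrix factors. *)
Lemma second_formE u : U u -> second_form u = - ('J F u *m ('J nu u)^T).
Proof.
move=> Uu; apply/matrixP => i j; rewrite second_formC // [LHS]mxE [RHS]mxE.
rewrite mulmx_tr_dot rowJ // (row_jacobian j (dnu Uu)).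
have E : 'D_('e_j) (fun v => dot (F1 i v) (nu v)) u = 0.
  apply: (etrans (eq_on_derive 'e_j oU _ Uu) (derive_cst (0 : R) u 'e_j)) => v Uv.
  have := congr1 (fun M : 'rV_n => M 0 i) (nuF Uv); rewrite [RHS]mxE => <-.
  by rewrite dotC mulmx_tr_dot rowJ // row_id.
have {}E := etrans (esym (derive_dot _ (dF1 i Uu) (dnu Uu))) E.
by apply/eqP; rewrite -addr_eq0; apply/eqP; exact: E.
Qed.

Lemma local_sffE u i j : U u ->
  local_sff g (fun=> 1%:M) F u i j = second_form u i j *: nu u.
Proof.
move=> Uu; rewrite /local_sff.
have -> : (\row_a (\sum_b \sum_c christoffel (fun=> 1%:M) a b c (F u) *
             ('J F u) i b * ('J F u) j c)) = 0.
  apply/rowP => a; rewrite !mxE big1 // => b _; rewrite big1 // => c _.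
  rewrite /christoffel big1 ?mulr0 ?mul0r // => l _.
  by rewrite !derive_cst !addr0 subrr mulr0.
rewrite addr0 -[RHS](addKr (\sum_k christoffel g k i j u *: F1 k u)) addrC.
apply: (congr2 +%R); last exact: gauss_formula.
by apply: (congr1 -%R); apply: eq_bigr => k _; rewrite rowJ.
Qed.

End Gauss.

Section RicciBound.
Context {R : realType} {n p : nat}.
Variables (A S : 'M[R]_(n, p)) (B g : 'M[R]_n) (v : 'rV[R]_p).
Hypotheses (fA : row_free A) (gE : g = A *m A^T) (BS : B = - (A *m S^T)).
Hypotheses (BT : B^T = B) (vA : (v <= A)%MS) (v1 : dot v v = 1).

Let a := v *m pinvmx A.
Let tau := \tr (B *m invmx g).

(** Let [b] be the image of [v] under the shape operator, [beta] its component along [v] and [c] its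
    squared length. The Ricci value is [tau * beta - c], and Cauchy-Schwarz gives [c >= beta ^+ 2].
    Moreover [tau ^+ 2 / 2 - tau * beta + beta ^+ 2] is half of [(tau - beta) ^+ 2 + beta ^+ 2].
    Equality thus forces [beta = 0], [tau = 0], then [c = 0] and [b = 0]. *)
Lemma ricci_bound (rho := tau *: B - B *m invmx g *m B) :
  dot (a *m rho) a <= tau ^+ 2 / 2 /\
  (dot (a *m rho) a = tau ^+ 2 / 2 -> tau = 0 /\ v *m S^T = 0).
Proof.
have gU : g \in unitmx by rewrite gE; exact: gram_unit.
have aA : a *m A = v by exact: mulmxKpV.
have giT : (invmx g)^T = invmx g by rewrite trmx_inv gE trmx_mul trmxK.
pose b := a *m B *m invmx g *m A.
pose beta := dot (a *m B) a.
pose c := dot (a *m (B *m invmx g *m B)) a.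
have E : dot (a *m rho) a = tau * beta - c.
  by rewrite /rho mulmxBr -scalemxAr dotBl dotZl.
have bA : b *m A^T = a *m B by rewrite /b -mulmxA -gE -mulmxA mulVmx // mulmx1.
have bb : dot b b = c.
  by rewrite {2}/b dot_mulmx bA dot_mulmx giT dot_mulmx BT /c !mulmxA.
have bv : dot b v = beta by rewrite -aA dot_mulmx bA.
have cb : 0 <= c - beta ^+ 2.
  have := dot_ge0 (b - beta *: v).
  rewrite dotBl !dotBr !dotZl !dotZr bb (dotC v) bv v1.
  by rewrite (_ : _ - _ = c - beta ^+ 2) //; ring.
rewrite E; split.
  by have := sqr_ge0 (tau - beta); have := sqr_ge0 beta; rewrite !expr2 in cb *; nra.
move=> Eq.
have H1 := sqr_ge0 (tau - beta); have H2 := sqr_ge0 beta.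
have H3 : beta ^+ 2 = 0 by rewrite !expr2 in cb H1 H2 Eq *; nra.
have b0 : beta = 0 by apply/eqP; rewrite -sqrf_eq0 H3.
have t0 : tau = 0.
  by apply/eqP; rewrite -sqrf_eq0; apply/eqP; rewrite b0 !expr2 in cb H1 Eq *; nra.
split=> //.
have c0 : c = 0 by rewrite t0 b0 in Eq; lra.
have b00 : b = 0 by apply: dot_eq0; rewrite bb.
have aBg : a *m B *m invmx g = 0 by apply: (row_free_inj fA); rewrite mul0mx.
have aB : a *m B = 0 by rewrite -[LHS]mulmx1 -(mulVmx gU) mulmxA aBg mul0mx.
by move/eqP: aB; rewrite BS mulmxN mulmxA aA oppr_eq0 => /eqP.
Qed.

End RicciBound.

Section Cplx.
Context {R : realType} {m : nat}.

Definition Jmx : 'M[R]_(m + m) := block_mx 0 1%:M (- 1%:M) 0.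

Lemma cplxJE (v : 'rV[R]_(m + m)) : cplxJ v = v *m Jmx.
Proof.
rewrite /cplxJ /Jmx -{3}[v]hsubmxK mul_row_block.
by rewrite !mulmx0 mulmx1 mulmxN mulmx1 add0r addr0.
Qed.

Lemma JmxT : Jmx^T = - Jmx.
Proof.
by rewrite /Jmx tr_block_mx opp_block_mx !trmx0 !oppr0 opprK linearN /= trmx1.
Qed.

Lemma JmxJ : Jmx *m Jmx = - 1%:M.
Proof.
rewrite /Jmx mulmx_block !mul0mx !mulmx0 !mulmx1 !mul1mx !addr0 !add0r.
by rewrite scalar_mx_block opp_block_mx !oppr0.
Qed.

Lemma dot_J (v w : 'rV[R]_(m + m)) : dot (v *m Jmx) w = - dot v (w *m Jmx).
Proof. by rewrite [in RHS]dot_mulmx JmxT mulmxN dotNl opprK. Qed.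

Lemma dot_Jv (v : 'rV[R]_(m + m)) : dot (v *m Jmx) v = 0.
Proof. by have := dot_J v v; rewrite (dotC v) => H; lra. Qed.

Lemma dot_JJ (v w : 'rV[R]_(m + m)) : dot (v *m Jmx) (w *m Jmx) = dot v w.
Proof. by rewrite dot_J -mulmxA JmxJ mulmxN mulmx1 dotNr opprK. Qed.

End Cplx.

(** * Change of charts and the curvature of a hypersurface *)

Section Charts.
Context {R : realType} {n : nat} {M : smoothManifold R n}.
Implicit Types c d : chart R n M.

Lemma chart_open c (V : set M) : open V -> open (ccod c `&` cinv c @^-1` V).
Proof.
move=> oV; rewrite openE => u [cu Vu]; rewrite /interior.
have := @cinv_continuous _ _ _ c.
rewrite continuous_open_subspace; last exact: ccod_open.
move=> /(_ u (mem_set cu)) => /(_ V (open_nbhs_nbhs (conj oV Vu))) H.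
by apply: filterI => //; apply: open_nbhs_nbhs; split => //; exact: ccod_open.
Qed.

Lemma eq_on_jacobian k q (U : set 'rV[R]_k) (F G : 'rV[R]_k -> 'rV[R]_q) u :
  open U -> (forall u, U u -> F u = G u) -> U u -> differentiable F u ->
  'J F u = 'J G u.
Proof.
move=> oU FG Uu dF; apply/row_matrixP => i.
have dG : differentiable G u by apply: near_differentiable dF; exact: (near_open oU).
apply: (etrans (row_jacobian i dF)); apply: (etrans (eq_on_derive 'e_i oU FG Uu)).
exact: esym (row_jacobian i dG).
Qed.

Lemma jacobian_transition c d q (G : M -> 'rV[R]_q) u :
  atlas c -> atlas d -> smooth_vec G -> ccod c u -> cdom d (cinv c u) ->
  'J (G \o cinv c) u =
  'J (cmap d \o cinv c) u *m 'J (G \o cinv d) (cmap d (cinv c u)).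
Proof.
move=> ac ad SG cu du.
have oW := @chart_open c _ (@cdom_open _ _ _ d).
set W := _ `&` _ in oW.
have Wu : W u by split.
have dG : differentiable (G \o cinv c) u by exact: smooth_on_diff (SG c ac) cu.
have E (w : 'rV[R]_n) : W w -> (G \o cinv c) w = ((G \o cinv d) \o (cmap d \o cinv c)) w.
  by move=> [cw dw] /=; rewrite cmapK.
apply: (etrans (eq_on_jacobian oW E Wu dG)); apply: jacobian_comp.
- exact: smooth_on_diff (atlas_smooth ac ad) _.
- by apply: smooth_on_diff (SG d ad) _; exact: cmap_cod.
Qed.

End Charts.

Section Hypersurface.
Context {R : realType} {n p : nat} {M : smoothManifold R n}.
Variables (f xi : M -> 'rV[R]_p).
Hypotheses (pn : p = n.+1) (f_imm : immersion f) (xi_smooth : smooth_vec xi).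
Hypothesis xi_normal : unit_normal_field f xi.

(** [immersion] speaks only of the preferred chart at each point. The Jacobian there is a transition
    matrix times the Jacobian in [c], and a product has at most the rank of its factors. *)
Lemma immersion_chart c u : atlas c -> ccod c u -> row_free ('J (f \o cinv c) u).
Proof.
move=> ac cu; set x := cinv c u; set d := chart_at x.
have ad : atlas d by exact: chart_at_atlas.
have dx : cdom d x by exact: chart_at_dom.
have cx : cdom c x by exact: cinv_dom.
have E := jacobian_transition (q := p) (G := f) ad ac f_imm.1 (cmap_cod dx).
rewrite cmapK // cinvK // in E; have {}E := E cx.
have := f_imm.2 x; rewrite /tangent -/d E -!row_leq_rank => H.
exact: leq_trans H (mxrankM_maxr _ _).
Qed.

Lemma normal_chart c u : atlas c -> ccod c u ->
  xi (cinv c u) *m ('J (f \o cinv c) u)^T = 0.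
Proof.
move=> ac cu; set x := cinv c u; set d := chart_at x.
have ad : atlas d by exact: chart_at_atlas.
have dx : cdom d x by exact: chart_at_dom.
rewrite (jacobian_transition (d := d) ac ad f_imm.1 cu) //.
rewrite trmx_mul mulmxA.
have -> : xi x *m ('J (f \o cinv d) (cmap d x))^T = 0; last by rewrite mul0mx.
apply/rowP => j; rewrite mulmx_tr_dot row_id mxE.
by apply: (xi_normal x).2; exact: row_sub.
Qed.

Lemma smooth_chart c : atlas c -> smooth_on (ccod c) (f \o cinv c).
Proof. exact: f_imm.1. Qed.

Section AtPoint.
Variable x : M.
Let c := chart_at x.
Let u := cmap c x.
Let B := second_form (f \o cinv c) (xi \o cinv c) u.
Let tau := \tr (B *m invmx (induced_metric f c u)).

Let ac : atlas c. Proof. exact: chart_at_atlas. Qed.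
Let cu : ccod c u. Proof. by apply: cmap_cod; exact: chart_at_dom. Qed.
Let xu : cinv c u = x. Proof. by rewrite cmapK //; exact: chart_at_dom. Qed.

Let nu1 w : ccod c w -> dot ((xi \o cinv c) w) ((xi \o cinv c) w) = 1.
Proof. by move=> _; exact: (xi_normal _).1. Qed.
Let fF w : ccod c w -> row_free ('J (f \o cinv c) w).
Proof. exact: immersion_chart. Qed.
Let nuF w : ccod c w -> (xi \o cinv c) w *m ('J (f \o cinv c) w)^T = 0.
Proof. exact: normal_chart. Qed.

Lemma mean_curvatureE : mean_curvature f x = (n%:R^-1 * tau) *: xi x.
Proof.
rewrite /mean_curvature -scalerA; congr (_ *: _).
rewrite /tau /mxtrace exchange_big /= scaler_suml; apply: eq_bigr => j _.
rewrite mxE scaler_suml; apply: eq_bigr => i _.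
have -> : sff f x i j = B i j *: xi x.
  have E : sff f x i j = B i j *: (xi \o cinv c) u.
    have := (local_sffE pn (@ccod_open _ _ _ c) (smooth_chart ac) fF nuF nu1
      (g := induced_metric f c) (fun=> erefl) i j cu).
    exact.
  by rewrite E /= xu.
rewrite scalerA mulrC; congr (_ * _ *: _).
exact: (second_formC _ (@ccod_open _ _ _ c) (smooth_chart ac)).
Qed.

Lemma ric_point (v : 'rV[R]_p) : (v <= tangent f x)%MS -> dot v v = 1 ->
  Ric f x v v <= tau ^+ 2 / 2 /\
  (Ric f x v v = tau ^+ 2 / 2 ->
    tau = 0 /\ v *m ('J (xi \o cinv c) u)^T = 0).
Proof.
move=> vx v1.
have Snu : smooth_on (ccod c) (xi \o cinv c) by exact: xi_smooth.
have oc := @ccod_open _ _ _ c.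
have E := ricciE pn oc (smooth_chart ac) fF nuF nu1
  (g := induced_metric f c) (fun=> erefl) cu.
rewrite /Ric -/c -/u E.
apply: (ricci_bound (A := tangent f x)) => //.
- exact: f_imm.2.
- exact: (second_formE oc (smooth_chart ac) Snu nuF).
- apply/matrixP => i j; rewrite [LHS]mxE.
  exact: (second_formC _ oc (smooth_chart ac)).
Qed.

End AtPoint.
End Hypersurface.

(** * The inverse function theorem *)

HB.instance Definition _ (R : realType) m n := Complete.on 'M[R]_(m, n).

Section RowNorm.
Context {R : realType}.

Lemma dist_continuous (V : normedModType R) (a : V) : continuous (fun u : V => `|u - a|).
Proof.
move=> u; have H : (x - a @[x --> u]) --> u - a.
  by apply: cvgB; [exact: cvg_id|exact: cvg_cst].
exact: (cvg_norm H).
Qed.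

Lemma near_norm_ball (V : normedModType R) (a : V) (P : V -> Prop) :
  (\forall h \near a, P h) -> exists2 d : R, 0 < d & forall h, `|h - a| < d -> P h.
Proof.
by move=> /nbhs_normP [d /= d0 H]; exists d => // h hd; apply: H; rewrite /= distrC.
Qed.

Lemma open_ball_norm (V : normedModType R) (a : V) (r : R) : open [set u | `|u - a| < r].
Proof.
have -> : [set u | `|u - a| < r] = (fun u => `|u - a|) @^-1` [set x | x < r] by [].
by apply: open_comp; [move=> u _; exact: dist_continuous|exact: open_lt].
Qed.

Lemma closed_ball_norm (V : normedModType R) (a : V) (r : R) :
  closed [set u | `|u - a| <= r].
Proof.
have -> : [set u | `|u - a| <= r] = (fun u => `|u - a|) @^-1` [set x | x <= r] by [].
by apply: preimage_closed; [move=> u _; exact: dist_continuous|exact: closed_le].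
Qed.

Lemma coord_norm_le m n (v : 'M[R]_(m, n)) i j : `|v i j| <= `|v|.
Proof.
rewrite [leRHS]/Num.Def.normr/= mx_normrE.
exact: (le_bigmax (0 : R) (fun ij : 'I_m * 'I_n => `|v ij.1 ij.2|) (i, j)).
Qed.

Lemma norm_coord_le m n (v : 'M[R]_(m, n)) c : 0 <= c ->
  (forall i j, `|v i j| <= c) -> `|v| <= c.
Proof.
move=> c0 vc; rewrite [leLHS]/Num.Def.normr/= mx_normrE.
by apply: bigmax_le => // ij _; exact: vc.
Qed.

Lemma differentiable_mulmxr n p (A : 'M[R]_(n, p)) (v : 'rV[R]_n) :
  differentiable (fun w : 'rV[R]_n => w *m A) v.
Proof.
apply/differentiable_rV => j.
have -> : (fun w : 'rV[R]_n => (w *m A) 0 j) =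
   \sum_(i < n) (fun w : 'rV[R]_n => A i j *: (w 0 i : R)).
  apply/funext => w; rewrite fct_sumE mxE; apply: eq_bigr => i _.
  exact: mulrC.
apply: differentiable_sum => i; apply: differentiableZ.
exact: differentiable_coord.
Qed.

Lemma continuous_mulmxr n p (A : 'M[R]_(n, p)) :
  continuous (fun w : 'rV[R]_n => w *m A).
Proof. by move=> v; apply: differentiable_continuous; exact: differentiable_mulmxr. Qed.

Lemma mulmxr_bound n p (A : 'M[R]_(n, p)) :
  exists2 c : R, 0 < c & forall w : 'rV[R]_n, `|w *m A| <= c * `|w|.
Proof. exact: (linear_lipschitz (f := mulmxr A) (@continuous_mulmxr _ _ A)). Qed.

Lemma derive_mulmxr n p (A : 'M[R]_(n, p)) (v u : 'rV[R]_n) :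
  'D_v (fun w : 'rV[R]_n => w *m A) u = v *m A.
Proof.
rewrite deriveE; last exact: differentiable_mulmxr.
by rewrite (diff_lin (f := mulmxr A) _ (@continuous_mulmxr _ _ A)).
Qed.

Lemma fixed_point n (B : set 'rV[R]_n) (T : 'rV[R]_n -> 'rV[R]_n) :
  closed B -> B !=set0 -> (forall u, B u -> B (T u)) ->
  (forall u v, B u -> B v -> `|T u - T v| <= 2^-1 * `|u - v|) ->
  exists2 u, B u & u = T u.
Proof.
move=> cB B0 TB TL.
have funT : set_fun B B T by [].
pose T' : {fun B >-> B} := HB.pack T (isFun.Build _ _ B B T funT).
have h0 : (0 : R) <= 2^-1 by rewrite invr_ge0.
apply: (@banach_fixed_point R _ B T') => //.
exists (NngNum h0); split => /=; first by rewrite invf_lt1 // ltr1n.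
by move=> [u v] [/= Bu Bv]; exact: TL.
Qed.

End RowNorm.

Section InverseFunction.
Context {R : realType} {n : nat}.
Variables (U : set 'rV[R]_n) (Th : 'rV[R]_n -> 'rV[R]_n) (u0 : 'rV[R]_n).
Hypotheses (oU : open U) (STh : smooth_on U Th) (Uu0 : U u0).
Hypotheses (Th0 : Th u0 = 0) (JTh : 'J Th u0 = 1%:M).

(** Solving [Th u = y] means finding a fixed point of [u |-> y + E u]. The Jacobian of [E] vanishes
    at [u0], so this map contracts near [u0]. *)
Let E u := u - Th u.

Let dTh u : U u -> differentiable Th u. Proof. exact: smooth_on_diff. Qed.

Let DTh i j u : U u -> 'D_('e_i) (fun t => Th t 0 j) u = ('J Th u) i j.
Proof. by move=> Uu; rewrite jacobianE //; exact: dTh. Qed.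

Lemma contraction_near :
  exists2 r, 0 < r & forall u v, `|u - u0| <= r -> `|v - u0| <= r ->
    U u /\ `|E u - E v| <= 2^-1 * `|u - v|.
Proof.
(* Each coordinate of [E u - E v] is a sum of [n] terms of size at most [e] times the distance, so
   this [e] yields the factor 1/2; [n.+1] avoids dividing by 0. *)
pose e : R := (2 * n.+1%:R)^-1.
have e0 : 0 < e by rewrite invr_gt0 mulr_gt0.
have near_e i j : \forall u \near u0, `|(i == j)%:R - 'D_('e_i) (fun t => Th t 0 j) u| < e.
  have Sj : smooth U ('D_('e_i) (fun t => Th t 0 j)).
    by apply: smooth_D; exact: ((smooth_onP _ oU).1 STh).
  have /differentiable_continuous/cvgrPdist_lt/(_ e e0) := smooth_diff Sj Uu0.
  by rewrite DTh // JTh mxE.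
have nearU : \forall u \near u0, U u by exact: open_nbhs_nbhs.
have near_e' : \forall u \near u0, forall i j,
    `|(i == j)%:R - 'D_('e_i) (fun t => Th t 0 j) u| < e.
  have H i := filter_forall (nbhs_filter u0) (near_e i).
  exact: (filter_forall (nbhs_filter u0) H).
have /nbhs_normP [r /= r0 Hr] : \forall u \near u0, U u /\
    forall i j, `|(i == j)%:R - 'D_('e_i) (fun t => Th t 0 j) u| < e.
  exact: filterI nearU near_e'.
(* Halving passes from the open ball to a closed one, as the fixed point theorem needs a closed
   set. *)
exists (r / 2); first by rewrite divr_gt0.
have inB w : `|w - u0| <= r / 2 -> U w /\
    forall i j, `|(i == j)%:R - 'D_('e_i) (fun t => Th t 0 j) w| < e.
  move=> wr; apply: Hr; rewrite /= distrC; apply: le_lt_trans wr _.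
  by rewrite ltr_pdivrMr // ltr_pMr // ltr1n.
move=> u v ur vr; split; first exact: (inB u ur).1.
apply: norm_coord_le => [|i j]; first by rewrite mulr_ge0.
rewrite (ord1 i) => {i}.
pose w := u - v.
have seg (s : R) : 0 <= s <= 1 -> `|s *: w + v - u0| <= r / 2.
  move=> /andP[s0 s1].
  have -> : s *: w + v - u0 = s *: (u - u0) + (1 - s) *: (v - u0).
    by rewrite /w !scalerBr scalerBl !scale1r; apply/rowP => k; rewrite !mxE; ring.
  apply: le_trans (ler_normD _ _) _; rewrite !normrZ !ger0_norm ?subr_ge0 //.
  have s1' : 0 <= 1 - s by rewrite subr_ge0.
  have := ler_wpM2l s0 ur; have := ler_wpM2l s1' vr.
  by move: `|u - u0| `|v - u0| => a b; nra.
have dEj (s : R) : 0 <= s <= 1 -> differentiable (fun t => E t 0 j) (s *: w + v).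
  move=> s01; have [Us _] := inB _ (seg s s01).
  apply: diff_coord; apply: differentiableB => //; exact: dTh.
have [c /andP[c0 c1]] := MVT_line dEj.
have c01 : 0 <= c <= 1 by rewrite !ltW.
have [Uc Hc] := inB _ (seg c c01).
rewrite subrK => Ec.
have -> : (E u - E v) 0 j = E u 0 j - E v 0 j by rewrite mxE [X in _ + X = _]mxE.
rewrite Ec derive_coords; last exact: dEj.
apply: le_trans (ler_norm_sum _ _ _) _.
apply: (@le_trans _ _ (\sum_(i < n) `|u - v| * e)).
  apply: ler_sum => i _; rewrite normrM; apply: ler_pM => //.
    exact: coord_norm_le.
  have -> : 'D_('e_i) (fun t => E t 0 j) (c *: w + v) =
     (i == j)%:R - 'D_('e_i) (fun t => Th t 0 j) (c *: w + v).
    pose pj (t : 'rV[R]_n) : R := t 0 j; pose tj (t : 'rV[R]_n) : R := Th t 0 j.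
    have -> : (fun t => E t 0 j) = pj - tj.
      by apply/funext => t; rewrite !fctE /E !mxE.
    have dp : derivable pj (c *: w + v) 'e_i.
      by apply: diff_derivable; exact: differentiable_coord.
    have dt : derivable tj (c *: w + v) 'e_i.
      by apply: diff_derivable; apply: diff_coord; exact: dTh.
    rewrite (deriveB dp dt); apply: (congr1 (fun z => z - _)).
    have dI : differentiable (id : 'rV[R]_n -> 'rV[R]_n) (c *: w + v).
      by [].
    apply: (etrans (esym (derive_rV 'e_i j dI))).
    by rewrite derive_id mxE eqxx /= eq_sym.
  by apply: ltW.
rewrite sumr_const card_ord -[leLHS]mulr_natr -[leLHS]mulrA [leRHS]mulrC ler_wpM2l //.
rewrite /e invfM -mulrA ler_piMr ?invr_ge0 // mulrC ler_pdivrMr // mul1r ler_nat.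
exact: leqnSn.
Qed.

Theorem inverse_function : exists2 rho, 0 < rho & exists th : 'rV[R]_n -> 'rV[R]_n,
  [/\ smooth_on [set y | `|y| < rho] th, th 0 = u0,
      forall y, `|y| < rho -> U (th y) /\ Th (th y) = y &
      forall y, `|y| < rho -> 'J th y *m 'J Th (th y) = 1%:M].
Proof.
have [r r0 Hr] := contraction_near.
(* On the closed ball of radius [r] the contraction moves [E u] from [u0] by at most [r / 2]; adding
   [y] with [|y| < r / 2] stays inside. *)
pose rho := r / 2.
have rho0 : 0 < rho by rewrite divr_gt0.
pose B : set 'rV[R]_n := [set u | `|u - u0| <= r].
have Eu0 : E u0 = u0 by rewrite /E Th0 subr0.
have Bu0 : B u0 by rewrite /B /= subrr normr0 ltW.
have cB : closed B by exact: closed_ball_norm.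
have ex y : `|y| < rho -> exists u, [/\ B u, U u & Th u = y].
  move=> yr.
  have [||u v Bu Bv|u Bu uE] := @fixed_point _ _ B (fun u => y + E u) cB.
  - by exists u0.
  - move=> u Bu; rewrite /B /=.
    have -> : y + E u - u0 = y + (E u - E u0) by rewrite Eu0 [RHS]addrA.
    apply: le_trans (ler_normD _ _) _.
    have := (Hr u u0 Bu Bu0).2; move: Bu yr; rewrite /B /= /rho.
    move: `|u - u0| `|E u - E u0| `|y| => a b c; lra.
  - have -> : y + E u - (y + E v) = E u - E v by apply/rowP => k; rewrite !mxE; ring.
    exact: (Hr u v Bu Bv).2.
  exists u; split => //; first exact: (Hr u u Bu Bu).1.
  move: uE; rewrite /E addrCA => /eqP; rewrite -subr_eq0 opprD addNKr.
  by rewrite opprB subr_eq0 => /eqP.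
pose th y := if pselect (`|y| < rho) is left H then sval (cid (ex y H)) else 0.
have thP y : `|y| < rho -> [/\ B (th y), U (th y) & Th (th y) = y].
  by move=> yr; rewrite /th; case: pselect => // H; case: cid.
(* From [u - v = (Th u - Th v) + (E u - E v)], where the last term has at most half the norm of the
   left side. This gives uniqueness of preimages and the Lipschitz bound for the inverse. *)
have lip u v : B u -> B v -> `|u - v| <= 2 * `|Th u - Th v|.
  move=> Bu Bv; have [_ H] := Hr u v Bu Bv.
  have : `|u - v| <= `|Th u - Th v| + `|E u - E v|.
    apply: le_trans (ler_normD _ _); rewrite /E.
    rewrite (_ : Th u - Th v + _ = u - v) //.
    by apply/rowP => k; rewrite !mxE; ring.
  by move: H; move: `|u - v| `|E u - E v| `|Th u - Th v| => a b c; lra.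
pose V : set 'rV[R]_n := [set y | `|y| < rho].
have oV : open V.
  have -> : V = [set u | `|u - 0| < rho] by apply/funext => u; rewrite /V /= subr0.
  exact: open_ball_norm.
have uJ y : V y -> 'J Th (th y) \in unitmx.
  move=> Vy; have [By Uy Ey] := thP y Vy.
  rewrite -row_free_unit -kermx_eq0; apply/eqP/row_matrixP => i; rewrite row0.
  set w := row i _.
  have w0 : 'D_w Th (th y) = 0.
    rewrite deriveEjacobian; last exact: dTh.
    by apply: sub_kermxP; exact: row_sub.
  (* [|t w| <= 2 |Th(u + t w) - Th u| = o(t)] *)
  apply/eqP; rewrite -normr_le0 leNgt; apply/negP => wn.
  have e0 : 0 < (4%:R)^-1 :> R by rewrite invr_gt0.
  have D := diff_eps (dTh Uy) e0.
  have sB : `|th y - u0| < r.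
    have := lip _ _ By Bu0; rewrite Ey Th0 subr0; move: Vy; rewrite /V /= /rho.
    by move: `|th y - u0| `|y| => a b; lra.
  have nB : \forall h \near (0 : 'rV[R]_n), B (h + th y).
    apply: near_shift0.
    have oB := open_ball_norm u0 r.
    by apply: (near_open oB) => // x; exact: ltW.
  have [d d0 Hd] := near_norm_ball (filterI D nB).
  pose t := d / 2 / `|w|.
  have t0 : 0 < t by rewrite !divr_gt0.
  have tw : `|t *: w| = d / 2.
    by rewrite normrZ gtr0_norm // /t mulfVK // gt_eqF.
  have [H1 H2] : (fun h => `|Th (h + th y) - Th (th y) - 'd Th (th y) h| <= 4%:R^-1 * `|h| /\
      B (h + th y)) (t *: w).
    by apply: Hd; rewrite subr0 tw ltr_pdivrMr // ltr_pMr // ltr1n.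
  have H3 := lip _ _ H2 By; rewrite addrK tw in H3.
  have w00 : 'd Th (th y) (t *: w) = 0.
    by rewrite linearZ /= -deriveE ?w0 ?scaler0 //; exact: dTh.
  rewrite w00 subr0 tw in H1.
  by move: H1 H3; move: `|Th (t *: w + th y) - Th (th y)| => a; lra.
have th_diff y : V y -> differentiable th y /\
    'd th y = (fun k => k *m invmx ('J Th (th y))) :> ('rV[R]_n -> 'rV[R]_n).
  move=> Vy; have [By Uy Ey] := thP y Vy.
  set A := 'J Th (th y).
  apply: (is_diff_unique (df := mulmxr (invmx A))); first exact: continuous_mulmxr.
  move=> e e0.
  have [c c0 cA] := mulmxr_bound (invmx A).
  (* The factor 2 is the Lipschitz constant of the inverse and [c] bounds the inverse Jacobian. *)
  have e1 : 0 < e / (2 * c) by rewrite divr_gt0 // mulr_gt0.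
  have [d d0 Hd] := near_norm_ball (diff_eps (dTh Uy) e1).
  have nV : \forall k \near (0 : 'rV[R]_n), V (k + y).
    by apply: near_shift0; exact: (near_open oV).
  have nd : \forall k \near (0 : 'rV[R]_n), `|k| < d / 2.
    apply/nbhs_normP; exists (d / 2); first by rewrite /= divr_gt0.
    by move=> k /=; rewrite sub0r normrN.
  near=> k.
  have Vk : V (k + y) by near: k.
  have kd : `|k| < d / 2 by near: k.
  have [Bk Uk Ek] := thP _ Vk.
  set h := th (k + y) - th y.
  have hk : `|h| <= 2 * `|k|.
    by have := lip _ _ Bk By; rewrite Ek Ey addrK.
  have hd : `|h - 0| < d.
    by rewrite subr0; move: hk kd; move: `|h| `|k| => a b; lra.
  have := Hd h hd; rewrite subrK Ek Ey addrK.
  have -> : 'd Th (th y) h = h *m A.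
    by rewrite -deriveEjacobian ?deriveE //; exact: dTh.
  move=> Hh.
  have -> : h - mulmxr (invmx A) k = - ((k - h *m A) *m invmx A).
    by rewrite /= mulmxBl -mulmxA mulmxV ?uJ // mulmx1 opprB.
  rewrite normrN; apply: le_trans (cA _) _.
  apply: le_trans (ler_wpM2l (ltW c0) Hh) _.
  have -> : e * `|k| = c * (e / (2 * c) * (2 * `|k|)) by field; rewrite gt_eqF.
  apply: ler_wpM2l; first exact: ltW.
  by apply: ler_wpM2l => //; exact: ltW.
have th0 : th 0 = u0.
  have V0 : V 0 by rewrite /V /= normr0.
  have [B0 _ E0] := thP 0 V0.
  have := lip _ _ B0 Bu0; rewrite E0 Th0 subrr normr0 mulr0 normr_le0 subr_eq0.
  by move/eqP.
have Dth v y : V y -> 'D_v th y = v *m invmx ('J Th (th y)).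
  by move=> Vy; have [d E1] := th_diff y Vy; rewrite deriveE // E1.
exists rho => //; exists th; split => //.
(* Bootstrapping: the derivative of [th] is the inverse Jacobian of [Th] composed with [th], so it
   is as regular as [th], and [th] gains one order. *)
- apply/(smooth_onP _ oV) => j k; elim: k j => [|k IH] j.
    by split=> // y Vy; apply: diff_coord; exact: (th_diff y Vy).1.
  split=> [y Vy|v]; first by apply: diff_coord; exact: (th_diff y Vy).1.
  have H : Ck k V (fun y => (cst v y *m invmx ('J Th (th y))) 0 j).
    apply: Ck_mulmx => //; first by move=> *; exact: Ck_cst.
    apply: Ck_invmx => // i l.
    have H : Ck k V ('D_('e_i) (fun t => Th t 0 l) \o th).
      apply: (Ck_comp (U' := U)) => //; first by move=> y /thP[].
      by apply: smooth_D; exact: ((smooth_onP _ oU).1 STh).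
    by apply: Ck_eq H => // y /thP[_ Uy _]; rewrite /= DTh.
  apply: Ck_eq H => // y Vy; rewrite -Dth // derive_rV //.
  exact: (th_diff y Vy).1.
- by move=> y /thP[].
- move=> y Vy; have -> : 'J th y = invmx ('J Th (th y)).
    apply/row_matrixP => i; rewrite row_jacobian; last exact: (th_diff y Vy).1.
    by rewrite Dth // rowE.
  by rewrite mulVmx // uJ.
Unshelve. all: by end_near. Qed.

End InverseFunction.

(** * Functions with a degenerate Hessian *)

Section Gronwall.
Context {R : realType}.

Lemma continuous_bounded_itv (f : R -> R) (a b : R) :
  (forall t, a <= t <= b -> {for t, continuous f}) ->
  exists C, forall t, a <= t <= b -> `|f t| <= C.
Proof.
move=> cf; have [ab|ba] := leP a b; last first.
  by exists 0 => t /andP[at_ tb]; have := le_trans at_ tb; rewrite leNgt ba.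
have cn : {within `[a, b], continuous (fun t => `|f t|)}.
  apply: continuous_in_subspaceT => t; rewrite inE /= in_itv /= => /cf ct.
  exact: (cvg_norm ct).
have [c _ H] := EVT_max ab cn.
by exists `|f c| => t tab; apply: H; rewrite in_itv.
Qed.

(** The squared length [phi] of [q] satisfies [phi' <= K * phi], so [phi] times [expR (- K * t)] is
    nonincreasing, starts at 0 and is nonnegative. *)
Lemma gronwall n (q : R -> 'rV[R]_n) (A : R -> 'M[R]_n) :
  q 0 = 0 ->
  (forall t : R, 0 <= t <= 1 -> forall k,
     is_derive t (1:R) (fun s => q s 0 k) ((q t *m A t) 0 k)) ->
  (forall t : R, 0 <= t <= 1 -> forall i j, {for t, continuous (fun s => A s i j)}) ->
  forall t : R, 0 <= t <= 1 -> q t = 0.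
Proof.
move=> q0 dq cA.
have [C HC] : exists C : R, forall t : R, 0 <= t <= 1 -> forall i j, `|A t i j| <= C.
  have ex i j := continuous_bounded_itv (fun t t01 => cA t t01 i j).
  pose Cij i j := sval (cid (ex i j)).
  have CijP i j t : 0 <= t <= 1 -> `|A t i j| <= Cij i j by move=> t01; exact: (svalP (cid (ex i j)) t).
  exists (\sum_i \sum_j `|Cij i j|) => t t01 i j.
  apply: le_trans (CijP i j t t01) _; apply: le_trans (ler_norm _) _.
  rewrite (bigD1 i) //= (bigD1 j) //= -addrA lerDl addr_ge0 //.
    by rewrite sumr_ge0.
  by rewrite sumr_ge0 // => k _; rewrite sumr_ge0.
pose phi (t : R) := dot (q t) (q t).
(* Bounding each product of two coordinates by the mean of their squares and summing over all
   entries of [A] gives [C * n] times the squared length; the 2 comes from differentiating a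
   square. *)
pose K := C * n%:R * 2.
have dphi (t : R) : 0 <= t <= 1 -> is_derive t (1:R) phi (2 * dot (q t *m A t) (q t)).
  move=> t01.
  have -> : phi = \sum_(k < n) ((fun s => q s 0 k) * (fun s => q s 0 k)).
    by apply/funext => s; rewrite fct_sumE /phi dotE.
  have -> : 2 * dot (q t *m A t) (q t) = \sum_(k < n)
     (q t 0 k *: (q t *m A t) 0 k + q t 0 k *: (q t *m A t) 0 k).
    rewrite dotE mulr_sumr; apply: eq_bigr => k _.
    by rewrite -mulr2n -[RHS]mulr_natl; congr (_ * _); exact: mulrC.
  apply: is_derive_sum => k; apply: is_deriveM; exact: dq.
have bphi (t : R) : 0 <= t <= 1 -> 2 * dot (q t *m A t) (q t) <= K * phi t.
  move=> t01; rewrite (_ : K * _ = 2 * (C * n%:R * dot (q t) (q t))); last by rewrite /K /phi; ring.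
  rewrite ler_pM2l //.
  have -> : C * n%:R * dot (q t) (q t) =
     \sum_(i < n) \sum_(j < n) C * ((q t 0 i ^+ 2 + q t 0 j ^+ 2) / 2).
    under eq_bigr do rewrite -mulr_sumr -mulr_suml big_split /= sumr_const card_ord.
    rewrite -mulr_sumr -mulr_suml big_split /= sumr_const card_ord.
    rewrite sumrMnl dotE.
    rewrite (eq_bigr (fun i => q t 0 i ^+ 2)); last by move=> i _; rewrite expr2.
    by rewrite -mulrA; congr (_ * _); rewrite -mulrnDl -[_ *+ n]mulr_natr; field.
  rewrite dotE; under eq_bigr do rewrite mxE mulr_suml.
  rewrite exchange_big /=; apply: ler_sum => i _; apply: ler_sum => j _.
  apply: le_trans (ler_norm _) _; rewrite !normrM.
  have HA := HC t t01 i j.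
  have H1 : `|q t 0 i| * `|q t 0 j| <= (q t 0 i ^+ 2 + q t 0 j ^+ 2) / 2.
    rewrite -(real_normK (num_real (q t 0 i))) -(real_normK (num_real (q t 0 j))).
    move: `|q t 0 i| `|q t 0 j| => a b.
    by have := sqr_ge0 (a - b); rewrite !expr2; lra.
  rewrite mulrAC [X in X <= _]mulrC.
  by apply: ler_pM => //; rewrite mulr_ge0.
pose psi := fun t : R => phi t * expR (- K * t).
have dpsi (t : R) : 0 <= t <= 1 -> is_derive t (1:R) psi
    (expR (- K * t) * (2 * dot (q t *m A t) (q t) - K * phi t)).
  move=> t01.
  have dl : is_derive t (1:R) (fun s : R => - K * s) (- K).
    have -> : (fun s : R => - K * s) = (- K) *: (id : R -> R) by apply/funext.
    by apply: is_derive_eq; exact: mulr1.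
  have de : is_derive t (1:R) (fun s => expR (- K * s)) (- K * expR (- K * t)).
    have H := @is_derive1_comp R expR (fun s : R => - K * s) t _ _ (is_derive_expR (- K * t)) dl.
    apply: is_derive_eq H _; rewrite mulrC //.
  have H := is_deriveM (dphi t t01) de.
  apply: is_derive_eq H _; rewrite /GRing.scale /=; ring.
have psi_le (t : R) : 0 <= t <= 1 -> psi t <= psi 0.
  move=> /andP[t0 t1].
  have sub (s : R) : s \in `[0, t]%R -> 0 <= s <= 1.
    by rewrite in_itv /= => /andP[s0 st]; rewrite s0 (le_trans st t1).
  apply: (@ler0_derive1_nincr R psi 0 t) => //.
  - by move=> s /subset_itv_oo_cc /sub s01; have [] := dpsi s s01.
  - move=> s /subset_itv_oo_cc /sub s01; rewrite derive1E.
    have [_ ->] := dpsi s s01.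
    by apply: mulr_ge0_le0; [exact: expR_ge0|rewrite subr_le0; exact: bphi].
  - by apply: derivable_within_continuous => s /sub s01; have [] := dpsi s s01.
move=> t t01; apply: dot_eq0; apply/eqP; rewrite eq_le dot_ge0 andbT.
have := psi_le t t01; rewrite /psi {2}/phi q0 dot0l mul0r.
by rewrite pmulr_lle0 // expR_gt0.
Qed.

End Gronwall.

Section HessDeriv.
Context {R : realType} {n : nat}.

Definition mx_deriv (H : 'rV[R]_n -> 'M[R]_n) (v u : 'rV[R]_n) : 'M[R]_n :=
  \matrix_(i, j) 'D_v (fun t => H t i j) u.

Lemma dot_delta (v : 'rV[R]_n) k : v 0 k = dot v 'e_k.
Proof. by rewrite dotC /dot -rowE [RHS]mxE [RHS]mxE. Qed.

Lemma mx_derivE H v u i j : mx_deriv H v u i j = 'D_v (fun t => H t i j) u.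
Proof. by rewrite mxE. Qed.

End HessDeriv.
#[local] Opaque mx_deriv.

Section Flat.
Context {R : realType} {n : nat}.
Variables (Om : set 'rV[R]_n) (h kappa : 'rV[R]_n -> R) (G : 'rV[R]_n -> 'M[R]_n).
Hypotheses (oOm : open Om).
Hypothesis cvx : forall u v (t : R), Om u -> Om v -> 0 <= t <= 1 -> Om (u + t *: (v - u)).
Hypotheses (Sh : smooth Om h) (Sk : smooth Om kappa).
Hypothesis SG : forall i j, smooth Om (fun u => G u i j).

Variable H : 'rV[R]_n -> 'M[R]_n.
Hypothesis HE : forall u i j, H u i j = 'D_('e_i) ('D_('e_j) h) u.
Hypothesis cubic : forall u, Om u -> H u *m G u *m H u *m G u *m H u = kappa u *: H u.
Hypothesis kappa0 : forall u, Om u -> (kappa u = 0 <-> H u = 0).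

Let SH i j : smooth Om (fun u => H u i j).
Proof.
move=> k; have := smooth_D 'e_i (smooth_D 'e_j Sh) k; by apply: Ck_eq => // u _; rewrite HE.
Qed.

Let Hsym u : Om u -> (H u)^T = H u.
Proof.
move=> Ou; apply/matrixP => i j; rewrite [LHS]mxE; apply: (etrans (HE _ _ _)); apply: (etrans _ (esym (HE _ _ _))).
exact: smooth_schwarz oOm Sh Ou.
Qed.

Let Sx (x : 'rV[R]_n) k : smooth Om (fun u => (x *m H u) 0 k).
Proof.
move=> m; apply: (Ck_mulmx oOm (A := fun=> x)) => *; [exact: Ck_cst|exact: SH].
Qed.

Let dD v u : Om u -> differentiable ('D_v h) u.
Proof. by move=> Ou; exact: smooth_diff (smooth_D v Sh) Ou. Qed.

Let dDD v w u : Om u -> differentiable ('D_w ('D_v h)) u.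
Proof. by move=> Ou; exact: smooth_diff (smooth_D w (smooth_D v Sh)) Ou. Qed.

Let xHE (x : 'rV[R]_n) u k : Om u -> (x *m H u) 0 k = 'D_x ('D_('e_k) h) u.
Proof.
move=> Ou; apply: (etrans _ (esym (derive_coords x (dD 'e_k Ou)))).
by rewrite mxE; apply: eq_bigr => i _; rewrite HE.
Qed.

Let BE (x x' : 'rV[R]_n) u : Om u -> 'D_x ('D_x' h) u = dot (x *m H u) x'.
Proof.
move=> Ou; apply: (etrans (smooth_schwarz x' x oOm Sh Ou)).
apply: (etrans (derive_coords x' (dD x Ou))).
rewrite dotE; apply: eq_bigr => k _; rewrite xHE // [RHS]mulrC.
apply: (congr1 (fun z => x' 0 k * z)).
exact: smooth_schwarz oOm Sh Ou.
Qed.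

Let TM := mx_deriv H.

Let DxH (x : 'rV[R]_n) v u k : Om u ->
  'D_v (fun t => (x *m H t) 0 k) u = (x *m TM v u) 0 k.
Proof.
move=> Ou.
have -> : (fun t => (x *m H t) 0 k) = \sum_(i < n) (x 0 i *: (fun t => H t i k)).
  by apply/funext => t; rewrite fct_sumE mxE.
have dH i : derivable (fun t => H t i k) u v.
  by apply: diff_derivable; exact: smooth_diff (SH i k) Ou.
rewrite derive_sum; last by move=> i; apply: derivableZ.
by rewrite mxE; apply: eq_bigr => i _; rewrite (deriveZ (x 0 i) (dH i)) mx_derivE.
Qed.

Let dxH (x : 'rV[R]_n) u : Om u -> differentiable (fun t => x *m H t) u.
Proof. by move=> Ou; apply/differentiable_rV => k; exact: smooth_diff (Sx x k) Ou. Qed.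

Let T1 v (x x' : 'rV[R]_n) u : Om u ->
  'D_v ('D_x ('D_x' h)) u = dot (x *m TM v u) x'.
Proof.
move=> Ou; apply: (etrans (eq_on_derive v oOm (fun t Ot => BE x x' Ot) Ou)).
apply: (etrans (derive_dot v (dxH x Ou) (differentiable_cst _ _))).
rewrite derive_cst dot0r addr0; congr (dot _ _); apply/rowP => k.
by rewrite derive_rV ?DxH //; exact: dxH.
Qed.

Let Tswap v (x x' : 'rV[R]_n) u : Om u ->
  dot (x *m TM v u) x' = dot (v *m TM x u) x'.
Proof.
move=> Ou; apply: (etrans (esym (T1 v x x' Ou))); apply: (etrans _ (T1 x v x' Ou)).
exact: smooth_schwarz oOm (smooth_D x' Sh) Ou.
Qed.

Let Tsym v (x x' : 'rV[R]_n) u : Om u ->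
  dot (x *m TM v u) x' = dot (x' *m TM v u) x.
Proof.
move=> Ou; apply: (etrans (esym (T1 v x x' Ou))); apply: (etrans _ (T1 v x' x Ou)).
apply: (eq_on_derive v oOm _ Ou) => t Ot.
exact: smooth_schwarz oOm Sh Ot.
Qed.

(** By total symmetry of the third derivative, the change of [x *m H] along [x] becomes the form
    ['D_e H] evaluated on the pair [(x, x)], where [Tker] applies to the kernel part of [x]. *)
Let Tcyc (x e : 'rV[R]_n) u : Om u -> dot (x *m TM x u) e = dot (x *m TM e u) x.
Proof.
move=> Ou; have E1 := Tsym x x e Ou; have E2 := Tswap x e x Ou.
by have E := etrans E1 E2.
Qed.

(* Differentiate [cubic]: its left-hand side vanishes to second order on the
   kernel of [H]. *)
Let Tker v (x x' : 'rV[R]_n) u : Om u -> kappa u != 0 ->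
  x *m H u = 0 -> x' *m H u = 0 -> dot (x *m TM v u) x' = 0.
Proof.
move=> Ou ku xH x'H.
pose P t := x *m H t *m G t *m H t *m G t.
have dP : differentiable P u.
  apply/differentiable_rV => k; apply: (Ck_diff (k := 0) (U := Om)) => //.
  have CM a b c := @Ck_mulmx R n Om oOm 0 a b c.
  by apply: (CM _ _ _) => [i j|i j]; [apply: (CM _ _ _) => [i' j'|i' j'];
    [apply: (CM _ _ _) => [i2 j2|i2 j2]; [rewrite (ord1 i2); exact: Sx|exact: SG]
    |exact: SH]|exact: SG].
have E1 : 'D_v (fun t => dot (P t) (x' *m H t)) u = 0.
  apply: (etrans (derive_dot v dP (dxH x' Ou))).
  by rewrite x'H /P xH !mul0mx dot0l dot0r addr0.
have E2 : 'D_v (fun t => dot (P t) (x' *m H t)) u =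
          'D_v (fun t => kappa t * 'D_x ('D_x' h) t) u.
  apply: (eq_on_derive v oOm _ Ou) => t Ot.
  rewrite BE // dot_mulmx Hsym // /P -!mulmxA.
  have := cubic Ot; rewrite -!mulmxA => ->.
  by rewrite -scalemxAr dotZl.
have dk : derivable kappa u v by apply: diff_derivable; exact: smooth_diff Sk Ou.
have dB : derivable ('D_x ('D_x' h)) u v by apply: diff_derivable; exact: dDD.
have E3 := etrans (esym (deriveM dk dB)) (etrans (esym E2) E1).
have B0 : 'D_x ('D_x' h) u = 0 by rewrite BE // xH dot0l.
have := etrans (esym (congr2 (fun a b => kappa u * a + b * 'D_v kappa u) (T1 v x x' Ou) B0)) E3.
by rewrite mul0r addr0 => /eqP; rewrite mulf_eq0 (negbTE ku) /= => /eqP.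
Qed.

Let Ob : set 'rV[R]_n := Om `&` [set u | kappa u != 0].

Let oOb : open Ob.
Proof.
rewrite openE => u [Ou /= ku]; rewrite /interior; apply: filterI.
  by apply: open_nbhs_nbhs.
have ck : {for u, continuous kappa}.
  by apply: differentiable_continuous; exact: smooth_diff Sk Ou.
have : nbhs (kappa u) [set z | z != 0] by apply: open_nbhs_nbhs; split => //; exact: open_neq.
by move=> /ck.
Qed.

(** By [cubic] this is a generalized inverse of [H] on [Ob]: [H *m Nm *m H = H]. So
    [x - x *m H u *m Nm u] lies in the kernel of [H u], and the complementary part of [x] is linear
    in [x *m H u]. *)
Let Nm (u : 'rV[R]_n) := (kappa u)^-1 *: (G u *m H u *m G u).

Let SNm i j : smooth Ob (fun u => Nm u i j).
Proof.
move=> k.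
have sub f : smooth Om f -> Ck k Ob f by move=> Sf; apply: Ck_sub (Sf k) => u [].
have C1 : Ck k Ob (fun u => (kappa u)^-1 * (G u *m H u *m G u) i j).
  apply: CkM => //; first by apply: CkV => //; [move=> u []|exact: sub].
  apply: Ck_mulmx => // [i' j'|i' j']; last exact: sub.
  by apply: Ck_mulmx => // [i2 j2|i2 j2]; exact: sub.
by apply: Ck_eq C1 => // u _; rewrite [RHS]mxE.
Qed.

(** Along the line, [q = x *m H] solves a linear equation [q' = q *m A]. Its derivative is the third
    derivative of [h] on [x], [x] and a basis vector; splitting [x] into its kernel part and
    [q *m Nm], the term with two kernel parts vanishes by [Tker], and every other term contains [q].
    Since [q] starts at 0, [gronwall] concludes. *)
Lemma kernel_line (y x : 'rV[R]_n) : Om y -> x *m H y = 0 ->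
  (forall t : R, 0 <= t <= 1 -> Ob (t *: x + y)) ->
  forall t : R, 0 <= t <= 1 -> x *m H (t *: x + y) = 0.
Proof.
move=> Oy xH Obt.
(* For a symmetric form T and the part [xP] of [x] outside the kernel, T(x, x) - T(x - xP, x - xP) =
   T(xP, 2x - xP). *)
pose w u := 2 *: x - x *m H u *m Nm u.
pose Au u : 'M[R]_n := \matrix_(l, k) (Nm u *m TM 'e_k u *m (w u)^T) l 0.
apply: (gronwall (q := fun t => x *m H (t *: x + y)) (A := fun t => Au (t *: x + y))).
- by rewrite scale0r add0r.
- move=> t /Obt []; set u := t *: x + y => Ou ku k.
  have L := is_derive_line (f := fun u => (x *m H u) 0 k) (x := y) (v := x) (s := t)
    (smooth_diff (Sx x k) Ou).
  apply: is_derive_eq L _; rewrite DxH //.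
  set xP := x *m H u *m Nm u.
  have xPH : xP *m H u = x *m H u.
    rewrite /xP /Nm -scalemxAr -scalemxAl -!mulmxA.
    have := cubic Ou; rewrite -!mulmxA => ->.
    by rewrite -scalemxAr scalerA mulVf // scale1r.
  have Tk : (x *m TM x u) 0 k = dot (x *m TM 'e_k u) x.
    by apply: (etrans (dot_delta _ _)); exact: Tcyc.
  apply: (etrans Tk).
  have Z : dot ((x - xP) *m TM 'e_k u) (x - xP) = 0.
    by apply: Tker => //; rewrite mulmxBl xPH subrr.
  have Z2 : dot (x *m TM 'e_k u) x = dot (xP *m TM 'e_k u) (w u).
    have S := Tsym 'e_k x xP Ou.
    have -> : w u = 2 *: x - xP by [].
    move: (TM 'e_k u) Z S => T; rewrite mulmxBl dotBl !dotBr dotZr => Z S.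
    by move: Z; rewrite S; move: (dot (x *m T) x) (dot (xP *m T) x) (dot (xP *m T) xP) => a b c; lra.
  apply: (etrans Z2).
  transitivity ((x *m H u *m (Nm u *m TM 'e_k u *m (w u)^T)) 0 0).
    by rewrite /dot /xP !mulmxA.
  rewrite [LHS]mxE [RHS]mxE; apply: eq_bigr => l _.
  by apply: (congr1 (fun z => (x *m H u) 0 l * z)); rewrite [RHS]mxE.
- move=> t t01 i j; have Obu := Obt t t01.
  have dA : differentiable (fun u => Au u i j) (t *: x + y).
    apply: (Ck_diff (k := 0) (U := Ob)) => //.
    have sub f : smooth Om f -> Ck 0 Ob f by move=> Sf; apply: Ck_sub (Sf 0%N) => u [].
    have C1 : Ck 0 Ob (fun u => (Nm u *m TM 'e_j u *m (w u)^T) i 0).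
      apply: Ck_mulmx => // [a b|a b].
        apply: Ck_mulmx => // [a' b'|a' b']; first exact: SNm.
        have := sub _ (smooth_D 'e_j (SH a' b')).
        by apply: Ck_eq => // u _; rewrite mx_derivE.
      rewrite (ord1 b).
      have C2 : Ck 0 Ob (fun u => 2 * x 0 a - (x *m H u *m Nm u) 0 a).
        apply: (CkB oOb (Ck_cst oOb 0 (2 * x 0 a))).
        apply: Ck_mulmx => // [a' b'|a' b']; last exact: SNm.
        by rewrite (ord1 a'); apply: sub; exact: Sx.
      by apply: Ck_eq C2 => // u _; rewrite !mxE.
    by apply: Ck_eq C1 => // u _; rewrite [RHS]mxE.
  have dl : differentiable (fun s : R => s *: x + y) t.
    by apply: differentiableD; [exact: differentiableZl|exact: differentiable_cst].
  exact: differentiable_continuous (differentiable_comp dl dA).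
Qed.

Lemma gradient_line (y x : 'rV[R]_n) i : Om y -> x *m H y = 0 ->
  (forall t : R, 0 <= t <= 1 -> Ob (t *: x + y)) ->
  'D_('e_i) h (x + y) = 'D_('e_i) h y.
Proof.
move=> Oy xH Obt.
have D (s : R) : 0 <= s <= 1 -> differentiable ('D_('e_i) h) (s *: x + y).
  by move=> /Obt [Os _]; exact: dD.
have [c c01 E] := MVT_line D.
have c01' : 0 <= c <= 1 by move/andP: c01 => [? ?]; rewrite !ltW.
apply/eqP; rewrite -subr_eq0; apply/eqP; apply: (etrans E).
apply: (etrans (esym (xHE x i (Obt c c01').1))).
by rewrite kernel_line // mxE.
Qed.

(** A tube lemma: the parameter interval is compact, so the segments that start near [y] with a
    nearby direction stay in [W] simultaneously for all parameters. *)
Lemma tube_line (W : set 'rV[R]_n) (X : 'rV[R]_n -> 'rV[R]_n) y (t : R) :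
  open W -> {for y, continuous X} ->
  (forall s : R, 0 <= s <= t -> W (s *: X y + y)) ->
  \forall y' \near y, forall s : R, 0 <= s <= t -> W (s *: X y' + y').
Proof.
move=> oW cX HW.
have cpt : compact (`[0, t]%classic : set R) by exact: segment_compact.
move/compact_near_coveringP : cpt => cov.
have H1 : \forall y' \near y, `[0, t]%classic `<=` (fun s : R => W (s *: X y' + y')).
  apply: (cov _ (nbhs y) (fun y' (s : R) => W (s *: X y' + y'))) => s.
  rewrite /= in_itv /= => s0t.
  have C : (z.1 *: X z.2 + z.2 @[z --> (s, y)]) --> s *: X y + y.
    apply: cvgD; last exact: cvg_snd.
    apply: cvgZ; first exact: cvg_fst.
    apply: (@continuous_comp _ _ _ (@snd R 'rV[R]_n) X (s, y)); last exact: cX.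
    exact: cvg_snd.
  have nW : nbhs (s *: X y + y) W by apply: open_nbhs_nbhs; split => //; exact: HW.
  exact: (C W nW).
apply: filterS H1 => y' H1 s s0t; apply: H1.
by rewrite /= in_itv.
Qed.

Let seg y x (t : R) : Om y -> Om (x + y) -> 0 <= t <= 1 -> Om (t *: x + y).
Proof. by move=> Oy Oxy t01; have := cvx Oy Oxy t01; rewrite addrK addrC. Qed.

(* The kernel directions through the neighbours of [y] move [y + t x] along
   the affine Jacobi field [a + t m], on which the Hessian is thus constant. *)
Let jacobi y x a : Om y -> kappa y != 0 -> x *m H y = 0 ->
  exists m : 'rV[R]_n, forall t : R, 0 <= t ->
    (forall s : R, 0 <= s <= t -> Ob (s *: x + y)) ->
    (t *: m + a) *m H (t *: x + y) = a *m H y.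
Proof.
move=> Oy ky xH.
(* A smooth field of kernel directions through [x]: [cubic] makes [H] annihilate it, and the
   constant factor normalizes [X y] to [x]. *)
pose X u := (kappa y)^-1 *: (kappa u *: x - x *m H u *m G u *m H u *m G u).
have Xy : X y = x.
  by rewrite /X xH !mul0mx subr0 scalerA mulVf // scale1r.
have XH u : Om u -> X u *m H u = 0.
  move=> Ou; rewrite /X -scalemxAl mulmxBl -scalemxAl -!mulmxA.
  have := cubic Ou; rewrite -!mulmxA => ->.
  by rewrite -scalemxAr subrr scaler0.
have dX u : Om u -> differentiable X u.
  move=> Ou; apply/differentiable_rV => k; apply: (Ck_diff (k := 0) (U := Om)) => //.
  have CM a' b c := @Ck_mulmx R n Om oOm 0 a' b c.
  have C1 : Ck 0 Om (fun u => (kappa y)^-1 * (kappa u * x 0 k -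
     (x *m H u *m G u *m H u *m G u) 0 k)).
    apply: (CkM oOm (Ck_cst oOm 0 _)); apply: (CkB oOm).
      exact: (CkM oOm (Sk 0%N) (Ck_cst oOm 0 _)).
    by apply: (CM _ _ _) => [i j|i j]; [apply: (CM _ _ _) => [i' j'|i' j'];
      [apply: (CM _ _ _) => [i2 j2|i2 j2]; [rewrite (ord1 i2); exact: Sx|exact: SG]
      |exact: SH]|exact: SG].
  by apply: Ck_eq C1 => // v _; rewrite /X [RHS]mxE [X in _ = _ * X]mxE [X in _ = _ * (X + _)]mxE [X in _ = _ * (_ + X)]mxE.
exists ('D_a X y) => t t0 Obt.
have t01 (s : R) : 0 <= s <= 1 -> 0 <= s * t <= t.
  by move=> /andP[s0 s1]; rewrite mulr_ge0 //= ler_piMl.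
have cX : {for y, continuous X} by apply: differentiable_continuous; exact: dX.
have T : \forall y' \near y, forall s : R, 0 <= s <= t -> Ob (s *: X y' + y').
  by apply: tube_line => //; rewrite Xy.
have nO : \forall y' \near y, Om y' by exact: open_nbhs_nbhs.
apply/rowP => i.
pose Psi u := t *: X u + u.
have dPsi : differentiable Psi y.
  by apply: differentiableD => //; apply: differentiableZ; exact: dX.
have DPsi : 'D_a Psi y = t *: 'D_a X y + a.
  have e1 : derivable (t *: X) y a by apply: derivableZ; apply: diff_derivable; exact: dX.
  have e2 : derivable (id : 'rV[R]_n -> 'rV[R]_n) y a by apply: derivable_id.
  apply: (etrans (deriveD e1 e2)); rewrite derive_id; congr (_ + _).
  by apply: deriveZ; apply: diff_derivable; exact: dX.
have Py : Psi y = t *: x + y by rewrite /Psi Xy.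
have OP : Om (Psi y) by rewrite Py; apply: (Obt t _).1; rewrite t0 lexx.
have dDi : differentiable ('D_('e_i) h) (Psi y) by exact: dD.
(* [gradient_line], used at all points near [y], says that [Psi] preserves the gradient of [h].
   Differentiating this in the direction [a] is the claim, with [m] the derivative of [X] along
   [a]. *)
have E : 'D_a ('D_('e_i) h \o Psi) y = 'D_a ('D_('e_i) h) y.
  apply: near_eq_derive; near=> u.
  have Ou : Om u by near: u.
  have Tu : forall s : R, 0 <= s <= t -> Ob (s *: X u + u) by near: u.
  apply: gradient_line => //; first by rewrite -scalemxAl XH // scaler0.
  by move=> s /t01 /Tu; rewrite scalerA.
have E1 := etrans (esym (derive_comp a dPsi dDi)) E.
have E2 := etrans E1 (esym (xHE a i Oy)).
apply: (etrans _ E2).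
rewrite -DPsi -Py mxE; apply: eq_bigr => j _.
apply: (congr2 *%R); first exact: derive_rV.
exact: HE.
Unshelve. all: by end_near. Qed.

(** Take the first zero [tau] of [kappa] on the segment; there [H] vanishes. Before [tau], [jacobi]
    keeps [(t *: m + a) *m H] equal to [a *m H y], so by continuity [a *m H y = 0] for every [a],
    against [kappa y != 0]. *)
Let nonzero_line y x : Om y -> kappa y != 0 -> x *m H y = 0 -> Om (x + y) ->
  forall t : R, 0 <= t <= 1 -> kappa (t *: x + y) != 0.
Proof.
move=> Oy ky xH Oxy t1 t101; apply/negP => /eqP kt1.
pose Z : set R := [set t | 0 <= t <= 1 /\ kappa (t *: x + y) = 0].
have Z0 : Z !=set0 by exists t1.
have lbZ : lbound Z 0 by move=> t [/andP[]].
have hZ : has_inf Z by split => //; exists 0.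
pose tau := inf Z.
have tau0 : 0 <= tau by exact: lb_le_inf.
have tau1 : tau <= 1.
  by apply: le_trans (_ : t1 <= 1); [apply: ge_inf => //; exists 0|case/andP: t101].
have Otau : Om (tau *: x + y) by apply: seg => //; rewrite tau0.
have before (t : R) : 0 <= t -> t < tau -> Ob (t *: x + y).
  move=> t0 tt; have t01 : 0 <= t <= 1 by rewrite t0 (le_trans (ltW tt)).
  split; first exact: seg.
  apply/eqP => kt; move: tt; rewrite ltNge => /negP; apply.
  by apply: ge_inf; [exists 0|].
have dl (t : R) : differentiable (fun s : R => s *: x + y) t.
  by apply: differentiableD; [exact: differentiableZl|exact: differentiable_cst].
have ktau : kappa (tau *: x + y) = 0.
  apply/eqP/negPn/negP => kn.
  have c1 : {for tau, continuous (fun s : R => kappa (s *: x + y))}.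
    apply: differentiable_continuous; apply: (differentiable_comp (dl tau)).
    exact: smooth_diff Sk Otau.
  have nz : nbhs (kappa (tau *: x + y)) [set z | z != 0].
    by apply: open_nbhs_nbhs; split => //; exact: open_neq.
  have nz' : \forall s \near tau, kappa (s *: x + y) != 0 by exact: (c1 _ nz).
  have [d d0 Hd] := near_norm_ball nz'.
  have [z [z01 kz] zd] := inf_adherent d0 hZ.
  have zt : tau <= z by apply: ge_inf; [exists 0|].
  have := Hd z; rewrite /= kz eqxx => K; suff : false by [].
  by apply: K; rewrite ger0_norm ?subr_ge0 // ltrBlDl.
have taup : 0 < tau.
  rewrite lt_neqAle tau0 andbT; apply/eqP => t0.
  by move: ktau; rewrite -t0 scale0r add0r => /eqP; rewrite (negbTE ky).
have Htau : H (tau *: x + y) = 0 by apply/kappa0.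
suff Hy : H y = 0 by move: ky; rewrite (kappa0 Oy).2 // eqxx.
suff Ha (a : 'rV[R]_n) : a *m H y = 0 by apply/row_matrixP => i; rewrite row0 rowE Ha.
have [m Hm] := jacobi a Oy ky xH.
apply/rowP => k; rewrite [RHS]mxE.
pose F (t : R) := ((t *: m + a) *m H (t *: x + y)) 0 k.
have Fc : {for tau, continuous F}.
  apply: differentiable_continuous.
  have -> : F = \sum_(j < n) ((fun t : R => (t *: m + a) 0 j) *
      (fun t => H (t *: x + y) j k)).
    by apply/funext => t; rewrite fct_sumE /F mxE.
  apply: differentiable_sum => j; apply: differentiableM.
    apply: (diff_coord (F := fun t : R => t *: m + a)).
    by apply: differentiableD; [exact: differentiableZl|exact: differentiable_cst].
  exact: (differentiable_comp (dl tau) (smooth_diff (SH j k) Otau)).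
have Fb (t : R) : 0 <= t -> t < tau -> F t = (a *m H y) 0 k.
  move=> t0 tt; apply: (congr1 (fun v : 'rV[R]_n => v 0 k)); apply: Hm => // s /andP[s0 st].
  by apply: before => //; exact: le_lt_trans tt.
have Ftau : F tau = 0 by rewrite /F Htau mulmx0 mxE.
apply/eqP; rewrite -normr_le0; apply/ler_addgt0Pl => e e0; rewrite addr0.
have [d d0 Hd] := near_norm_ball ((cvgrPdist_lt _ _).1 Fc e e0).
(* A parameter before [tau] at distance less than [d]; the maximum keeps it in the segment when
   [tau] is small. *)
pose t := Num.max 0 (tau - d / 2).
have t0 : 0 <= t by rewrite le_max lexx.
have d2 : 0 < d / 2 by rewrite divr_gt0.
have tt : t < tau by rewrite gt_max taup /= ltrBlDr ltrDl.
have td : `|t - tau| < d.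
  have tge : tau - d / 2 <= t by rewrite le_max lexx orbT.
  rewrite distrC ger0_norm ?subr_ge0 ?(ltW tt) //; lra.
have := Hd t td; rewrite Ftau sub0r normrN Fb //.
exact: ltW.
Qed.

Theorem gradient_kernel (y x : 'rV[R]_n) i :
  Om y -> kappa y != 0 -> x *m H y = 0 -> Om (x + y) ->
  'D_('e_i) h (x + y) = 'D_('e_i) h y.
Proof.
move=> Oy ky xH Oxy; apply: gradient_line => // t t01; split; first exact: seg.
exact: nonzero_line.
Qed.

End Flat.

(** * Linear algebra of the shape operator *)

Section RankTrace.
Context {R : realType}.

Lemma rank_factor n (E : 'M[R]_n) r : (\rank E <= r)%N ->
  exists (C : 'M[R]_(n, r)) (D : 'M[R]_(r, n)), E = C *m D.
Proof.
move=> rE; exists (col_ebase E *m pid_mx (\rank E)), (pid_mx (\rank E) *m row_ebase E).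
rewrite mulmxA -(mulmxA (col_ebase E)) mul_pid_mx minnn (minn_idPr rE).
by rewrite mulmx_ebase.
Qed.

(** Cayley-Hamilton for a traceless matrix of size 2: the square is scalar, and its trace determines
    the scalar. *)
Lemma mx2_trace0 (K : 'M[R]_2) : \tr K = 0 -> K *m K = (\tr (K *m K) / 2)%:M.
Proof.
rewrite /mxtrace !big_ord_recl !big_ord0 !addr0 => t0.
have d : K ord0 ord0 = - K (lift ord0 ord0) (lift ord0 ord0) by lra.
apply/matrixP => i j; rewrite !mxE !big_ord_recl !big_ord0 !addr0 d.
have ij (k : 'I_2) : k = ord0 \/ k = lift ord0 ord0.
  by case: k => [[|[|//]]] ?; [left|right]; apply/val_inj.
have ne1 : (ord0 == lift ord0 ord0 :> 'I_2) = false by [].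
have ne2 : (lift ord0 ord0 == ord0 :> 'I_2) = false by [].
have [->|->] := ij i; have [->|->] := ij j; rewrite ?eqxx ?ne1 ?ne2 ?mulr1n ?mulr0n ?d.
- by field.
- by ring.
- by ring.
- by field.
Qed.

(** Factor [E = C *m D] through dimension 2. Then [D *m C] is traceless of size 2, so its square is
    scalar, and the cube of [E] is [C] times that square times [D]. *)
Lemma cube_trace0 n (E : 'M[R]_n) : (\rank E <= 2)%N -> \tr E = 0 ->
  E *m E *m E = (\tr (E *m E) / 2) *: E.
Proof.
move=> /rank_factor [C [D ->]] t0.
rewrite mxtrace_mulC in t0.
have := mx2_trace0 t0; set K := D *m C => KK.
have -> : \tr (C *m D *m (C *m D)) = \tr (K *m K).
  by rewrite -mulmxA mxtrace_mulC /K !mulmxA.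
have -> : C *m D *m (C *m D) *m (C *m D) = C *m (K *m K) *m D.
  by rewrite /K !mulmxA.
by rewrite [in LHS]KK mul_mx_scalar -scalemxAl.
Qed.

Lemma square_rank1 n (E : 'M[R]_n) : (\rank E <= 1)%N -> \tr E = 0 -> E *m E = 0.
Proof.
move=> /rank_factor [C [D ->]]; rewrite mxtrace_mulC => t0.
have DC : D *m C = 0 by rewrite [LHS]mx11_scalar -trace_mx11 t0 raddf0.
by rewrite mulmxA -(mulmxA C) DC mulmx0 mul0mx.
Qed.

Lemma trace_sym_eq0 n (M : 'M[R]_n) : M^T = M -> \tr (M *m M) = 0 -> M = 0.
Proof.
move=> MT; rewrite -{2}MT => t0.
have d0 i : dot (row i M) (row i M) = 0.
  have : \sum_i dot (row i M) (row i M) = 0.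
    transitivity (\tr (M *m M^T)); last exact: t0.
    by rewrite /mxtrace; apply: eq_bigr => j _; rewrite mulmx_tr_dot.
  move/eqP; rewrite psumr_eq0; last by move=> j _; exact: dot_ge0.
  by move/allP => /(_ i (mem_index_enum i)) /eqP.
by apply/row_matrixP => i; rewrite row0; apply: dot_eq0.
Qed.

(** In the full-rank factorization [C *m D] of an idempotent, [D *m C] is the identity, and the
    trace is invariant under exchanging the factors. It lets a rank be followed to a limit. *)
Lemma idempotent_rank n (P : 'M[R]_n) : P *m P = P -> (\rank P)%:R = \tr P.
Proof.
move=> PP.
move: (col_base P) (row_base P) (mulmx_base P) (row_base_free P) (col_base_full P).
move=> C D CD fD fC.
have DC : D *m C = 1%:M.
  apply: (row_free_inj fD); rewrite mul1mx; apply: (row_full_inj fC).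
  by rewrite !mulmxA CD -mulmxA CD.
by rewrite -[in RHS]CD mxtrace_mulC DC mxtrace1.
Qed.

Lemma Jmx_free m : row_free (@Jmx R m).
Proof.
rewrite row_free_unit; apply: (mulmx1_unit (B := - Jmx) _).1.
by rewrite mulmxN JmxJ opprK.
Qed.

Lemma isotropic_rank k m (W : 'M[R]_(k, m + m)) :
  W *m Jmx *m W^T = 0 -> (\rank W <= m)%N.
Proof.
move=> /mulmx0_rank_max; rewrite mxrank_tr mxrankMfree; last exact: Jmx_free.
by move=> H; rewrite -leq_double -!addnn.
Qed.

(* The orthogonal complement of a Lagrangian subspace is its image under [Jmx]. *)
Lemma lagrangian_complement k q m (W : 'M[R]_(k, m + m)) (X : 'M[R]_(q, m + m)) :
  W *m Jmx *m W^T = 0 -> \rank W = m -> X *m W^T = 0 -> X *m Jmx *m X^T = 0.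
Proof.
move=> WJW rW XW.
have sub : (W *m Jmx <= kermx W^T)%MS by apply/sub_kermxP.
have [_ E] := mxrank_leqif_eq sub.
have kW : (kermx W^T <= W *m Jmx)%MS.
  have : (W *m Jmx == kermx W^T)%MS.
    by rewrite -E mxrankMfree ?Jmx_free // mxrank_ker mxrank_tr rW addnK.
  by case/andP.
have /submxP [z ->] : (X <= W *m Jmx)%MS.
  by apply: submx_trans kW; apply/sub_kermxP.
rewrite !trmx_mul JmxT !mulmxA -(mulmxA _ Jmx Jmx) JmxJ.
rewrite !mulmxN !mulmx1 !mulNmx opprK.
by rewrite -(mulmxA z) -(mulmxA z) WJW mulmx0 mul0mx.
Qed.

End RankTrace.

(** * Rank and kernel of the Hessian when the Gauss image is isotropic *)

Section MinimalHopf.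
Context {R : realType}.
Variables (A S : 'M[R]_(5, 3 + 3)) (nu : 'rV[R]_(3 + 3)) (H g : 'M[R]_5) (la : R).
Hypotheses (fA : row_free A) (gE : g = A *m A^T) (la0 : la != 0).
Hypotheses (HT : H^T = H) (BE : la *: H = - (A *m S^T)).
Hypotheses (nu1 : dot nu nu = 1) (nuA : nu *m A^T = 0) (nuS : nu *m S^T = 0).
Hypotheses (nuJS : nu *m Jmx *m S^T = 0) (SJS : S *m Jmx *m S^T = 0).
Hypothesis tr0 : \tr (H *m invmx g) = 0.

Let W := col_mx S nu.

Let WJW : W *m Jmx *m W^T = 0.
Proof.
rewrite /W mul_col_mx tr_col_mx mul_col_row SJS nuJS.
have -> : nu *m Jmx *m nu^T = 0.
  by rewrite [LHS]mx11_scalar -/(dot _ _) dot_Jv raddf0.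
have -> : S *m Jmx *m nu^T = 0.
  apply: trmx_inj; rewrite !trmx_mul trmxK trmx0 JmxT mulNmx mulmxN mulmxA nuJS.
  exact: oppr0.
exact: block_mx0.
Qed.

(** The derivatives of a unit normal are orthogonal to it, so [nu] adds a dimension. *)
Let rankW : \rank W = (\rank S).+1.
Proof.
have nu0 : nu != 0.
  by apply/eqP => nu0; move: nu1; rewrite nu0 dot0l => /esym/eqP; rewrite oner_eq0.
have cap : (S :&: nu)%MS = 0.
  apply/eqP; rewrite -submx0; apply/rV_subP => v; rewrite sub_capmx => /andP[/submxP [z vS]].
  move=> /sub_rVP [a va]; rewrite submx0.
  have : dot v nu = 0.
    by rewrite vS dotC dot_mulmx nuS dot0l.
  by rewrite va dotZl nu1 mulr1 => ->; rewrite scale0r.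
have := mxrank_sum_cap S nu; rewrite cap mxrank0 addn0 rank_rV nu0 => rS.
by rewrite /W -addsmxE rS /= [LHS]addnC add1n.
Qed.

(** [W] is isotropic in complex dimension 3, so its rank is at most 3, one of which is due to
    [nu]. *)
Lemma gauss_rank : (\rank S <= 2)%N.
Proof. by have := isotropic_rank WJW; rewrite rankW. Qed.

Let HE : H = la^-1 *: - (A *m S^T).
Proof. by rewrite -BE scalerA mulVf // scale1r. Qed.

Lemma hessian_rank : (\rank H <= \rank S)%N.
Proof.
rewrite HE -mulNmx scalemxAl -(mxrank_tr S).
exact: mxrankM_maxr.
Qed.

Let gU : g \in unitmx. Proof. by rewrite gE; exact: gram_unit. Qed.
Let giT : (invmx g)^T = invmx g. Proof. by rewrite trmx_inv gE trmx_mul trmxK. Qed.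

Let E := H *m invmx g.
Let kappa := \tr (E *m E) / 2.

Let rankE r : (\rank H <= r)%N -> (\rank E <= r)%N.
Proof. by move=> rH; apply: leq_trans rH; exact: mxrankM_maxl. Qed.

Lemma shape_cubic : H *m invmx g *m H *m invmx g *m H = kappa *: H.
Proof.
have rE : (\rank E <= 2)%N by apply: rankE; exact: leq_trans hessian_rank gauss_rank.
have := cube_trace0 rE tr0; rewrite -/kappa => C.
have := congr1 (fun X => X *m g) C; rewrite -scalemxAl /E !mulmxA.
by rewrite -!(mulmxA _ (invmx g) g) mulVmx // !mulmx1.
Qed.

(** In a chart that is not orthonormal, [H *m invmx g] is not symmetric. The rows of [invmx g *m A]
    form the dual frame, and this matrix is the same operator on the ambient space, where it is
    symmetric and sums of squares are available. *)
Definition shape_mx := (invmx g *m A)^T *m H *m (invmx g *m A).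

Let VA : invmx g *m A *m A^T = 1%:M.
Proof. by rewrite -mulmxA -gE mulVmx. Qed.

Lemma shape_mxT : shape_mx^T = shape_mx.
Proof. by rewrite /shape_mx !trmx_mul !trmxK HT !mulmxA. Qed.

Let AVT : A *m (invmx g *m A)^T = 1%:M.
Proof. by rewrite trmx_mul giT mulmxA -gE mulmxV. Qed.

Let VVT : invmx g *m A *m (invmx g *m A)^T = invmx g.
Proof. by rewrite -[LHS]mulmxA AVT mulmx1. Qed.

Lemma shape_mx_sq : \tr (shape_mx *m shape_mx) = 2 * kappa.
Proof.
rewrite /kappa mulrC mulfVK ?pnatr_eq0 // /shape_mx /E.
move: VVT; set V := invmx g *m A => VV.
have -> : V^T *m H *m V *m (V^T *m H *m V) = V^T *m (H *m (V *m V^T) *m H *m V).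
  by rewrite !mulmxA.
by rewrite mxtrace_mulC VV -(mulmxA _ V) VV !mulmxA.
Qed.

Lemma shape_square : E *m E = A *m (shape_mx *m shape_mx) *m (invmx g *m A)^T.
Proof.
rewrite /shape_mx /E; move: VVT AVT; set V := invmx g *m A => VV AV.
have -> : A *m (V^T *m H *m V *m (V^T *m H *m V)) *m V^T =
  A *m V^T *m H *m (V *m V^T) *m H *m (V *m V^T) by rewrite !mulmxA.
by rewrite AV mul1mx VV !mulmxA.
Qed.

(** [2 * kappa] is the trace of the square of a symmetric matrix, that is, the sum of the squares of
    its entries. *)
Lemma shape_kappa0 : kappa = 0 <-> H = 0.
Proof.
split=> [k0|H0]; last by rewrite /kappa /E H0 !mul0mx mxtrace0 mul0r.
have M0 : shape_mx = 0.
  by apply: (trace_sym_eq0 shape_mxT); rewrite shape_mx_sq k0 mulr0.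
have := congr1 (fun X => A *m X *m A^T) M0.
rewrite mulmx0 mul0mx /shape_mx !mulmxA AVT mul1mx -(mulmxA H) -mulmxA VA mulmx1.
by [].
Qed.

(* The kernel of the second fundamental form is the complement of the Lagrangian
   subspace spanned by the normal and the image of the Gauss map. *)
Lemma kernel_totally_real q (X : 'M[R]_(q, 5)) : kappa != 0 -> X *m H = 0 ->
  X *m A *m Jmx *m (X *m A)^T = 0.
Proof.
move=> k0 XH.
have rS : \rank S = 2.
  (* A traceless operator of rank at most 1 has square 0, which would make [kappa] vanish. *)
  apply/eqP; rewrite eqn_leq gauss_rank /= ltnNge; apply/negP => r1.
  have r1' : (\rank E <= 1)%N by apply: rankE; exact: leq_trans hessian_rank r1.
  move: k0; rewrite /kappa (square_rank1 r1' tr0) mxtrace0 mul0r eqxx //.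
apply: (lagrangian_complement WJW); first by rewrite rankW rS.
rewrite /W tr_col_mx mul_mx_row.
have -> : X *m A *m S^T = 0.
  have : la *: (X *m H) = 0 by rewrite XH scaler0.
  by rewrite scalemxAr BE mulmxN mulmxA => /eqP; rewrite oppr_eq0 => /eqP.
have -> : X *m A *m nu^T = 0.
  apply: trmx_inj; rewrite !trmx_mul trmxK trmx0 mulmxA nuA.
  exact: mul0mx.
exact: row_mx0.
Qed.

End MinimalHopf.

Section LagrangianExists.
Context {R : realType} {m : nat}.

(** [W] and its image under [Jmx] together have rank below [2 * m], so some nonzero vector is
    orthogonal to both; it is then normalized. *)
Lemma isotropic_extend k (W : 'M[R]_(k, m + m)) :
  W *m Jmx *m W^T = 0 -> (\rank W < m)%N ->
  exists v : 'rV[R]_(m + m), [/\ dot v v = 1, v *m W^T = 0 & v *m Jmx *m W^T = 0].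
Proof.
move=> WJW rW.
pose C := col_mx W (W *m Jmx).
have rC : (\rank C < m + m)%N.
  rewrite /C -addsmxE; apply: leq_ltn_trans (mxrank_adds_leqif _ _) _.
  by rewrite mxrankMfree ?Jmx_free // -addSn leq_add // ltnW.
have nk : kermx C^T != 0.
  by rewrite -mxrank_eq0 mxrank_ker mxrank_tr subn_eq0 -ltnNge.
have [i ni] : exists i, row i (kermx C^T) != 0.
  apply/existsP; apply: contraNT nk; rewrite negb_exists => /forallP r0.
  by apply/eqP/row_matrixP => i; rewrite row0; have := r0 i; rewrite negbK => /eqP.
set w := row i _ in ni.
have wC : w *m C^T = 0 by apply/sub_kermxP; exact: row_sub.
rewrite /C tr_col_mx mul_mx_row in wC.
have [wW wJ] : w *m W^T = 0 /\ w *m (W *m Jmx)^T = 0.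
  by apply: eq_row_mx; rewrite wC row_mx0.
have w2 : 0 < dot w w.
  rewrite lt_neqAle dot_ge0 andbT eq_sym; apply/eqP => /dot_eq0 w0.
  by rewrite w0 eqxx in ni.
exists ((Num.sqrt (dot w w))^-1 *: w); split.
- rewrite dotZl dotZr mulrA -invfM -expr2 sqr_sqrtr ?dot_ge0 // mulVf //.
  by rewrite gt_eqF.
- by rewrite -scalemxAl wW scaler0.
- move: wJ; rewrite trmx_mul JmxT mulNmx mulmxN mulmxA => /eqP.
  by rewrite oppr_eq0 -!scalemxAl => /eqP ->; rewrite scaler0.
Qed.

End LagrangianExists.

(** * Limits along ultrafilters *)

Section MatrixLimits.
Context {R : realType} {T : Type}.
Variables (F : set_system T).
Context {PF : ProperFilter F}.

(** Entrywise convergence reduces limits of products, transposes and traces to scalar limits;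
    [mcvg_rV] returns to the norm topology. *)
Definition mcvg m n (X : T -> 'M[R]_(m, n)) (L : 'M[R]_(m, n)) : Prop :=
  forall i j, (X y i j @[y --> F]) --> L i j.

Lemma mcvg_cst m n (L : 'M[R]_(m, n)) : mcvg (fun=> L) L.
Proof. by move=> i j; exact: cvg_cst. Qed.

Lemma mcvgB m n (X Y : T -> 'M[R]_(m, n)) L L' : mcvg X L -> mcvg Y L' ->
  mcvg (fun y => X y - Y y) (L - L').
Proof.
move=> cX cY i j; rewrite [(L - L') i j]mxE [(- L') i j]mxE.
have -> : (fun y => (X y - Y y) i j) = (fun y => X y i j - Y y i j).
  by apply/funext => y; rewrite !mxE.
by apply: cvgB; [exact: cX|exact: cY].
Qed.

Lemma mcvgD m n (X Y : T -> 'M[R]_(m, n)) L L' : mcvg X L -> mcvg Y L' ->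
  mcvg (fun y => X y + Y y) (L + L').
Proof.
move=> cX cY i j; rewrite [(L + L') i j]mxE.
have -> : (fun y => (X y + Y y) i j) = (fun y => X y i j + Y y i j).
  by apply/funext => y; rewrite !mxE.
by apply: cvgD; [exact: cX|exact: cY].
Qed.

Lemma mcvgM m n p (X : T -> 'M[R]_(m, n)) (Y : T -> 'M[R]_(n, p)) L L' :
  mcvg X L -> mcvg Y L' -> mcvg (fun y => X y *m Y y) (L *m L').
Proof.
move=> cX cY i j; rewrite [(L *m L') i j]mxE.
have -> : (fun y => (X y *m Y y) i j) = (fun y => \sum_k X y i k * Y y k j).
  by apply/funext => y; rewrite mxE.
apply: cvg_big => [|k _]; first exact: add_continuous.
by apply: cvgM; [exact: cX|exact: cY].
Qed.

Lemma mcvgT m n (X : T -> 'M[R]_(m, n)) L : mcvg X L -> mcvg (fun y => (X y)^T) L^T.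
Proof.
move=> cX i j; rewrite [L^T i j]mxE.
have -> : (fun y => (X y)^T i j) = (fun y => X y j i) by apply/funext => y; rewrite mxE.
exact: cX.
Qed.

Lemma mcvg_unique m n (X Y : T -> 'M[R]_(m, n)) L L' : mcvg X L -> mcvg Y L' ->
  (\forall y \near F, X y = Y y) -> L = L'.
Proof.
move=> cX cY XY; apply/matrixP => i j.
apply: (cvg_unique _ (cX i j)) => //.
apply: cvg_trans (cY i j); apply: near_eq_cvg.
by apply: filterS XY => y ->.
Qed.

Lemma mcvg_rV n (X : T -> 'rV[R]_n) L : mcvg X L -> X y @[y --> F] --> L.
Proof.
move=> cX; apply/cvgrPdist_le => e e0.
have H j : \forall y \near F, `|L 0 j - X y 0 j| <= e.
  exact: ((cvgrPdist_le _ _).1 (cX 0 j) e e0).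
have H' := @filter_forall T 'I_n (fun j y => `|L 0 j - X y 0 j| <= e) F _ H.
have S : [set y | forall j, `|L 0 j - X y 0 j| <= e] `<=` [set y | `|L - X y| <= e].
  move=> y Hy; apply: norm_coord_le => [|i j]; first exact: ltW.
  by rewrite (ord1 i) !mxE; have := Hy j.
near=> y; apply: S; near: y; exact: H'.
Unshelve. all: by end_near. Qed.

End MatrixLimits.

Section RealUltra.
Context {R : realType} {T : Type}.

Lemma ultra_fmap (S : Type) (U : set_system T) (f : T -> S) :
  UltraFilter U -> UltraFilter (f @ U).
Proof.
move=> UU; split; first exact: fmap_proper_filter.
move=> G PG fUG; rewrite eqEsubset; split=> // A GA.
have [//|UA] := in_ultra_setVsetC (f @^-1` A) UU.
have GC : G (~` A) by apply: fUG.
have GAC : G (A `&` ~` A) by apply: filterI.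
by have [x []] := filter_ex GAC.
Qed.

(** Compactness of the interval in terms of ultrafilters. One ultrafilter gives limits to all
    bounded functions at once, in place of successive extractions of subsequences. *)
Lemma ultra_bounded_cvg (U : set_system T) (f : T -> R) (c : R) : UltraFilter U ->
  (\forall y \near U, `|f y| <= c) -> exists l : R, (f y @[y --> U]) --> l.
Proof.
move=> UU fc.
have cpt : compact (`[- c, c]%classic : set R) by exact: segment_compact.
have UfU : UltraFilter (f @ U) by exact: ultra_fmap.
move: cpt; rewrite compact_ultra => /(_ (f @ U) UfU) [].
  by apply: filterS fc => y; rewrite /= in_itv /= ler_norml.
by move=> l [_ fl]; exists l.
Qed.

End RealUltra.

Section SymSquare.
Context {R : realType}.

(** The entries of the square are inner products of rows, at most the mean of two squared row
    lengths, and each of these is at most their sum, the trace. *)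
Lemma sym_sq_bound n (M : 'M[R]_n) i j : M^T = M ->
  `|(M *m M) i j| <= \tr (M *m M).
Proof.
move=> MT.
have E k l : (M *m M) k l = dot (row k M) (row l M) by rewrite -{2}MT mulmx_tr_dot.
have le k : dot (row k M) (row k M) <= \tr (M *m M).
  rewrite /mxtrace (bigD1 k) //= E lerDl sumr_ge0 // => l _.
  by rewrite E dot_ge0.
rewrite E; have := dot_ge0 (row i M - row j M); have := dot_ge0 (row i M + row j M).
rewrite !(dotDl, dotDr, dotNl, dotNr) (dotC (row j M)) ler_norml.
have := le i; have := le j.
by move: (dot _ _) (dot _ _) (dot _ _) (\tr _) => a b d t; lra.
Qed.

Lemma isotropic_step k m (W : 'M[R]_(k, m + m)) :
  (k < m)%N -> W *m Jmx *m W^T = 0 -> W *m W^T = 1%:M ->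
  exists v : 'rV[R]_(m + m), let W' := col_mx W v in
    W' *m Jmx *m W'^T = 0 /\ W' *m W'^T = 1%:M.
Proof.
move=> km WJW WW.
have [|v [v1 vW vJW]] := isotropic_extend WJW.
  by apply: leq_ltn_trans km; exact: rank_leq_row.
have WvT : W *m v^T = 0 by apply: trmx_inj; rewrite trmx_mul trmxK vW trmx0.
exists v => W'; split.
- rewrite /W' mul_col_mx tr_col_mx mul_col_row WJW vJW.
  have -> : v *m Jmx *m v^T = 0.
    by rewrite [LHS]mx11_scalar -/(dot _ _) dot_Jv raddf0.
  have -> : W *m Jmx *m v^T = 0.
    apply: trmx_inj; rewrite !trmx_mul trmxK trmx0 JmxT mulNmx mulmxN mulmxA vJW.
    exact: oppr0.
  exact: block_mx0.
- rewrite /W' tr_col_mx mul_col_row WW vW WvT.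
  have -> : v *m v^T = 1%:M by rewrite [LHS]mx11_scalar -/(dot _ _) v1.
  by rewrite -scalar_mx_block.
Qed.

(** Start from [nu *m Jmx] and extend twice to an orthonormal isotropic family. Isotropy against
    this first vector is exactly orthogonality to [nu]. *)
Lemma lagrangian_normal (nu : 'rV[R]_(3 + 3)) : dot nu nu = 1 ->
  exists L : 'M[R]_(3, 3 + 3),
    [/\ row_free L, L *m Jmx *m L^T = 0 & L *m nu^T = 0].
Proof.
move=> nu1; pose W := nu *m Jmx.
have WJW : W *m Jmx *m W^T = 0.
  by rewrite [LHS]mx11_scalar -/(dot _ _) dot_Jv raddf0.
have WW : W *m W^T = 1%:M.
  by rewrite [LHS]mx11_scalar -/(dot _ _) dot_JJ nu1.
have [v [I1 O1]] := isotropic_step (isT : (1 < 3)%N) WJW WW.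
have [w [I2 O2]] := isotropic_step (isT : (1 + 1 < 3)%N) I1 O1.
set L := col_mx _ w in I2 O2; exists L; split => //.
  by apply/row_freeP; exists L^T.
have : W = row_mx (row_mx 1%:M 0) 0 *m L.
  by rewrite /L !mul_row_col !mul0mx !addr0 mul1mx.
move: I2 => /[swap] WL I2.
have : L *m Jmx *m W^T = 0 by rewrite WL trmx_mul mulmxA I2 mul0mx.
rewrite /W trmx_mul JmxT mulNmx mulmxN -mulmxA (mulmxA Jmx Jmx) JmxJ mulNmx mul1mx mulmxN opprK.
by [].
Qed.

End SymSquare.

Section KernelProjector.
Context {R : realType} {n : nat}.
Variables (H gi : 'M[R]_n) (k : R).
Hypotheses (k0 : k != 0) (cub : H *m gi *m H *m gi *m H = k *: H).

(** [E = H *m gi] satisfies [E ^ 3 = k E], so its square divided by [k] is the projector onto the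
    part where [E] is invertible. *)
Definition ker_proj : 'M[R]_n := 1%:M - k^-1 *: (H *m gi *m (H *m gi)).

Lemma ker_projH : ker_proj *m H = 0.
Proof.
rewrite /ker_proj mulmxBl mul1mx -scalemxAl !mulmxA cub.
by rewrite scalerA mulVf // scale1r subrr.
Qed.

Lemma ker_proj_idem : ker_proj *m ker_proj = ker_proj.
Proof.
rewrite {2}/ker_proj mulmxBr mulmx1 -scalemxAr !mulmxA ker_projH.
by rewrite !mul0mx scaler0 subr0.
Qed.

Lemma ker_proj_trace : k = \tr (H *m gi *m (H *m gi)) / 2 -> \tr ker_proj = n%:R - 2.
Proof.
move=> kE; rewrite /ker_proj linearB /= mxtrace1 mxtraceZ.
have -> : \tr (H *m gi *m (H *m gi)) = 2 * k by rewrite kE mulrC mulfVK.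
by rewrite mulrCA mulVf // mulr1.
Qed.

End KernelProjector.

Lemma mxrank_eq3 (R : realType) (P : 'M[R]_5) : P *m P = P -> \tr P = 5 - 2 ->
  \rank P = 3.
Proof.
move=> PP tP; apply/eqP; rewrite -(eqr_nat R) idempotent_rank // tP; apply/eqP; ring.
Qed.

(** * The hypersurface as a graph over its tangent space *)

Section SmoothOnComp.
Context {R : realType}.

Lemma smooth_on_comp k n p (U : set 'rV[R]_k) (U' : set 'rV[R]_n)
    (f : 'rV[R]_k -> 'rV[R]_n) (g : 'rV[R]_n -> 'rV[R]_p) :
  open U -> open U' -> (forall u, U u -> U' (f u)) ->
  smooth_on U f -> smooth_on U' g -> smooth_on U (g \o f).
Proof.
move=> oU oU' fU Sf Sg; apply/(smooth_onP _ oU) => j.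
exact: (smooth_comp oU fU ((smooth_onP _ oU).1 Sf) ((smooth_onP _ oU').1 Sg j)).
Qed.

Lemma smooth_on_cst n p (U : set 'rV[R]_n) (a : 'rV[R]_p) : open U ->
  smooth_on U (fun=> a).
Proof. by move=> oU; apply/(smooth_onP _ oU) => j k; exact: Ck_cst. Qed.

Lemma smooth_onB n p (U : set 'rV[R]_n) (f g : 'rV[R]_n -> 'rV[R]_p) : open U ->
  smooth_on U f -> smooth_on U g -> smooth_on U (fun u => f u - g u).
Proof.
move=> oU Sf Sg; apply/(smooth_onP _ oU) => j k.
have := CkB oU ((smooth_onP _ oU).1 Sf j k) ((smooth_onP _ oU).1 Sg j k).
by apply: Ck_eq => // u _; rewrite !mxE.
Qed.

Lemma smooth_on_mulmxr n p q (U : set 'rV[R]_n) (f : 'rV[R]_n -> 'rV[R]_p)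
    (P : 'M[R]_(p, q)) : open U ->
  smooth_on U f -> smooth_on U (fun u => f u *m P).
Proof.
move=> oU Sf; apply/(smooth_onP _ oU) => j k.
apply: (Ck_mulmx oU (B := fun=> P)) => [i l|i l]; last exact: Ck_cst.
by rewrite (ord1 i); exact: ((smooth_onP _ oU).1 Sf l k).
Qed.

Lemma smooth_on_linear n p (U : set 'rV[R]_n) (A : 'M[R]_(n, p)) : open U ->
  smooth_on U (fun u => u *m A).
Proof.
move=> oU vs; case/lastP: vs => [|vs v] u Uu /=; first exact: differentiable_mulmxr.
rewrite foldr_rcons.
have -> : 'D_v (fun u => u *m A) = (fun=> v *m A).
  by apply/funext => w; exact: derive_mulmxr.
exact: (smooth_on_cst _ oU).
Qed.

Lemma derive_mulmxr_comp (V : normedModType R) p q (g : V -> 'rV[R]_p) (P : 'M[R]_(p, q)) y v :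
  differentiable g y -> 'D_v (fun y => g y *m P) y = 'D_v g y *m P.
Proof.
move=> dg; have dP := differentiable_mulmxr P (g y).
have dc := differentiable_comp dg dP.
apply: (etrans (deriveE v dc)); rewrite (diff_comp dg dP) /= -(deriveE _ dg).
by rewrite -(deriveE _ dP) derive_mulmxr.
Qed.

Lemma ball0_convex n (rho : R) (u v : 'rV[R]_n) (t : R) :
  `|u| < rho -> `|v| < rho -> 0 <= t <= 1 -> `|u + t *: (v - u)| < rho.
Proof.
move=> ur vr /andP[t0 t1].
have -> : u + t *: (v - u) = (1 - t) *: u + t *: v.
  by rewrite scalerBr scalerBl scale1r addrAC -addrA.
apply: le_lt_trans (ler_normD _ _) _; rewrite !normrZ !ger0_norm ?subr_ge0 //.
set M := Num.max `|u| `|v|.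
have M_lt : M < rho by rewrite gt_max ur.
have s0 : 0 <= 1 - t by rewrite subr_ge0.
have H1 : (1 - t) * `|u| <= (1 - t) * M by rewrite ler_wpM2l // le_max lexx.
have H2 : t * `|v| <= t * M by rewrite ler_wpM2l // le_max lexx orbT.
apply: le_lt_trans (lerD H1 H2) _.
by rewrite -mulrDl subrK mul1r.
Qed.

Lemma open_ball0 n (rho : R) : open [set y : 'rV[R]_n | `|y| < rho].
Proof.
have -> : [set y : 'rV[R]_n | `|y| < rho] = [set u | `|u - 0| < rho].
  by apply/funext => u; rewrite /= subr0.
exact: open_ball_norm.
Qed.

End SmoothOnComp.

(** The trace of the second form with respect to the metric does not depend on the chart; [Q] is the
    Jacobian of the change of coordinates. *)
Lemma trace_change (R : realType) n p (Q : 'M[R]_n) (A S : 'M[R]_(n, p)) :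
  Q \in unitmx -> A *m A^T \in unitmx ->
  \tr (Q *m A *m (Q *m S)^T *m invmx (Q *m A *m (Q *m A)^T)) =
  \tr (A *m S^T *m invmx (A *m A^T)).
Proof.
move=> Qu gu; have QTu : Q^T \in unitmx by rewrite unitmx_tr.
rewrite !trmx_mul.
have -> : Q *m A *m (A^T *m Q^T) = Q *m ((A *m A^T) *m Q^T) by rewrite !mulmxA.
have -> : Q *m A *m (S^T *m Q^T) = Q *m (A *m S^T) *m Q^T by rewrite !mulmxA.
move: (A *m A^T) (A *m S^T) gu => X Y Xu.
have -> : invmx (Q *m (X *m Q^T)) = invmx Q^T *m invmx X *m invmx Q.
  have U : Q *m (X *m Q^T) \in unitmx by rewrite !unitmx_mul Qu Xu QTu.
  apply: (row_free_inj (A := Q *m (X *m Q^T))); first by rewrite row_free_unit.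
  rewrite mulVmx // -!mulmxA (mulmxA (invmx Q) Q) mulVmx // mul1mx.
  by rewrite (mulmxA (invmx X)) mulVmx // mul1mx mulVmx.
rewrite -!mulmxA mxtrace_mulC !mulmxA -(mulmxA _ (Q^T)) mulmxV // mulmx1.
by rewrite -!mulmxA mulVmx // mulmx1.
Qed.

Section GraphChart.
Context {R : realType} {N : smoothManifold R 5}.
Variables (f xi : N -> 'rV[R]_(3 + 3)).
Hypotheses (f_imm : immersion f) (xi_smooth : smooth_vec xi).
Hypothesis xi_normal : unit_normal_field f xi.
Hypothesis legendre : forall x, let c := chart_at x in
  xi x *m Jmx *m ('J (xi \o cinv c) (cmap c x))^T = 0.
Hypothesis tr0 : forall x, let c := chart_at x in
  \tr (second_form (f \o cinv c) (xi \o cinv c) (cmap c x)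
       *m invmx (induced_metric f c (cmap c x))) = 0.

Variables (c : chart R 5 N) (u0 : 'rV[R]_5) (rho : R) (th : 'rV[R]_5 -> 'rV[R]_5).
Hypotheses (ac : atlas c) (cu0 : ccod c u0).

Let F := f \o cinv c.
Let A0 := 'J F u0.
Let xi0 := xi (cinv c u0).
(** A right inverse of [A]: it sends an ambient vector to the coordinates, in the basis of rows of
    [A], of its orthogonal projection onto their span. *)
Definition tangent_proj (A : 'M[R]_(5, 3 + 3)) := A^T *m invmx (A *m A^T).
Let Pm := tangent_proj A0.
Let Om := [set y : 'rV[R]_5 | `|y| < rho].
Hypotheses (rho0 : 0 < rho) (Sth : smooth_on Om th) (th0 : th 0 = u0).
Hypothesis thP : forall y, `|y| < rho -> ccod c (th y) /\ (F (th y) - F u0) *m Pm = y.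

Definition graph_map := F \o th.
Definition graph_normal := xi \o cinv c \o th.
Definition height (y : 'rV[R]_5) := dot (graph_map y - F u0) xi0.
Local Notation G := graph_map.
Local Notation mm := graph_normal.
Local Notation h := height.
Definition height_hess (u : 'rV[R]_5) : 'M[R]_5 :=
  \matrix_(i, j) 'D_('e_i) ('D_('e_j) height) u.
Local Notation H := height_hess.
Let la y := dot xi0 (mm y).

Let oOm : open Om. Proof. exact: open_ball0. Qed.
Let fA0 : row_free A0. Proof. exact: immersion_chart. Qed.
Let xiA0 : xi0 *m A0^T = 0. Proof. exact: normal_chart. Qed.
Let xi1 : dot xi0 xi0 = 1. Proof. exact: (xi_normal _).1. Qed.

Let SG : smooth_on Om G.
Proof.
apply: (smooth_on_comp oOm (@ccod_open _ _ _ c)) => //; first by move=> y /thP[].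
exact: (f_imm.1 c ac).
Qed.

Let Smm : smooth_on Om mm.
Proof.
apply: (smooth_on_comp oOm (@ccod_open _ _ _ c)) => //; first by move=> y /thP[].
exact: (xi_smooth ac).
Qed.

Let mmE y : mm y = xi (cinv c (th y)). Proof. by []. Qed.
Let GE y : G y = F (th y). Proof. by []. Qed.
Let jG y : Om y -> 'J G y = 'J th y *m 'J F (th y).
Proof.
move=> Oy; apply: jacobian_comp; first exact: smooth_on_diff Sth Oy.
by apply: smooth_on_diff (f_imm.1 c ac) _; exact: (thP Oy).1.
Qed.

Let jmm y : Om y -> 'J mm y = 'J th y *m 'J (xi \o cinv c) (th y).
Proof.
move=> Oy; apply: (jacobian_comp (f := th) (g := xi \o cinv c)).
  exact: smooth_on_diff Sth Oy.
by apply: smooth_on_diff (xi_smooth ac) _; exact: (thP Oy).1.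
Qed.

#[local] Opaque graph_map graph_normal.

Let dG y : Om y -> differentiable G y. Proof. exact: smooth_on_diff. Qed.
Let dmm y : Om y -> differentiable mm y. Proof. exact: smooth_on_diff. Qed.

Lemma decomp0 (z : 'rV[R]_(3 + 3)) : z = z *m Pm *m A0 + dot z xi0 *: xi0.
Proof.
by rewrite {1}(tangent_decomp z (erefl : (3 + 3)%N = 6) fA0 xiA0 xi1) /Pm /tangent_proj !mulmxA.
Qed.

Lemma graph_mapE y : Om y -> G y = F u0 + y *m A0 + h y *: xi0.
Proof.
move=> Oy; have := decomp0 (G y - F u0); rewrite (thP Oy).2 => E.
by rewrite -addrA -E addrC subrK.
Qed.

Let DGc v y : Om y -> 'D_v (fun y => G y - F u0) y = 'D_v G y.
Proof.
move=> Oy; have d1 : derivable G y v by apply: diff_derivable; exact: dG.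
apply: (etrans (deriveB d1 (derivable_cst (F u0) y v))).
apply: (etrans (congr1 (fun z => 'D_v G y - z) (derive_cst (F u0) y v))).
exact: subr0.
Qed.

Let dGc y : Om y -> differentiable (fun y => G y - F u0) y.
Proof.
by move=> Oy; apply: differentiableB; [exact: dG|exact: differentiable_cst].
Qed.

Let DGP v y : Om y -> 'D_v G y *m Pm = v.
Proof.
move=> Oy.
have E : 'D_v (fun y => (G y - F u0) *m Pm) y = 'D_v id y.
  by apply: (eq_on_derive v oOm _ Oy) => w Ow; exact: (thP Ow).2.
have {}E := etrans (esym (derive_mulmxr_comp Pm v (dGc Oy))) E.
apply: (etrans (esym (congr1 (fun z => z *m Pm) (DGc v Oy)))).
by apply: (etrans E); exact: derive_id.
Qed.

Let Dh v y : Om y -> 'D_v h y = dot ('D_v G y) xi0.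
Proof.
move=> Oy; apply: (etrans (derive_dot v (dGc Oy) (differentiable_cst _ _))).
apply: (etrans (congr2 (fun a b => dot a xi0 + dot (G y - F u0) b)
  (DGc v Oy) (derive_cst xi0 y v))).
by rewrite dot0r addr0.
Qed.

Lemma height_smooth : smooth Om h.
Proof.
apply: smooth_dot => //; last exact: smooth_on_cst.
by apply: smooth_onB => //; exact: smooth_on_cst.
Qed.

Lemma derive_graph v y : Om y -> 'D_v G y = v *m A0 + 'D_v h y *: xi0.
Proof. by move=> Oy; rewrite {1}(decomp0 ('D_v G y)) DGP // Dh. Qed.

Let AGP y : Om y -> 'J G y *m Pm = 1%:M.
Proof.
move=> Oy; apply/row_matrixP => i; rewrite row_mul (row_jacobian i (dG Oy)) DGP //.
by rewrite row1.
Qed.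

Let fAG y : Om y -> row_free ('J G y).
Proof. by move=> Oy; apply/row_freeP; exists Pm; exact: AGP. Qed.

Let mm1 y : Om y -> dot (mm y) (mm y) = 1.
Proof. by move=> _; rewrite mmE; exact: (xi_normal _).1. Qed.

Let mmA y : Om y -> mm y *m ('J G y)^T = 0.
Proof.
move=> Oy; rewrite jG // trmx_mul mulmxA mmE.
by rewrite normal_chart ?mul0mx //; exact: (thP Oy).1.
Qed.

(** The graph is never vertical: if the normal at [y] were orthogonal to [xi0], orthogonality to the
    tangent vectors of the graph would make it orthogonal to the rows of [A0] as well, hence
    zero. *)
Let la0 y : Om y -> la y != 0.
Proof.
move=> Oy; apply/eqP => l0.
have m0 : mm y *m A0^T = 0.
  apply/rowP => j; rewrite mulmx_tr_row mxE.
  have E1 := congr1 (fun v : 'rV[R]_5 => v 0 j) (mmA Oy).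
  rewrite mulmx_tr_row [RHS]mxE in E1.
  have E2 := etrans (row_jacobian j (dG Oy)) (derive_graph 'e_j Oy).
  have {E1}E2 := etrans (esym (congr1 (dot (mm y)) E2)) E1.
  by move: E2; rewrite dotDr dotZr (dotC _ xi0) -/(la y) l0 mulr0 addr0 -rowE.
have := mm1 Oy.
rewrite (normal_decomp (erefl : (3 + 3)%N = 6) fA0 xiA0 xi1 m0) (dotC (mm y)) -/(la y).
by rewrite l0 scale0r dot0l => /esym/eqP; rewrite oner_eq0.
Qed.

(* Both geometric conditions are invariant under the change of coordinates from
   the preferred chart at the point. *)
Let change y : Om y -> exists (Q : 'M[R]_5) (d := chart_at (cinv c (th y))),
  'J G y = Q *m 'J (f \o cinv d) (cmap d (cinv c (th y))) /\
  'J mm y = Q *m 'J (xi \o cinv d) (cmap d (cinv c (th y))).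
Proof.
move=> Oy; have [cy _] := thP Oy.
exists ('J th y *m 'J (cmap (chart_at (cinv c (th y))) \o cinv c) (th y)).
have ad : atlas (chart_at (cinv c (th y))) by exact: chart_at_atlas.
have dx := @chart_at_dom _ _ _ (cinv c (th y)).
split.
- have E := jacobian_transition ac ad f_imm.1 cy dx.
  by apply: (etrans (jG Oy)); rewrite -[RHS]mulmxA; exact: (congr1 (mulmx ('J th y)) E).
- have E := jacobian_transition ac ad xi_smooth cy dx.
  by apply: (etrans (jmm Oy)); rewrite -[RHS]mulmxA; exact: (congr1 (mulmx ('J th y)) E).
Qed.

Let mmJS y : Om y -> mm y *m Jmx *m ('J mm y)^T = 0.
Proof.
move=> Oy; have [Q [_ ->]] := change Oy.
by rewrite trmx_mul mulmxA mmE legendre mul0mx.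
Qed.

Let mmS y : Om y -> mm y *m ('J mm y)^T = 0.
Proof.
move=> Oy; apply/rowP => j; rewrite mulmx_tr_dot row_id mxE (row_jacobian j (dmm Oy)).
have E : 'D_('e_j) (fun y => dot (mm y) (mm y)) y = 0.
  by apply: (etrans (eq_on_derive 'e_j oOm _ Oy) (derive_cst (1 : R) y 'e_j)) => w Ow; exact: mm1.
have {}E := etrans (esym (derive_dot 'e_j (dmm Oy) (dmm Oy))) E.
by move: E; rewrite (dotC ('D_('e_j) mm y)); move: (dot _ _) => a; lra.
Qed.

(** Differentiate [mmJS]. The resulting second-derivative term is symmetric in the two directions,
    while the first-derivative term is skew because [Jmx] is. *)
Let SJS y : Om y -> 'J mm y *m Jmx *m ('J mm y)^T = 0.
Proof.
have fin (a b d : R) : b + d = 0 -> a + d = 0 -> b = - a -> a = 0 by lra.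
move=> Oy; apply/matrixP => i j.
rewrite mulmx_tr_dot row_mul !(row_jacobian _ (dmm Oy)) [RHS]mxE.
have dD k : differentiable ('D_('e_k) mm) y by exact: smooth_on_diff (smooth_on_D _ Smm) Oy.
have dJ : differentiable (fun y => mm y *m Jmx) y.
  exact: smooth_on_diff (smooth_on_mulmxr Jmx oOm Smm) Oy.
have E k l : dot ('D_('e_k) mm y *m Jmx) ('D_('e_l) mm y) +
    dot (mm y *m Jmx) ('D_('e_k) ('D_('e_l) mm) y) = 0.
  have E : 'D_('e_k) (fun y => dot (mm y *m Jmx) ('D_('e_l) mm y)) y = 0.
    apply: (etrans (eq_on_derive 'e_k oOm _ Oy) (derive_cst (0 : R) y 'e_k)) => w Ow.
    have := congr1 (fun v : 'rV[R]_5 => v 0 l) (mmJS Ow).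
    by rewrite mulmx_tr_dot row_id [RHS]mxE (row_jacobian l (dmm Ow)).
  have {}E := etrans (esym (derive_dot 'e_k dJ (dD l))) E.
  by rewrite (derive_mulmxr_comp Jmx 'e_k (dmm Oy)) in E.
have E1 := E i j; have E2 := E j i.
have sw := smooth_on_schwarz 'e_i 'e_j oOm Smm Oy.
have E3 := etrans (esym (congr1 (fun z => dot ('D_('e_i) mm y *m Jmx) ('D_('e_j) mm y) +
  dot (mm y *m Jmx) z) sw)) E1.
have E4 := etrans (dot_J ('D_('e_j) mm y) ('D_('e_i) mm y)) (congr1 -%R (dotC _ _)).
exact: fin E2 E3 E4.
Qed.

(** The graph map is affine plus [h] times the constant vector [xi0], so its second derivatives are
    [H] times [xi0]; pairing with the normal gives the factor [la]. *)
Let BE y : Om y -> la y *: H y = - ('J G y *m ('J mm y)^T).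
Proof.
move=> Oy; rewrite -(second_formE oOm SG Smm mmA Oy).
apply/matrixP => i j; rewrite [LHS]mxE [X in _ * X]mxE [RHS]mxE.
have D2 : 'D_('e_i) ('D_('e_j) G) y = 'D_('e_i) ('D_('e_j) h) y *: xi0.
  have dDh : differentiable ('D_('e_j) h) y.
    exact: smooth_diff (smooth_D 'e_j height_smooth) Oy.
  apply: (etrans (eq_on_derive 'e_i oOm (fun w Ow => derive_graph 'e_j Ow) Oy)).
  have d1 : derivable (fun w => 'D_('e_j) h w *: xi0) y 'e_i.
    by apply: diff_derivable; exact: differentiableZl.
  apply: (etrans (deriveD (derivable_cst ('e_j *m A0) y 'e_i) d1)).
  rewrite derive_cst add0r.
  apply: (etrans (deriveE _ (differentiableZl _ dDh))).
  by rewrite (diffZl _ dDh) /= -(deriveE _ dDh).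
apply: (etrans _ (esym (congr1 (fun z => dot z (mm y)) D2))).
by rewrite dotZl mulrC.
Qed.

Let g y := 'J G y *m ('J G y)^T.

Let HT y : Om y -> (H y)^T = H y.
Proof.
move=> Oy; apply/matrixP => i j; rewrite [LHS]mxE [LHS]mxE [RHS]mxE.
exact: smooth_schwarz oOm height_smooth Oy.
Qed.

(** The trace is known to vanish only in the preferred charts. By [second_formE] the second form is
    a product of two Jacobians, which change by the same factor [Q]. *)
Let trH0 y : Om y -> \tr (H y *m invmx (g y)) = 0.
Proof.
move=> Oy; apply: (mulfI (la0 Oy)); rewrite mulr0 -mxtraceZ scalemxAl (BE Oy).
have [Q [EG ES]] := change Oy; move: EG ES.
set x := cinv c (th y); set d := chart_at x => EG ES.
apply: (etrans (congr2 (fun X Y => \tr (- (X *m Y^T) *m invmx (X *m X^T))) EG ES)).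
have ad : atlas d by exact: chart_at_atlas.
have dx : ccod d (cmap d x) by apply: cmap_cod; exact: chart_at_dom.
have Qu : Q \in unitmx.
  rewrite -row_free_unit -row_leq_rank.
  have := fAG Oy; rewrite EG -row_leq_rank => r5.
  exact: leq_trans r5 (mxrankM_maxl _ _).
rewrite mulNmx linearN /= trace_change //; last by apply: gram_unit; exact: immersion_chart.
apply: (etrans _ (tr0 x)).
have SFE := second_formE (@ccod_open _ _ _ d) (f_imm.1 d ad) (xi_smooth ad)
  (fun u du => normal_chart f_imm xi_normal ad du) dx.
apply: (etrans _ (esym (congr1 (fun B => \tr (B *m _)) SFE))).
by rewrite mulNmx linearN.
Qed.

Let Sg i j : smooth Om (fun y => g y i j).
Proof.
have SJ i' a : smooth Om (fun y => ('J G y) i' a).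
  move=> k; have := (smooth_onP _ oOm).1 (smooth_on_D 'e_i' SG) a k.
  by apply: Ck_eq => // y Oy; rewrite -(row_jacobian i' (dG Oy)) mxE.
move=> k; apply: (Ck_mulmx oOm) => [a b|a b]; first exact: SJ.
by apply: Ck_eq (SJ b a k) => // y _; rewrite [RHS]mxE.
Qed.

Let gU y : Om y -> g y \in unitmx.
Proof. by move=> Oy; apply: gram_unit; exact: fAG. Qed.

Let Sgi i j : smooth Om (fun y => invmx (g y) i j).
Proof. by move=> k; apply: (Ck_invmx oOm) => // a b; exact: Sg. Qed.

Definition graph_kappa y :=
  let g := 'J G y *m ('J G y)^T in
  \tr (H y *m invmx g *m (H y *m invmx g)) / 2.
Local Notation kappa := graph_kappa.

Let SH i j : smooth Om (fun y => H y i j).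
Proof.
move=> k; apply: Ck_eq (smooth_D 'e_i (smooth_D 'e_j height_smooth) k) => // y _.
by rewrite mxE.
Qed.

Let Skappa : smooth Om kappa.
Proof.
move=> k; rewrite /graph_kappa /=; apply: (CkM oOm); last exact: Ck_cst.
apply: (Ck_sum oOm) => i _; apply: (Ck_mulmx oOm) => a b;
  apply: (Ck_mulmx oOm) => a' b'; [exact: SH|exact: Sgi|exact: SH|exact: Sgi].
Qed.

Lemma graph_flat (y x : 'rV[R]_5) v : Om y -> kappa y != 0 -> x *m H y = 0 ->
  Om (x + y) -> 'D_v h (x + y) = 'D_v h y.
Proof.
move=> Oy ky xH Oxy.
have dh w : Om w -> differentiable h w by move=> Ow; exact: smooth_diff height_smooth Ow.
apply: (etrans (derive_coords v (dh _ Oxy))).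
apply: (etrans _ (esym (derive_coords v (dh _ Oy)))).
apply: eq_bigr => i _; apply: (congr1 (fun z => v 0 i *: z)).
have cvx u w (t : R) : Om u -> Om w -> 0 <= t <= 1 -> Om (u + t *: (w - u)).
  by move=> ur wr t01; exact: ball0_convex.
have HE u i' j : H u i' j = 'D_('e_i') ('D_('e_j) h) u by rewrite mxE.
have cub u : Om u ->
    H u *m invmx (g u) *m H u *m invmx (g u) *m H u = kappa u *: H u.
  move=> Ou; exact: (shape_cubic (fAG Ou) erefl (la0 Ou) (BE Ou) (mm1 Ou) (mmS Ou)
    (mmJS Ou) (SJS Ou) (trH0 Ou)).
have k0 u : Om u -> kappa u = 0 <-> H u = 0.
  by move=> Ou; exact: (shape_kappa0 (fAG Ou) erefl (HT Ou)).
exact: (gradient_kernel oOm cvx height_smooth Skappa Sgi HE cub k0 i Oy ky xH Oxy).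
Qed.

Lemma graph_kernel_real q (X : 'M[R]_(q, 5)) y : Om y -> kappa y != 0 ->
  X *m H y = 0 -> X *m 'J G y *m Jmx *m (X *m 'J G y)^T = 0.
Proof.
move=> Oy ky XH.
exact: (kernel_totally_real (la0 Oy) (BE Oy) (mm1 Oy) (mmA Oy) (mmS Oy)
    (mmJS Oy) (SJS Oy) (trH0 Oy) ky XH).
Qed.

Let A0P : A0 *m Pm = 1%:M.
Proof. by rewrite /Pm /tangent_proj mulmxA mulmxV //; exact: gram_unit. Qed.

Let Om0 : Om 0. Proof. by rewrite /Om /= normr0. Qed.

Let JG0 : 'J G 0 = A0.
Proof.
have E := jG Om0; rewrite th0 in E.
have := AGP Om0; rewrite E -mulmxA A0P mulmx1 => ->.
by rewrite mul1mx.
Qed.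

Let Dh0 v : 'D_v h 0 = 0.
Proof.
apply: (etrans (Dh v Om0)).
have E := etrans (deriveEjacobian v (dG Om0)) (congr1 (mulmx v) JG0).
apply: (etrans (congr1 (fun z => dot z xi0) E)).
by rewrite dotC dot_mulmx xiA0 dot0l.
Qed.

Let h0 : h 0 = 0.
Proof. by rewrite /height GE th0 subrr dot0l. Qed.

Let dh w : Om w -> differentiable h w.
Proof. by move=> Ow; exact: smooth_diff height_smooth Ow. Qed.

Let height_zero r k (K : 'M[R]_(k, 5)) : r <= rho ->
  (forall s v, `|s *m K| < r -> 'D_v h (s *m K) = 0) ->
  forall s, `|s *m K| < r -> h (s *m K) = 0.
Proof.
move=> rr D s sr.
have sc (t : R) : 0 <= t <= 1 -> `|t *: s *m K| < r.
  move=> /andP[t0 t1].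
  rewrite -scalemxAl.
  rewrite normrZ.
  rewrite (ger0_norm t0).
  apply: le_lt_trans sr.
  by apply: ler_piMl.
have dl (t : R) : 0 <= t <= 1 -> differentiable h (t *: (s *m K) + 0).
  by move=> /sc H1; apply: dh; rewrite addr0 scalemxAl; exact: lt_le_trans H1 rr.
have [t /andP[t0 t1] E] := MVT_line dl.
have t01 : 0 <= t <= 1 by rewrite !ltW.
rewrite !addr0 h0 subr0 scalemxAl in E.
by rewrite E; apply: D; exact: sc.
Qed.

Definition graph_proj y := ker_proj (H y) (invmx (g y)) (kappa y).

Local Notation Pi := graph_proj.

Let cubE y : Om y ->
  H y *m invmx (g y) *m H y *m invmx (g y) *m H y = kappa y *: H y.
Proof.
move=> Oy; exact: (shape_cubic (fAG Oy) erefl (la0 Oy) (BE Oy) (mm1 Oy) (mmS Oy)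
    (mmJS Oy) (SJS Oy) (trH0 Oy)).
Qed.

Let PiH y : Om y -> kappa y != 0 -> Pi y *m H y = 0.
Proof. by move=> Oy ky; exact: ker_projH ky (cubE Oy). Qed.

Let PiPi y : Om y -> kappa y != 0 -> Pi y *m Pi y = Pi y.
Proof. by move=> Oy ky; exact: ker_proj_idem ky (cubE Oy). Qed.

Let trPi y : kappa y != 0 -> \tr (Pi y) = 5 - 2.
Proof. by move=> ky; exact: ker_proj_trace ky erefl. Qed.

Definition graph_V y := invmx (g y) *m 'J G y.
(** The one factor of the projector that could blow up as [kappa] tends to 0. It is the square of a
    symmetric matrix whose square has trace [2 * kappa], divided by [kappa], so its entries stay
    within 2; the other factors converge at the base point. *)
Definition graph_Z y := (kappa y)^-1 *: (shape_mx ('J G y) (H y) (g y) *m shape_mx ('J G y) (H y) (g y)).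

Local Notation Vm := graph_V.
Local Notation Zm := graph_Z.

Let PiE y : Om y -> Pi y = 1%:M - 'J G y *m Zm y *m (Vm y)^T.
Proof.
move=> Oy; apply: (congr1 (fun X => 1%:M - X)).
apply: (etrans (congr1 (fun X => (kappa y)^-1 *: X) (shape_square (H y) (fAG Oy) (erefl (g y))))).
by rewrite scalemxAl scalemxAr.
Qed.

Let Zbound y i j : Om y -> kappa y != 0 -> `|Zm y i j| <= 2.
Proof.
move=> Oy ky; rewrite /graph_Z mxE normrM normfV.
have MT := shape_mxT ('J G y) (g y) (HT Oy).
have H1 := sym_sq_bound i j MT; have H0 := le_trans (normr_ge0 _) H1.
have E := shape_mx_sq (H y) (fAG Oy) (erefl (g y)).
rewrite E -/(kappa y) in H1 H0.
have k0 : 0 < kappa y by rewrite lt_neqAle eq_sym ky -(pmulr_rge0 _ (ltr0Sn R 1)).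
by rewrite (gtr0_norm k0) mulrC ler_pdivrMr.
Qed.

Let k0E y : Om y -> kappa y = 0 <-> H y = 0.
Proof. by move=> Oy; exact: (shape_kappa0 (fAG Oy) erefl (HT Oy)). Qed.

Let VE : Vm = (fun y => invmx (g y) *m 'J G y). Proof. by []. Qed.
Let HEE y i j : H y i j = 'D_('e_i) ('D_('e_j) h) y. Proof. by rewrite mxE. Qed.

#[local] Opaque graph_kappa graph_proj graph_Z graph_V height_hess height.

Theorem totally_real_directions : exists (K : 'M[R]_(3, 5)) (r : R),
  [/\ 0 < r, r <= rho, row_free (K *m A0),
      K *m A0 *m Jmx *m (K *m A0)^T = 0 &
      forall s, `|s *m K| < r -> h (s *m K) = 0].
Proof.
have [[r [r0 rr kr]]|nP] := pselect (exists r : R, [/\ 0 < r, r <= rho &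
    forall y : 'rV[R]_5, `|y| < r -> kappa y = 0]).
  have [L [fL LJL Lxi]] := lagrangian_normal xi1.
  have KA : L *m Pm *m A0 = L.
    apply/row_matrixP => i; rewrite !row_mul [RHS](decomp0 (row i L)).
    suff -> : dot (row i L) xi0 = 0 by rewrite scale0r addr0.
    have := congr1 (fun M : 'cV[R]_3 => M i 0) Lxi.
    by rewrite mulmx_tr_dot row_id mxE.
  exists (L *m Pm), r; split; [exact: r0|exact: rr| | |].
  - by rewrite KA.
  - by rewrite KA.
  apply: (height_zero rr) => s v sr.
  set y := s *m (L *m Pm) in sr *.
  have Oy : Om y by exact: lt_le_trans sr rr.
  have seg (t : R) : 0 <= t <= 1 -> `|t *: y + 0| < r.
    move=> /andP[t0 t1]; rewrite addr0 normrZ (ger0_norm t0).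
    by apply: le_lt_trans sr; apply: ler_piMl.
  have Di i : 'D_('e_i) h y = 0.
    have dl (t : R) : 0 <= t <= 1 -> differentiable ('D_('e_i) h) (t *: y + 0).
      move=> /seg H1; have Ot : Om (t *: y + 0) by exact: lt_le_trans H1 rr.
      exact: smooth_diff (smooth_D 'e_i height_smooth) Ot.
    have [t /andP[t0 t1] E] := MVT_line dl.
    have t01 : 0 <= t <= 1 by rewrite !ltW.
    have Ot : Om (t *: y + 0) by exact: lt_le_trans (seg t t01) rr.
    have Ht : H (t *: y + 0) = 0.
      by apply/(k0E Ot); exact: kr (seg t t01).
    have E2 : 'D_y ('D_('e_i) h) (t *: y + 0) = 0.
      have dD := smooth_diff (smooth_D 'e_i height_smooth) Ot.
      apply: (etrans (derive_coords y dD)).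
      apply: big1 => j _.
      have E3 := etrans (esym (HEE _ j i)) (congr1 (fun M : 'M[R]_5 => M j i) Ht).
      rewrite [RHS]mxE in E3.
      by apply: (etrans (congr1 (fun z => y 0 j *: z) E3)); exact: scaler0.
    have := etrans E E2; rewrite addr0 => /eqP; rewrite subr_eq0 => /eqP E4.
    by apply: (etrans E4); exact: Dh0.
  apply: (etrans (derive_coords v (dh Oy))); apply: big1 => i _.
  by apply: (etrans (congr1 (fun z => v 0 i *: z) (Di i))); exact: scaler0.
pose S : set 'rV[R]_5 := [set y | kappa y != 0].
(* Points with [kappa != 0] accumulate at 0, so the neighbourhoods of 0 restricted to them form a
   proper filter, which an ultrafilter refines. *)
have PF : ProperFilter (within S (nbhs (0 : 'rV[R]_5))).
  apply: Build_ProperFilter_ex => B; rewrite withinE => -[C nC BC].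
  have [d d0 Hd] := near_norm_ball nC.
  have [y [yd ky]] : exists y, `|y| < Num.min d rho /\ kappa y != 0.
    apply: contrapT => nE; apply: nP; exists (Num.min d rho).
    have m0 : 0 < Num.min d rho by rewrite lt_min d0 rho0.
    have m1 : Num.min d rho <= rho by rewrite ge_min lexx orbT.
    split; [exact: m0|exact: m1|move=> y yd].
    have [E|ky] := eqVneq (kappa y) 0; first exact: E.
    by case: nE; exists y; exact: (conj yd ky).
  exists y.
  have Cy : C y.
    by apply: Hd; rewrite subr0; apply: lt_le_trans yd _; rewrite ge_min lexx.
  have : (C `&` S) y by exact: (conj Cy ky).
  by rewrite -BC => -[].
have [U [UU sU]] := ultraFilterLemma PF.
have Unb B : nbhs (0 : 'rV[R]_5) B -> U B.
  by move=> nB; apply: sU; apply: filterS nB => y By _.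
have US : \forall y \near U, kappa y != 0 by apply: sU; apply: nearW.
have UO : \forall y \near U, Om y by exact: (Unb Om (open_nbhs_nbhs (conj oOm Om0))).
have UOS : \forall y \near U, Om y /\ kappa y != 0 by exact: (filterI UO US).
have cU (q : 'rV[R]_5 -> R) : differentiable q 0 -> (q y @[y --> U]) --> q 0.
  by move=> /differentiable_continuous cq B /cq; exact: Unb.
have cJ : mcvg U (fun y => 'J G y) A0.
  move=> i a; rewrite -JG0.
  have := smooth_diff ((smooth_onP _ oOm).1 (smooth_on_D 'e_i SG) a) Om0.
  move=> /cU; rewrite -(row_jacobian i (dG Om0)) mxE.
  apply: cvg_trans; apply: near_eq_cvg; apply: filterS UO => y Oy.
  by rewrite -(row_jacobian i (dG Oy)) mxE.
have cgi : mcvg U (fun y => invmx (g y)) (invmx (g 0)).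
  by move=> i j; apply: cU; exact: smooth_diff (Sgi i j) Om0.
have cV : mcvg U Vm (Vm 0) by rewrite VE JG0; exact: mcvgM cgi cJ.
have ex i j : exists l : R, (Zm y i j @[y --> U]) --> l.
  have ZU : \forall y \near U, `|Zm y i j| <= 2.
    by apply: filterS UOS => y [Oy ky]; exact: Zbound.
  exact: (ultra_bounded_cvg UU ZU).
pose Z0 : 'M[R]_(3 + 3) := \matrix_(i, j) sval (cid (ex i j)).
have cZ : mcvg U Zm Z0.
  by move=> i j; rewrite [Z0 i j]mxE; exact: svalP (cid (ex i j)).
pose P0 := 1%:M - A0 *m Z0 *m (Vm 0)^T.
have cPi : mcvg U Pi P0.
  have C1 : mcvg U (fun y => 1%:M - 'J G y *m Zm y *m (Vm y)^T) P0.
    by apply: mcvgB; [exact: mcvg_cst|apply: mcvgM; [exact: mcvgM|exact: mcvgT]].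
  move=> i j; apply: cvg_trans (C1 i j); apply: near_eq_cvg.
  by apply: filterS UO => y Oy; rewrite PiE.
have PP : P0 *m P0 = P0.
  apply: (mcvg_unique (mcvgM cPi cPi) cPi).
  by apply: filterS UOS => y [Oy ky]; exact: PiPi.
(* The rank need not pass to the limit, but the trace does, and it equals the rank since [P0] is
   idempotent. *)
have trP : \tr P0 = 5 - 2.
  have c1 : (\sum_i Pi y i i @[y --> U]) --> \sum_i P0 i i.
    by apply: cvg_big => [|k _]; [exact: add_continuous|exact: cPi].
  have c2 : (\sum_i Pi y i i @[y --> U]) --> (5 - 2 : R).
    have c0 : ((fun=> 5 - 2 : R) @ U) --> (5 - 2 : R) by exact: cvg_cst.
    apply: cvg_trans c0; apply: near_eq_cvg.
    by apply: filterS US => y ky; apply/esym; exact: (trPi ky).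
  exact: (cvg_unique _ c1 c2).
have real0 : P0 *m A0 *m Jmx *m (P0 *m A0)^T = 0.
  have cPA : mcvg U (fun y => Pi y *m 'J G y) (P0 *m A0) by exact: mcvgM.
  have cJm : mcvg U (fun=> @Jmx R 3) Jmx by exact: mcvg_cst.
  have cPAJ : mcvg U (fun y => Pi y *m 'J G y *m Jmx) (P0 *m A0 *m Jmx) by exact: mcvgM.
  have c1 : mcvg U (fun y => Pi y *m 'J G y *m Jmx *m (Pi y *m 'J G y)^T)
    (P0 *m A0 *m Jmx *m (P0 *m A0)^T) by exact: (mcvgM cPAJ (mcvgT cPA)).
  have c2 : mcvg U (fun=> 0 : 'M[R]_(5, 5)) 0 by exact: mcvg_cst.
  have ev : \forall y \near U,
      Pi y *m 'J G y *m Jmx *m (Pi y *m 'J G y)^T = 0 :> 'M[R]_(5, 5).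
    by apply: filterS UOS => y [Oy ky]; exact: (graph_kernel_real Oy ky (PiH Oy ky)).
  exact: (mcvg_unique c1 c2 ev).
(* [graph_flat] starts at [y] rather than at 0, so the derivatives of [h] at [y] and at
   [x *m Pi y + y] agree. Along the ultrafilter they tend to those at 0, which vanish, and at
   [x *m P0]. *)
have flat0 (x v : 'rV[R]_5) : Om (x *m P0) -> 'D_v h (x *m P0) = 0.
  move=> Ox.
  have cxi : mcvg U (fun y : 'rV[R]_5 => x *m Pi y + y) (x *m P0 + 0).
    have cy : mcvg U (fun y : 'rV[R]_5 => y) 0.
      by move=> i j; rewrite (ord1 i); apply: cU; exact: differentiable_coord.
    have cc : mcvg U (fun=> x) x by exact: mcvg_cst.
    have cxP : mcvg U (fun y => x *m Pi y) (x *m P0) by exact: mcvgM.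
    exact: (mcvgD cxP cy).
  have cx : (x *m Pi y + y @[y --> U]) --> x *m P0.
    have E : x *m P0 + 0 = x *m P0 by exact: addr0.
    by move: cxi; rewrite E => cxi; exact: mcvg_rV.
  have dDv w : Om w -> differentiable ('D_v h) w.
    by move=> Ow; exact: smooth_diff (smooth_D v height_smooth) Ow.
  have c1 : ('D_v h (x *m Pi y + y) @[y --> U]) --> 'D_v h (x *m P0).
    have cD := differentiable_continuous (dDv _ Ox).
    exact: (@cvg_comp _ _ _ (fun y => x *m Pi y + y) ('D_v h) U _ _ cx cD).
  have c2 := cU _ (dDv _ Om0); rewrite Dh0 in c2.
  have nO : \forall y \near U, Om (x *m Pi y + y).
    exact: (cx _ (open_nbhs_nbhs (conj oOm Ox))).
  have ev : \forall y \near U, 'D_v h y = 'D_v h (x *m Pi y + y).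
    apply: filterS2 nO UOS => y Oxy [Oy ky].
    have xPH : x *m Pi y *m H y = 0 by rewrite -mulmxA (PiH Oy ky) mulmx0.
    exact: (esym (graph_flat v Oy ky xPH Oxy)).
  have c3 : ('D_v h (x *m Pi y + y) @[y --> U]) --> (0 : R).
    by apply: cvg_trans c2; apply: near_eq_cvg.
  exact: (cvg_unique _ c1 c3).
have rP : \rank P0 = 3.
  exact: mxrank_eq3.
(* [row_base P0] has [\rank P0] rows by its type; abstracting their number allows it to be replaced
   by 3. *)
suff : forall k (K : 'M[R]_(k, 5)), k = 3 -> row_free K -> K *m P0 = K ->
    exists (K : 'M[R]_(3, 5)) (r : R), [/\ 0 < r, r <= rho, row_free (K *m A0),
      K *m A0 *m Jmx *m (K *m A0)^T = 0 &
      forall s, `|s *m K| < r -> h (s *m K) = 0].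
  move=> /(_ _ (row_base P0) rP (row_base_free P0)); apply.
  have /submxP [D ->] : (row_base P0 <= P0)%MS by rewrite eq_row_base.
  by rewrite -mulmxA PP.
move=> k K k3; move: K; rewrite k3 => K fK KP.
exists K, rho; split; [exact: rho0|exact: lexx| | |].
- by rewrite /row_free mxrankMfree.
- have -> : K *m A0 *m Jmx *m (K *m A0)^T =
    K *m (P0 *m A0 *m Jmx *m (P0 *m A0)^T) *m K^T.
    by rewrite -[in LHS]KP !trmx_mul !mulmxA.
  by rewrite real0 mulmx0 mul0mx.
- apply: (height_zero (lexx _)) => s v sr; rewrite -KP mulmxA; apply: flat0.
  by rewrite -mulmxA KP.
Qed.

End GraphChart.

(** * Flat slices *)

Section OpenManifold.
Context {R : realType} {n : nat}.
Variables (W : set 'rV[R]_n) (oW : open W) (w0 : W).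

(** A chart inverse is a total function; outside [W] it takes the value [w0], which is why a point
    of [W] is required. *)
Definition open_inv (u : 'rV[R]_n) : W := insubd w0 u.

Lemma open_invK (u : 'rV[R]_n) : W u -> val (open_inv u) = u.
Proof. by move=> Wu; apply: insubdK; exact: mem_set. Qed.

Lemma open_valK (x : W) : open_inv (val x) = x.
Proof. exact: valKd. Qed.

Lemma set_valW (x : W) : W (val x).
Proof. exact: set_valP. Qed.

Lemma open_val_continuous : continuous (val : W -> 'rV[R]_n).
Proof. exact: (@initial_continuous W 'rV[R]_n set_val). Qed.

Definition open_chart : chart R n W.
Proof.
refine (@Chart R n W setT W val open_inv openT oW _ _ _ _ _ _).
- by move=> x _; exact: set_valW.
- by [].
- by move=> x _; exact: open_valK.
- exact: open_invK.
- by apply: continuous_subspaceT; exact: open_val_continuous.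
- apply/subspace_sigL_continuousP.
  have -> : sigL W open_inv = id by apply/funext => x; exact: open_valK.
  by move=> x.
Defined.

Lemma open_hausdorffW : hausdorff_space W.
Proof.
rewrite open_hausdorff => x y xy.
have vxy : val x != val y by apply: contra_neq xy; exact: val_inj.
have hV : hausdorff_space 'rV[R]_n by exact: norm_hausdorff.
rewrite open_hausdorff in hV.
have [[A B] /= [Ax By] [oA oB AB]] := hV _ _ vxy.
exists (val @^-1` A, val @^-1` B) => /=; first by rewrite !inE in Ax By *.
split.
- by apply: open_comp oA => z _; exact: open_val_continuous.
- by apply: open_comp oB => z _; exact: open_val_continuous.
- by rewrite -preimage_setI (eqP AB) preimage_set0.
Qed.

Lemma rational_near (u : 'rV[R]_n) (e : R) : 0 < e ->
  exists q : 'rV[rat]_n, `|u - map_mx ratr q| <= e.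
Proof.
move=> e0.
have ex j : exists q : rat, `|u 0 j - ratr q| <= e.
  have [q] := @rat_in_itvoo R (u 0 j - e) (u 0 j + e) ltac:(lra).
  by rewrite in_itv /= => /andP[q1 q2]; exists q; rewrite ler_norml; apply/andP; split; lra.
exists (\row_j sval (cid (ex j))).
apply: norm_coord_le => [|i j]; first exact: ltW.
by rewrite (ord1 i) !mxE; exact: (svalP (cid (ex j))).
Qed.

(** The base consists of the traces of balls with rational centre and radius [1 / (k + 1)]. A radius
    below [d / 2] and a centre within half of it from the point keep the ball around the point and
    inside its [d]-neighbourhood. *)
Lemma open_second_countable : @second_countable W.
Proof.
pose Bq (qk : 'rV[rat]_n * nat) : set W :=
  val @^-1` [set u : 'rV[R]_n | `|u - map_mx ratr qk.1| < qk.2.+1%:R^-1].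
exists (range Bq).
  exact: (sub_countable (card_image_le Bq setT) (countableP _)).
split.
  move=> _ [qk _ <-]; apply: open_comp; last exact: open_ball_norm.
  by move=> z _; exact: open_val_continuous.
move=> x V nV.
have [A [[A' oA' A'A] Ax AV]] : exists A : set W, [/\ open A, A x & A `<=` V].
  by move: nV; rewrite nbhsE => -[A [oA Ax] AV]; exists A.
have [d d0 Hd] : exists2 d : R, 0 < d & forall h, `|h - val x| < d -> A' h.
  apply: near_norm_ball; apply: open_nbhs_nbhs; split => //.
  by move: Ax; rewrite -A'A.
have [k kd] : exists k : nat, k.+1%:R^-1 < d / 2.
  have [k] := @ltr_add_invr R 0 (d / 2) ltac:(by rewrite divr_gt0).
  by rewrite add0r; exists k.
have k0 : 0 < k.+1%:R^-1 :> R by [].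
have [q hq] := rational_near (val x) (ltac:(by rewrite divr_gt0) : 0 < k.+1%:R^-1 / 2 :> R).
exists (Bq (q, k)).
  split; first by exists (q, k).
  rewrite /Bq /=; apply: le_lt_trans hq _.
  by rewrite ltr_pdivrMr // ltr_pMr // ltr1n.
move=> y; rewrite /Bq /= => yq; apply: AV; rewrite -A'A; apply: Hd.
have -> : val y - val x = (val y - map_mx ratr q) - (val x - map_mx ratr q).
  by rewrite opprB addrA subrK.
apply: le_lt_trans (ler_normB _ _) _.
have fin (a b e : R) : 0 < e -> a < e -> b <= e / 2 -> e < d / 2 -> a + b < d.
  by clear; lra.
exact: fin k0 yq hq kd.
Qed.

Lemma smooth_on_eq p (U : set 'rV[R]_n) (f g : 'rV[R]_n -> 'rV[R]_p) : open U ->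
  (forall u, U u -> f u = g u) -> smooth_on U f -> smooth_on U g.
Proof.
move=> oU fg Sf; apply/(smooth_onP _ oU) => j k.
by apply: Ck_eq ((smooth_onP _ oU).1 Sf j k) => // u /fg ->.
Qed.

Lemma open_chart_smooth (c d : chart R n W) : [set open_chart] c -> [set open_chart] d ->
  smooth_on (ccod c `&` cinv c @^-1` cdom d) (cmap d \o cinv c).
Proof.
move=> -> -> /=; rewrite preimage_setT setIT.
apply: smooth_on_eq (smooth_on_linear 1%:M oW) => // u Wu /=.
by rewrite mulmx1 open_invK.
Qed.

Definition open_manifold : smoothManifold R n :=
  @SmoothManifold R n W open_hausdorffW open_second_countable [set open_chart]
    (fun=> open_chart) (fun=> erefl) (fun=> I) open_chart_smooth.

End OpenManifold.

(** * Submanifolds whose image in the ambient space is affine *)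

Section AffineSlice.
Context {R : realType} {k n p : nat}.
Variables (W : set 'rV[R]_k) (U : set 'rV[R]_n).
Variables (Phi : 'rV[R]_k -> 'rV[R]_n) (F : 'rV[R]_n -> 'rV[R]_p).
Variables (p0 : 'rV[R]_p) (L : 'M[R]_(k, p)).
Hypotheses (oW : open W) (oU : open U).
Hypotheses (SPhi : smooth_on W Phi) (SF : smooth_on U F).
Hypothesis PhiU : forall s, W s -> U (Phi s).
Hypothesis FPhi : forall s, W s -> F (Phi s) = p0 + s *m L.

Lemma derive_affine (u v : 'rV[R]_k) : 'D_v (fun s => p0 + s *m L) u = v *m L.
Proof.
have dP : derivable (fun s => s *m L) u v.
  by apply: diff_derivable; exact: differentiable_mulmxr.
apply: etrans (deriveD (derivable_cst p0 u v) dP) _.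
by rewrite derive_cst add0r derive_mulmxr.
Qed.

Let dPhi s : W s -> differentiable Phi s.
Proof. exact: smooth_on_diff. Qed.

Let dF s : W s -> differentiable F (Phi s).
Proof. by move=> /PhiU; exact: smooth_on_diff. Qed.

Lemma derive_slice s v : W s -> 'D_v Phi s *m 'J F (Phi s) = v *m L.
Proof.
move=> Ws; apply: etrans (derive_affine s v).
have Ec (t : 'rV[R]_k) : W t -> p0 + t *m L = (F \o Phi) t by move=> /FPhi.
apply: etrans (esym (eq_on_derive _ oW Ec Ws)).
apply: etrans (esym (derive_comp _ (dPhi Ws) (dF Ws))).
rewrite mulmx_sum_row; apply: eq_bigr => i _.
by apply: congr2; [exact: derive_rV (dPhi Ws)|exact: row_jacobian (dF Ws)].
Qed.

Lemma jacobian_slice s : W s -> 'J Phi s *m 'J F (Phi s) = L.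
Proof.
move=> Ws; apply/row_matrixP => i; rewrite row_mul.
rewrite (row_jacobian _ (dPhi Ws)) (derive_slice _ Ws); exact: esym (rowE _ _).
Qed.

Let ddF s c : W s -> differentiable ('D_('e_c) F) (Phi s).
Proof. by move=> Ws; exact: smooth_on_diff (smooth_on_D _ SF) (PhiU Ws). Qed.

(** The second derivative of the affine map [F \o Phi] is zero; the chain rule splits it into these
    two sides. *)
Lemma second_derive_slice s i j : W s ->
  'D_('e_i) ('D_('e_j) Phi) s *m 'J F (Phi s) =
  - \sum_b \sum_c ('J Phi s i b * 'J Phi s j c) *: 'D_('e_b) ('D_('e_c) F) (Phi s).
Proof.
move=> Ws; apply/rowP => a.
(* For a fixed ambient coordinate [a], [Y] is the gradient of that coordinate of [F] along [Phi].
   The first-order identity [derive_slice] becomes a constant inner product, ready to be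
   differentiated. *)
pose Y t : 'rV[R]_n := \row_c ('D_('e_c) F (Phi t)) 0 a.
have EY t c : Y t 0 c = (('D_('e_c) F \o Phi) t) 0 a by rewrite mxE.
have dc c : differentiable ('D_('e_c) F \o Phi) s.
  exact: differentiable_comp (dPhi Ws) (ddF _ Ws).
have dYc c : differentiable (fun t => Y t 0 c) s.
  have -> : (fun t => Y t 0 c) = (fun t => (('D_('e_c) F \o Phi) t) 0 a).
    by apply/funext => t; exact: EY.
  exact: (differentiable_rV _ _).1 (dc c) a.
have dY : differentiable Y s by apply/differentiable_rV.
have dX : differentiable ('D_('e_j) Phi) s.
  exact: smooth_on_diff (smooth_on_D _ SPhi) Ws.
have JY t : W t -> Y t = row a ('J F (Phi t))^T.
  move=> Wt; apply/rowP => c; rewrite [LHS]mxE [RHS]mxE [RHS]mxE (jacobianE _ _ (dF Wt)).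
  exact: derive_rV (dF Wt).
have E0 t : W t -> dot ('D_('e_j) Phi t) (Y t) = row j L 0 a.
  move=> Wt; rewrite rowE.
  apply: etrans (congr1 (fun M : 'rV[R]_p => M 0 a) (derive_slice 'e_j Wt)).
  by rewrite (JY _ Wt) -mulmx_tr_row trmxK.
have D0 : 'D_('e_i) (fun t => dot ('D_('e_j) Phi t) (Y t)) s = 0.
  apply: etrans (eq_on_derive _ oW E0 Ws) _; exact: derive_cst.
have := etrans (esym (derive_dot _ dX dY)) D0.
move=> /eqP; rewrite addr_eq0 => /eqP; rewrite (JY _ Ws).
move=> E1.
rewrite -[in LHS](trmxK ('J F _)) mulmx_tr_row E1.
have EDc c : ('D_('e_i) Y s) 0 c =
    \sum_b 'J Phi s i b * ('D_('e_b) ('D_('e_c) F) (Phi s)) 0 a.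
  apply: etrans (derive_rV _ _ dY) _.
  have -> : (fun t => Y t 0 c) = (fun t => (('D_('e_c) F \o Phi) t) 0 a).
    by apply/funext => t; exact: EY.
  apply: etrans (esym (derive_rV _ _ (dc c))) _.
  apply: etrans (congr1 (fun M : 'rV[R]_p => M 0 a) (derive_comp _ (dPhi Ws) (ddF c Ws))) _.
  rewrite summxE; apply: eq_bigr => b _; rewrite mxE (jacobianE _ _ (dPhi Ws)).
  by [].
rewrite mxE summxE dotE; congr (- _).
have EJ c : ('D_('e_j) Phi s) 0 c = 'J Phi s j c.
  by rewrite (jacobianE _ _ (dPhi Ws)); exact: derive_rV (dPhi Ws).
under eq_bigr => c _ do rewrite EJ EDc mulr_sumr.
rewrite exchange_big; apply: eq_bigr => b _; rewrite summxE; apply: eq_bigr => c _.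
by rewrite [RHS]mxE -mulrA; exact: mulrCA.
Qed.

(** The metric of the slice is constant, so its Christoffel symbols vanish. Those of [g] express the
    tangential projection of the second derivatives of [F], which [second_derive_slice] identifies
    with minus the second derivative of [Phi]. *)
Lemma affine_totally_geodesic (gW : 'rV[R]_k -> 'M[R]_k) (g : 'rV[R]_n -> 'M[R]_n) s i j :
  (forall t, W t -> gW t = L *m L^T) -> (forall u, g u = 'J F u *m ('J F u)^T) ->
  (forall u, U u -> row_free ('J F u)) -> W s ->
  local_sff gW g Phi s i j = 0.
Proof.
move=> gWE gE fF Ws; have Us := PhiU Ws.
have dg a b e : 'D_('e_e) (fun v => gW v a b : R^o) s = 0.
  apply: etrans (eq_on_derive (g := fun=> (L *m L^T) a b) _ oW _ Ws) _.
    by move=> t Wt; rewrite gWE.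
  exact: derive_cst.
have c0 a : christoffel gW a i j s = 0.
  rewrite /christoffel big1 ?mulr0 // => b _.
  by rewrite !dg addr0 subr0 mulr0.
rewrite /local_sff; under [X in _ - X]eq_bigr => a _ do rewrite c0 scale0r.
rewrite big1 // subr0.
have gu : g (Phi s) \in unitmx by rewrite gE; apply: gram_unit; exact: fF.
pose D b c := 'D_('e_b) ('D_('e_c) F) (Phi s).
pose DD := \sum_b \sum_c ('J Phi s i b * 'J Phi s j c) *: D b c.
have gT : (g (Phi s))^T = g (Phi s) by rewrite gE trmx_mul trmxK.
have chE a b c : christoffel g a b c (Phi s) =
    (D b c *m ('J F (Phi s))^T *m invmx (g (Phi s))) 0 a.
  apply: etrans (christoffelE oU SF gE a b c Us) _; rewrite mxE.
  apply: eq_bigr => l _; rewrite mulmx_tr_row mulrC; congr (_ * _).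
    by rewrite /D (row_jacobian _ (dF Ws)).
  by rewrite -[in LHS]gT -trmx_inv mxE.
have -> : \row_a (\sum_b \sum_c christoffel g a b c (Phi s) * 'J Phi s i b * 'J Phi s j c)
    = DD *m ('J F (Phi s))^T *m invmx (g (Phi s)).
  apply/rowP => a; rewrite mxE /DD -mulmxA mulmx_suml summxE; apply: eq_bigr => b _.
  rewrite mulmx_suml summxE; apply: eq_bigr => c _.
  by rewrite -scalemxAl [RHS]mxE mulmxA -chE -mulrA mulrC.
have E2 : 'D_('e_i) ('D_('e_j) Phi) s *m 'J F (Phi s) = - DD.
  exact: second_derive_slice.
have -> : DD = - ('D_('e_i) ('D_('e_j) Phi) s *m 'J F (Phi s)).
  by rewrite E2 opprK.
by rewrite !mulNmx -(mulmxA _ ('J F _)) -gE mulmxK // subrr.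
Qed.

End AffineSlice.

Section FlatSlice.
Context {R : realType} {k n p : nat} {M : smoothManifold R n}.
Variables (f : M -> 'rV[R]_p) (f_imm : immersion f).
Variables (W : set 'rV[R]_k) (oW : open W) (w0 : W).
Variables (c : chart R n M) (t : 'rV[R]_k -> 'rV[R]_n).
Variables (p0 : 'rV[R]_p) (L : 'M[R]_(k, p)).
Hypotheses (ac : atlas c) (St : smooth_on W t) (tc : forall s, W s -> ccod c (t s)).
Hypothesis ft : forall s, W s -> f (cinv c (t s)) = p0 + s *m L.
Hypothesis fL : row_free L.

Let V := open_manifold oW w0.

Definition slice (s : V) : M := cinv c (t (val (s : W))).

Lemma sliceE u : W u -> slice (open_inv w0 u) = cinv c (t u).
Proof. by move=> Wu; rewrite /slice open_invK. Qed.

Lemma f_slice (s : V) : f (slice s) = p0 + val (s : W) *m L.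
Proof. by apply: ft; exact: set_valW. Qed.

Lemma slice_continuous : continuous slice.
Proof.
move=> s; have Ws := set_valW (s : W).
have cv : {for (s : W), continuous (val : W -> 'rV[R]_k)} by exact: open_val_continuous.
have ct : {for val (s : W), continuous t}.
  by apply: differentiable_continuous; exact: smooth_on_diff St Ws.
have cc : {for t (val (s : W)), continuous (cinv c)}.
  have := @cinv_continuous _ _ _ c.
  rewrite continuous_open_subspace; last exact: ccod_open.
  by move=> /(_ _ (mem_set (tc Ws))).
exact: (@continuous_comp W _ _ val (cinv c \o t) s cv (continuous_comp ct cc)).
Qed.

Let D (d : chart R n M) := W `&` (slice \o open_inv w0) @^-1` cdom d.

Let oD d : open (D d).
Proof.
have := @chart_open _ _ V (open_chart oW w0) (slice @^-1` cdom d).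
apply; apply: open_comp; last exact: cdom_open.
by move=> x _; exact: slice_continuous.
Qed.

Let C (d : chart R n M) := ccod c `&` cinv c @^-1` cdom d.

Let oC d : open (C d).
Proof. by apply: chart_open; exact: cdom_open. Qed.

Let DC d u : D d u -> C d (t u).
Proof. by move=> [Wu]; rewrite /= sliceE // => du; split => //; exact: tc. Qed.

Lemma slice_chart_smooth d : atlas d ->
  smooth_on (D d) (cmap d \o slice \o open_inv w0).
Proof.
move=> ad.
have StD : smooth_on (D d) t by move=> vs u [Wu _]; exact: St.
have := smooth_on_comp (@oD d) (@oC d) (@DC d) StD (atlas_smooth ac ad).
by apply: smooth_on_eq => // u [Wu _] /=; rewrite sliceE.
Qed.

Lemma slice_smooth : smooth_map slice.
Proof.
split; first exact: slice_continuous.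
by move=> e d -> ad; exact: slice_chart_smooth.
Qed.

Let d (y : V) := chart_at (slice y).
Let F y := f \o cinv (d y).

Let ad y : atlas (d y). Proof. exact: chart_at_atlas. Qed.

Let Sphi y : smooth_on (D (d y)) (local_map slice y).
Proof. exact: slice_chart_smooth. Qed.

Let SF y : smooth_on (ccod (d y)) (F y).
Proof. exact: f_imm.1. Qed.

Let phiU y s : D (d y) s -> ccod (d y) (local_map slice y s).
Proof. by move=> [Ws ds]; exact: cmap_cod. Qed.

Let Fphi y s : D (d y) s -> F y (local_map slice y s) = p0 + s *m L.
Proof.
move=> [Ws ds]; rewrite /F /local_map /= cmapK //.
by rewrite f_slice open_invK.
Qed.

Let Dy y : D (d y) (val (y : W)).
Proof.
split; first exact: set_valW.
by rewrite /= open_valK; exact: chart_at_dom.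
Qed.

Lemma slice_immersion y : row_free ('J (local_map slice y) (val (y : W))).
Proof.
have E := jacobian_slice (@oD _) (@Sphi y) (@SF y) (@phiU y) (@Fphi y) (Dy y).
by move: fL; rewrite -E -!row_leq_rank => H; exact: leq_trans H (mxrankM_maxl _ _).
Qed.

Lemma slice_inj : injective slice.
Proof.
move=> x y xy; have := f_slice x; rewrite xy f_slice => /addrI /(row_free_inj fL) H.
by apply: val_inj.
Qed.

Lemma immersion_continuous : continuous f.
Proof.
move=> x; set e := chart_at x; have ae : atlas e by exact: chart_at_atlas.
have ex : cdom e x by exact: chart_at_dom.
have cm : {for x, continuous (cmap e)}.
  have := @cmap_continuous _ _ _ e.
  rewrite continuous_open_subspace; last exact: cdom_open.
  by move=> /(_ x (mem_set ex)).
have cF : {for cmap e x, continuous (f \o cinv e)}.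
  apply: differentiable_continuous; apply: smooth_on_diff (f_imm.1 e ae) _.
  exact: cmap_cod.
have cc := continuous_comp cm cF.
rewrite /continuous_at -{2}(cmapK ex).
apply: cvg_trans cc; apply: near_eq_cvg.
near=> z; rewrite /= cmapK //; near: z.
by apply: open_nbhs_nbhs; split => //; exact: cdom_open.
Unshelve. all: by end_near.
Qed.

Lemma slice_embedding : smooth_embedding slice.
Proof.
split; [exact: slice_smooth|exact: slice_immersion|exact: slice_inj|].
move=> A [A' oA' A'A].
have [Q LQ] := row_freeP fL.
(* A continuous left inverse of the slice, defined on all of [M] through the ambient position: [Q]
   recovers the parameter [s] from [s *m L]. Open sets of parameters are pulled back along it. *)
pose l x := (f x - p0) *m Q.
exists (l @^-1` (A' `&` W)).
  apply: open_comp; last exact: openI.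
  move=> x _; have cf : {for x, continuous (fun x => f x - p0)}.
    by apply: cvgB; [exact: immersion_continuous|exact: cvg_cst].
  exact: (continuous_comp cf (@continuous_mulmxr _ _ _ Q _)).
have lE (s : V) : l (slice s) = val (s : W).
  by rewrite /l f_slice addrC addKr -mulmxA LQ mulmx1.
apply/seteqP; split => [_ [s As <-]|x [lx [s _ sx]]].
  split; last by exists s.
  rewrite /= lE; split; last exact: set_valW.
  by move: As; rewrite -A'A.
exists s => //; rewrite -A'A; move: lx; rewrite -sx /= lE.
by case.
Qed.

Let ftE u : W u -> p0 + u *m L = ((f \o slice) \o open_inv w0) u.
Proof. by move=> Wu /=; rewrite f_slice open_invK. Qed.

Let dfp u : differentiable (fun s => p0 + s *m L) u.
Proof.
by apply: differentiableD; [exact: differentiable_cst|exact: differentiable_mulmxr].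
Qed.

Lemma slice_jacobian u : W u -> 'J ((f \o slice) \o open_inv w0) u = L.
Proof.
move=> Wu; apply: etrans (esym (eq_on_jacobian oW ftE Wu (dfp u))) _.
apply/row_matrixP => i; rewrite row_jacobian // rowE; exact: derive_affine.
Qed.

Lemma slice_tangent (y : V) : tangent (f \o slice) y = L.
Proof. by apply: slice_jacobian; exact: set_valW. Qed.

Lemma slice_totally_geodesic : totally_geodesic slice f.
Proof.
move=> y i j; apply: (affine_totally_geodesic (@oD (d y)) _ (@Sphi y) (@SF y) (@phiU y)
  (@Fphi y) i j _ _ _ (Dy y)).
- exact: ccod_open.
- by move=> s [Ws _]; rewrite /induced_metric slice_jacobian.
- by [].
- by move=> u; exact: immersion_chart.
Qed.

End FlatSlice.

(** * The equality case *)

Lemma mulmx_tangent_proj (R : realType) (A : 'M[R]_(5, 3 + 3)) : row_free A ->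
  A *m tangent_proj A = 1%:M.
Proof. by move=> fA; rewrite /tangent_proj mulmxA mulmxV // gram_unit. Qed.

Section Ruled.
Context {R : realType} {N : smoothManifold R 5}.
Variables (f xi : N -> 'rV[R]_(3 + 3)).
Hypotheses (f_imm : immersion f) (xi_smooth : smooth_vec xi).
Hypothesis xi_normal : unit_normal_field f xi.
Hypothesis legendre : forall x, let c := chart_at x in
  xi x *m Jmx *m ('J (xi \o cinv c) (cmap c x))^T = 0.
Hypothesis tr0 : forall x, let c := chart_at x in
  \tr (second_form (f \o cinv c) (xi \o cinv c) (cmap c x)
       *m invmx (induced_metric f c (cmap c x))) = 0.

(** Projecting the displacement from the base point onto the tangent space has identity Jacobian
    there, so it can be inverted locally. In the new coordinates the hypersurface is a graph over
    its tangent space. *)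
Lemma tangential_chart (c : chart R 5 N) (u0 : 'rV[R]_5) : atlas c -> ccod c u0 ->
  exists2 rho, 0 < rho & exists th : 'rV[R]_5 -> 'rV[R]_5,
    [/\ smooth_on [set y | `|y| < rho] th, th 0 = u0 &
     forall y, `|y| < rho -> ccod c (th y) /\
       ((f \o cinv c) (th y) - (f \o cinv c) u0) *m tangent_proj ('J (f \o cinv c) u0) = y].
Proof.
move=> ac cu0; have oU := @ccod_open _ _ _ c.
set F := f \o cinv c; set P := tangent_proj _.
have SF : smooth_on (ccod c) F by exact: f_imm.1.
pose Th u := (F u - F u0) *m P.
have STh : smooth_on (ccod c) Th.
  apply: smooth_on_mulmxr => //; apply: smooth_onB => //; exact: smooth_on_cst.
have Th0 : Th u0 = 0 by rewrite /Th subrr mul0mx.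
have dF : differentiable F u0 by exact: smooth_on_diff SF cu0.
have dFc : differentiable (fun u => F u - F u0) u0.
  by apply: differentiableB => //; exact: differentiable_cst.
have JTh : 'J Th u0 = 1%:M.
  rewrite -(mulmx_tangent_proj (immersion_chart f_imm ac cu0)).
  apply/row_matrixP => i; rewrite row_mul.
  rewrite (row_jacobian _ dF) (row_jacobian _ (smooth_on_diff STh cu0)).
  apply: etrans (derive_mulmxr_comp P _ dFc) _; apply: (congr1 (fun v : 'rV[R]_(3 + 3) => v *m P)).
  apply: etrans (deriveB (diff_derivable dF) (derivable_cst _ _ _)) _.
  by rewrite derive_cst subr0.
have [rho rho0 [th [Sth th0 thP _]]] := inverse_function oU STh cu0 Th0 JTh.
by exists rho => //; exists th.
Qed.

Theorem legendre_ruled : totally_real_ruled (m := 3) f.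
Proof.
move=> x; set c := chart_at x; set u0 := cmap c x.
have ac : atlas c by exact: chart_at_atlas.
have cx : cdom c x by exact: chart_at_dom.
have cu0 : ccod c u0 by exact: cmap_cod.
have [rho rho0 [th [Sth th0 thP]]] := tangential_chart ac cu0.
have [K [r [r0 rrho fL LL hK]]] :=
  totally_real_directions f_imm xi_smooth xi_normal legendre tr0 ac cu0 rho0 Sth th0 thP.
set L := K *m _ in fL LL.
pose W := [set s : 'rV[R]_3 | `|s *m K| < r].
have oW : open W.
  rewrite (_ : W = (fun s => s *m K) @^-1` [set y | `|y| < r]) //.
  by apply: open_comp; [move=> s _; exact: continuous_mulmxr|exact: open_ball0].
have W0 : W 0 by rewrite /W /= mul0mx normr0.
have WB s : W s -> `|s *m K| < rho by move=> Ws; exact: lt_le_trans Ws rrho.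
have St : smooth_on W (th \o (fun s => s *m K)).
  have SK : smooth_on W (fun s => s *m K) by exact: smooth_on_linear.
  exact: (smooth_on_comp oW (@open_ball0 R 5 rho) WB SK Sth).
have tc s : W s -> ccod c ((th \o (fun s => s *m K)) s) by move=> /WB /thP[].
have ft s : W s -> f (cinv c ((th \o (fun s => s *m K)) s)) = (f \o cinv c) u0 + s *m L.
  (* The graph map is the affine tangential part plus the height along the normal, and the height
     vanishes on these parameters. *)
  move=> Ws; apply: etrans (graph_mapE f_imm xi_normal ac cu0 thP (WB _ Ws)) _.
  by rewrite (hK s Ws) scale0r addr0 /L mulmxA.
pose w0 : W := SigSub (mem_set W0).
exists (open_manifold oW w0), (@slice R 3 5 N W oW w0 c (th \o (fun s => s *m K))).
split.
- exact: (slice_embedding f_imm oW w0 ac St tc ft fL).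
- exists w0 => //; rewrite /slice /= mul0mx th0; exact: cmapK.
- move=> y v w; rewrite (slice_tangent ft) => /submxP[a ->] /submxP[b ->].
  rewrite cplxJE /dot trmx_mul mulmxA -(mulmxA a) -(mulmxA a).
  by rewrite LL mulmx0 mul0mx mxE.
- exact: (slice_totally_geodesic f_imm ac St tc ft).
Qed.

End Ruled.

Theorem theorem7p2 (R : realType) (N : smoothManifold R 5)
    (f : N -> 'rV[R]_(3 + 3)) (xi : N -> 'rV[R]_(3 + 3))
    (f_imm : immersion f) (xi_smooth : smooth_vec xi)
    (xi_normal : unit_normal_field f xi) :
  (forall x : N,
     Ric f x (cplxJ (xi x)) (cplxJ (xi x))
       <= 25 / 2 * dot (mean_curvature f x) (mean_curvature f x)) /\
  ((forall x : N,
      Ric f x (cplxJ (xi x)) (cplxJ (xi x))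
        = 25 / 2 * dot (mean_curvature f x) (mean_curvature f x)) ->
   totally_real_ruled (m := 3) f /\ minimal f).
Proof.
have Jtan x : (cplxJ (xi x) <= tangent f x)%MS.
  rewrite cplxJE; apply: (normal_submx (nu := xi x)) => //.
  - exact: f_imm.2.
  - have cx := chart_at_dom x.
    by have := normal_chart f_imm xi_normal (chart_at_atlas x) (cmap_cod cx); rewrite cmapK.
  - exact: (xi_normal x).1.
  - exact: dot_Jv.
have J1 x : dot (cplxJ (xi x)) (cplxJ (xi x)) = 1.
  by rewrite cplxJE dot_JJ; exact: (xi_normal x).1.
have key x := @ric_point R 5 (3 + 3) N f xi erefl f_imm xi_smooth xi_normal x _ (Jtan x) (J1 x).
have HE x := @mean_curvatureE R 5 (3 + 3) N f xi erefl f_imm xi_normal x.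
pose tau x := \tr (second_form (f \o cinv (chart_at x)) (xi \o cinv (chart_at x))
   (cmap (chart_at x) x) *m invmx (induced_metric f (chart_at x) (cmap (chart_at x) x))).
(* The mean curvature vector is [tau / 5] times a unit vector, so the factor 25 clears the average
   over 5 directions. *)
have H2 x : 25 / 2 * dot (mean_curvature f x) (mean_curvature f x) = tau x ^+ 2 / 2.
  rewrite HE dotZl dotZr (xi_normal x).1 mulr1 -/(tau x); move: (tau x) => a.
  by field.
split=> [x|eqR]; first by rewrite H2; exact: (key x).1.
have E x : tau x = 0 /\
    xi x *m Jmx *m ('J (xi \o cinv (chart_at x)) (cmap (chart_at x) x))^T = 0.
  by rewrite -cplxJE; apply: (key x).2; rewrite eqR H2.
split.
  by apply: (legendre_ruled f_imm xi_smooth xi_normal) => x; have [] := E x.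
by move=> x; rewrite HE -/(tau x) (E x).1 mulr0 scale0r.
Qed.
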